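(* One has $$\mu\left(\{z\in H:\ P_{|z|}\neq\mathbf P_z\}\right)>0 .$$
   Context: $H:=L^2(0,1)$ with inner product $\langle f,g\rangle=\int_0^1f_rg_r\,\mathrm dr$; $e_k(x)=\sqrt2\sin(k\pi x)$, $k\ge1$. $K:=\{z\in H:z\ge0\text{ a.e.}\}$. $\beta$ is a standard Brownian bridge from $0$ to $0$ over $[0,1]$, $\mu$ is its law on $H$, and $\nu$ is the law on $K$ of $|\beta|$ (equivalently, of the $1$-dimensional Bessel bridge from $0$ to $0$). $\mathcal F\mathcal C^\infty_b(H)$ is the set of functionals $F(z)=\psi(\langle l_1,z\rangle,\dots,\langle l_m,z\rangle)$ with $m\in\mathbb N$, $\psi\in C^\infty_b(\mathbb R^m)$, $l_1,\dots,l_m\in\mathrm{Span}\{e_k,k\ge1\}$; $\nabla F$ is the $L^2$-gradient. $\mathcal F\mathcal C^\infty_b(K)$ is the set of restrictions to $K$ of elements of $\mathcal F\mathcal C^\infty_b(H)$, with $\nabla(F|_K):=(\nabla F)|_K$. The form $\mathcal E(f,g):=\frac12\int_K\langle\nabla f,\nabla g\rangle\,\mathrm d\nu$ on $\mathcal F\mathcal C^\infty_b(K)$ is closable and its closure $(\mathcal E,D(\mathcal E))$ is a local, quasi-regular Dirichlet form on $L^2(\nu)$. Let $(\Omega,\mathcal F,(u_t)_{t\ge0},(\mathbb P_x)_{x\in K})$ be a diffusion process properly associated with $(\mathcal E,D(\mathcal E))$ (for every bounded Borel $\varphi\in L^2(\nu)$ and $t>0$, $x\mapsto\mathbb E_x[\varphi(u_t)]$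 is an $\mathcal E$-quasi-continuous version of $Q_t\varphi$, with $(Q_t)_{t\geq 0}$ the $L^2(\nu)$-semigroup of $\mathcal E$). $K^{\mathbb R_+}$ is the space of functions from $\mathbb R_+$ to $K$ with the product $\sigma$-algebra. For $x\in K$, $P_x$ is the law on $K^{\mathbb R_+}$ of $(u_t)_{t\ge0}$ started from $x$. For $z\in H$, $\mathbf P_z$ is the law on $K^{\mathbb R_+}$ of $(|v_t|)_{t\ge0}$, where $v$ is the solution of the stochastic heat equation $$\frac{\partial v}{\partial t}=\frac12\frac{\partial^2v}{\partial x^2}+\xi,\qquad v(0,\cdot)=z,\qquad v(t,0)=v(t,1)=0\ (t>0),$$ with $\xi$ a space-time white noise on $\mathbb R_+\times[0,1]$. *)

(* Defs.v *)
From HB Require Import structures.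
From mathcomp Require Import all_boot all_order all_algebra.
From mathcomp Require Import all_classical all_reals all_analysis.
From mathcomp Require Import interval_inference measurable_realfun.
Set Implicit Arguments.
Unset Strict Implicit.
Unset Printing Implicit Defensive.
Import Order.TTheory GRing.Theory Num.Theory.
Import numFieldNormedType.Exports.
Local Open Scope classical_set_scope.
Local Open Scope ring_scope.

Section L2.
Context {d} {T : measurableType d} {R : realType}.
Variable mu : {measure set T -> \bar R}.

(* The library's quotient L^2 space, equipped below with its normed module
   structure and its Borel sigma-algebra. *)
Definition L2 : Type := LspaceType2 mu.
Definition L2fun (f : L2) : T -> R := f.
Coercion L2fun : L2 >-> Funclass.

Local Notation MF := {mfun_ mu, T >-> measurableTypeR R}.

Lemma ae_eq_both (f g h k : T -> R) :
  f = g %[ae mu] -> h = k %[ae mu] ->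
  \forall x \near almost_everywhere mu, f x = g x /\ h x = k x.
Proof. by apply: filterS2 => x /(_ I) ? /(_ I). Qed.

Lemma repr_ae (f : {mfun T >-> measurableTypeR R}) :
  ((\pi_(MF)%qT f : MF) : T -> R) = (f : T -> R) %[ae mu].
Proof.
have : (repr (\pi_(MF)%qT f) == f %[mod MF])%qT by rewrite reprK.
by rewrite eqmodE => /asboolP.
Qed.

Lemma ae_eq_Lnorm (f g : T -> R) :
  measurable_fun setT f -> measurable_fun setT g ->
  f = g %[ae mu] ->
  ('N[mu]_2%:E[EFin \o f] = 'N[mu]_2%:E[EFin \o g])%E.
Proof.
have mp (h : T -> R) : measurable_fun setT h ->
    measurable_fun setT (fun x => (`|(h x)%:E| `^ 2)%E).
  move=> mh; apply: (measurableT_comp (measurable_poweR 2)).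
  by apply: measurableT_comp => //; exact/measurable_EFinP.
move=> mf mg fg; rewrite unlock.
rewrite (@ae_eq_integral _ _ _ mu setT (fun x => (`|(g x)%:E| `^ 2)%E)
  (fun x => (`|(f x)%:E| `^ 2)%E))//; [exact: mp..|].
by apply: filterS fg => x /= h /h ->.
Qed.

Lemma ae_eq_finite_norm (f g : T -> R) :
  measurable_fun setT f -> measurable_fun setT g ->
  f = g %[ae mu] -> finite_norm mu 2%:E f -> finite_norm mu 2%:E g.
Proof. by move=> mf mg fg; rewrite /finite_norm (ae_eq_Lnorm mf mg fg). Qed.

Lemma Lfun_mfun (f : T -> R) : f \in Lfun mu 2%:E -> measurable_fun setT f.
Proof. by rewrite inE => /andP[/[!inE]]. Qed.

Lemma Lfun_fin (f : T -> R) : f \in Lfun mu 2%:E -> finite_norm mu 2%:E f.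
Proof. by rewrite inE => /andP[_ /[!inE]]. Qed.

Lemma LfunI (f : T -> R) : measurable_fun setT f -> finite_norm mu 2%:E f ->
  f \in Lfun mu 2%:E.
Proof. by move=> mf nf; rewrite inE; apply/andP; split; rewrite inE. Qed.

Section mk.
Variables (f : T -> R) (fP : f \in Lfun mu 2%:E).
Let fm : {mfun T >-> measurableTypeR R} :=
  HB.pack (f : T -> measurableTypeR R) (isMeasurableFun.Build _ _ T (measurableTypeR R) f (Lfun_mfun fP)).
Let q : MF := \pi_(MF)%qT fm.
Let qfin : finite_norm mu 2%:E (q : T -> R).
Proof.
apply: (@ae_eq_finite_norm f) => //; last exact: Lfun_fin.
- exact: Lfun_mfun.
- exact: (measurable_funPT (repr q)).
- have := repr_ae fm; apply: filterS => x /= h /h ->; by [].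
Qed.
Definition L2_mk : L2 :=
  HB.pack q (isFinLebesgue.Build d T R mu 2%:E (lee1n 2) q qfin).

Lemma L2_mkE : (L2_mk : T -> R) = f %[ae mu].
Proof. exact: (repr_ae fm). Qed.
End mk.

Lemma L2_measurable (f : L2) : measurable_fun setT (f : T -> R).
Proof. exact: (measurable_funPT (repr (f : MF))). Qed.

Lemma L2_Lfun (f : L2) : (f : T -> R) \in Lfun mu 2%:E.
Proof.
by apply: LfunI; [exact: L2_measurable|case: f => q [[]]].
Qed.

Lemma L2_ext (f g : L2) : (f : T -> R) = g %[ae mu] -> f = g.
Proof.
case: f g => [q [[mq]]] [r [[mr]]] /= qr.
have {}qr : q = r.
  by rewrite -(reprK q) -(reprK r); apply/eqP; rewrite eqmodE; exact/asboolP.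
by subst r; rewrite (Prop_irrelevance mq mr).
Qed.

Lemma Lfun0 : (fun=> 0 : R) \in Lfun mu 2%:E.
Proof. exact: (LfunP (cst 0 : LfunType mu (lee1n 2))). Qed.

(* The class of f; a junk value (the class of 0) if f is not in L^2. *)
Definition cls (f : T -> R) : L2 :=
  if pselect (f \in Lfun mu 2%:E) is left h then L2_mk h else L2_mk Lfun0.

Lemma clsE f : f \in Lfun mu 2%:E -> (cls f : T -> R) = f %[ae mu].
Proof. by rewrite /cls; case: pselect => // h _; exact: L2_mkE. Qed.

Lemma LfunD f g : f \in Lfun mu 2%:E -> g \in Lfun mu 2%:E ->
  (fun x => f x + g x) \in Lfun mu 2%:E.
Proof. by move=> ? ?; apply: (Lfun_addr_closed mu (lee1n 2)).2. Qed.

Lemma LfunZ a f : f \in Lfun mu 2%:E -> (fun x => a * f x) \in Lfun mu 2%:E.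
Proof.
by move=> fP; have := Lfun_submod_closed mu (lee1n 2) => -[_ /(_ a f 0 fP)];
  rewrite addr0; apply; exact: Lfun0.
Qed.

HB.instance Definition _ := gen_eqMixin L2.
HB.instance Definition _ := gen_choiceMixin L2.

Definition L2_add (f g : L2) : L2 := cls (fun x => f x + g x).
Definition L2_opp (f : L2) : L2 := cls (fun x => -1 * f x).
Definition L2_scale (a : R) (f : L2) : L2 := cls (fun x => a * f x).

Lemma L2_addE f g : (L2_add f g : T -> R) = (fun x => f x + g x) %[ae mu].
Proof. by apply: clsE; apply: LfunD; exact: L2_Lfun. Qed.

Lemma L2_scaleE a f : (L2_scale a f : T -> R) = (fun x => a * f x) %[ae mu].
Proof. by apply: clsE; apply: LfunZ; exact: L2_Lfun. Qed.

Lemma L2_0E : (cls (fun=> 0) : T -> R) = (fun=> 0) %[ae mu].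
Proof. by apply: clsE; exact: Lfun0. Qed.

Lemma L2_addA : associative L2_add.
Proof.
move=> f g h; apply: L2_ext.
have := ae_eq_both (L2_addE f (L2_add g h)) (L2_addE g h).
have := ae_eq_both (L2_addE (L2_add f g) h) (L2_addE f g).
apply: filterS2 => x /= [e1 e2] [e3 e4] _.
by rewrite e3 e4 e1 e2 addrA.
Qed.

Lemma L2_addC : commutative L2_add.
Proof.
move=> f g; apply: L2_ext; have := L2_addE f g; have := L2_addE g f.
by apply: filterS2 => x /= + + _ => /(_ I) -> /(_ I) ->; rewrite addrC.
Qed.

Lemma L2_add0 : left_id (cls (fun=> 0)) L2_add.
Proof.
move=> f; apply: L2_ext; have := L2_addE (cls (fun=> 0)) f; have := L2_0E.
by apply: filterS2 => x /= + + _ => /(_ I) e1 /(_ I) ->; rewrite e1 add0r.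
Qed.

Lemma L2_addN : left_inverse (cls (fun=> 0)) L2_opp L2_add.
Proof.
move=> f; apply: L2_ext; have := L2_addE (L2_opp f) f; have := L2_0E.
have := L2_scaleE (-1) f.
apply: filterS3 => x /= + + + _ => /(_ I) e0 /(_ I) e1 /(_ I) e2.
by rewrite e2 e1 e0 mulN1r addNr.
Qed.

HB.instance Definition _ :=
  GRing.isZmodule.Build L2 L2_addA L2_addC L2_add0 L2_addN.

Lemma L2_scaleA a b f : L2_scale a (L2_scale b f) = L2_scale (a * b) f.
Proof.
apply: L2_ext; have := L2_scaleE a (L2_scale b f); have := L2_scaleE b f.
have := L2_scaleE (a * b) f.
apply: filterS3 => x /= + + + _ => /(_ I) e0 /(_ I) e1 /(_ I) e2.
by rewrite e2 e1 e0 mulrA.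
Qed.

Lemma L2_scale1 : left_id 1 L2_scale.
Proof.
move=> f; apply: L2_ext; have := L2_scaleE 1 f.
by apply: filterS => x /= + _ => /(_ I) ->; rewrite mul1r.
Qed.

Lemma L2_scaleDr : right_distributive L2_scale +%R.
Proof.
move=> a f g; apply: L2_ext.
have := ae_eq_both (L2_scaleE a (f + g)) (L2_addE f g).
have := L2_addE (L2_scale a f) (L2_scale a g).
have := ae_eq_both (L2_scaleE a f) (L2_scaleE a g).
apply: filterS3 => x /= [e1 e2] /(_ I) e3 [e4 e5] _.
by rewrite e3 e4 e1 e2 -mulrDr; congr (_ * _).
Qed.

Lemma L2_scaleDl f : {morph L2_scale^~ f : a b / a + b}.
Proof.
move=> a b; apply: L2_ext.
have := ae_eq_both (L2_scaleE a f) (L2_scaleE b f).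
have := ae_eq_both (L2_scaleE (a + b) f) (L2_addE (L2_scale a f) (L2_scale b f)).
apply: filterS2 => x /= [e1 e2] [e3 e4] _.
by rewrite e1 mulrDl -e3 -e4; exact/esym/e2.
Qed.

HB.instance Definition _ := GRing.Zmodule_isLmodule.Build R L2
  L2_scaleA L2_scale1 L2_scaleDr L2_scaleDl.

Definition L2_norm (f : L2) : R := fine ('N[mu]_2%:E[EFin \o (f : T -> R)])%E.

Lemma L2_normE (f : L2) (g : T -> R) : g \in Lfun mu 2%:E ->
  (f : T -> R) = g %[ae mu] -> L2_norm f = fine ('N[mu]_2%:E[EFin \o g])%E.
Proof.
move=> gP fg; rewrite /L2_norm (@ae_eq_Lnorm f g)//.
- exact: L2_measurable.
- exact: Lfun_mfun.
Qed.

Lemma L2_normD f g : L2_norm (f + g) <= L2_norm f + L2_norm g.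
Proof.
rewrite (L2_normE (LfunD (L2_Lfun f) (L2_Lfun g)) (L2_addE f g)).
exact: (ler_LnormD (Lfun_Sub (lee1n 2) (L2_Lfun f))
  (Lfun_Sub (lee1n 2) (L2_Lfun g))).
Qed.

Lemma L2_normZ a f : L2_norm (a *: f) = `|a| * L2_norm f.
Proof.
rewrite (L2_normE (LfunZ a (L2_Lfun f)) (L2_scaleE a f)).
have := LnormZ (Lfun_Sub (lee1n 2) (L2_Lfun f)) a; rewrite /= => ->.
by rewrite fineM//= -(finite_norm_fine (Lfun_Sub (lee1n 2) (L2_Lfun f))).
Qed.

Lemma L2_norm0 f : L2_norm f = 0 -> f = 0.
Proof.
move=> /(fine_Lnormr_eq0 (f := Lfun_Sub (lee1n 2) (L2_Lfun f))) f0.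
by apply: L2_ext; have := L2_0E; apply: filterS2 f0 => x /= + + _ => /(_ I) -> /(_ I) ->.
Qed.

HB.instance Definition _ :=
  Lmodule_isNormed.Build R L2 L2_normD L2_normZ L2_norm0.


Definition ip (f g : L2) : R := \int[mu]_x (f x * g x).

Lemma L2_normrE (f : L2) : `|f| ^+ 2 = ip f f.
Proof.
have N0 : ('N[mu]_2%:E[EFin \o (f : T -> R)] \is a fin_num)%E.
  by rewrite ge0_fin_numE ?Lnorm_ge0//; exact: Lfun_fin (L2_Lfun f).
rewrite -powR_mulrn ?normr_ge0//.
have -> : `|f| = fine ('N[mu]_2%:E[EFin \o (f : T -> R)])%E by [].
rewrite -fine_poweR powR_Lnorm// /ip /Rintegral; congr fine.
by apply: eq_integral => x _; rewrite /= ?poweR_EFin powR_mulrn// real_normK ?num_real// expr2.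
Qed.

HB.instance Definition _ :=
  Measurable.copy L2 (g_sigma_algebraType (@open L2)).

End L2.

Section spaces.
Variable R : realType.

Definition lebesgue01 : {measure set (measurableTypeR R) -> \bar R} :=
  mrestr lebesgue_measure (measurable_itv `]0, 1[).

Definition H : Type := L2 lebesgue01.
HB.instance Definition _ := NormedModule.on H.
HB.instance Definition _ := Measurable.on H.

(* Class of the restriction of f to (0, 1): the values of f elsewhere, even
   their measurability, are irrelevant. *)
Definition clsH (f : R -> R) : H := cls lebesgue01 (f \_ `]0, 1[).

Definition cone : set H := [set z | {ae lebesgue01, forall x, 0 <= z x}].

Lemma cone0 : (0 : H) \in cone.
Proof.
apply/mem_set; have := L2_0E lebesgue01.
by apply: filterS => x /(_ I) e; rewrite (e : (0 : H) x = 0).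
Qed.

Definition K : Type := set_type cone.
HB.instance Definition _ := Topological.on K.
HB.instance Definition _ := isPointed.Build K (SigSub cone0).
HB.instance Definition _ := Measurable.copy K (g_sigma_algebraType (@open K)).

Lemma Lfun_abs d (T : measurableType d) (mu : {measure set T -> \bar R})
  (f : T -> R) :
  f \in Lfun mu 2%:E -> (fun x => `|f x|) \in Lfun mu 2%:E.
Proof.
move=> fP; apply: LfunI; first by apply: measurableT_comp => //; exact: (Lfun_mfun fP).
have := Lfun_fin fP; rewrite /finite_norm -(Lnorm_abse _ (EFin \o f)).
exact.
Qed.

Definition absH (z : H) : H := cls lebesgue01 (fun x => `|z x|).

Lemma absH_cone z : absH z \in cone.
Proof.
apply/mem_set; have := clsE (Lfun_abs (L2_Lfun z)).
by apply: filterS => x /(_ I) e; rewrite (e : absH z x = `|z x|).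
Qed.

Definition absK (z : H) : K := SigSub (absH_cone z).

(* A real number read as an element of R_+; only used at nonnegative reals, or
   to extend a path on R_+ evenly to R when speaking of its continuity. *)
Definition time (s : R) : {nonneg R} := (`|s|)%:nng.

Definition path : Type := {nonneg R} -> K.
HB.instance Definition _ := Pointed.on path.
HB.instance Definition _ := Measurable.copy path (g_sigma_algebraType
  [set A : set path | exists t B, measurable B /\ A = (fun w => w t) @^-1` B]).

End spaces.

Definition same_law d (T : measurableType d) (R : realType)
    (m1 m2 : set T -> \bar R) : Prop :=
  forall A, measurable A -> m1 A = m2 A.

Definition has_law d d' (Om : measurableType d) (T : measurableType d')
    (R : realType) (P : probability Om R) (X : Om -> T) (m : set T -> \bar R) :=
  measurable_fun setT X /\ same_law (pushforward P X) m.

Section gaussian.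
Context {R : realType} {d} {Om : measurableType d} (P : probability Om R).

(* The library's normal_prob is not the Dirac mass when the variance is 0. *)
Definition centered_gaussian_law (v : R) : set (measurableTypeR R) -> \bar R :=
  if v == 0 then \d_(0 : measurableTypeR R) else normal_prob 0 (Num.sqrt v).

Definition centered_gaussian (X : Om -> measurableTypeR R) (v : R) : Prop :=
  has_law P X (centered_gaussian_law v).

Definition brownian_bridge (beta : R -> Om -> R) : Prop :=
  {ae P, forall w, {within `[0, 1], continuous (fun r => beta r w)}} /\
  forall n (t a : 'I_n -> R), (forall i, 0 <= t i <= 1) ->
    centered_gaussian (fun w => \sum_i a i * beta (t i) w)
      (\sum_i \sum_j a i * a j * (Num.min (t i) (t j) - t i * t j)).

(* The law of the bridge on H is that of this random element. *)
Definition path_class (beta : R -> Om -> R) (w : Om) : H R :=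
  clsH (fun r => beta r w).

Lemma measurable_spacetime :
  measurable ((`[0, +oo[ : set (measurableTypeR R)) `*`
              (`[0, 1] : set (measurableTypeR R))).
Proof. exact: measurableX. Qed.

Definition spacetime :
    {measure set (measurableTypeR R * measurableTypeR R) -> \bar R} :=
  mrestr (lebesgue_measure \x lebesgue_measure)%E measurable_spacetime.

(* Isonormal process on L^2(R_+ x [0, 1]). *)
Definition white_noise (W : L2 spacetime -> Om -> R) : Prop :=
  (forall h, centered_gaussian (W h) (`|h| ^+ 2)) /\
  forall a h k, {ae P, forall w, W (a *: h + k) w = a * W h w + W k w}.

Definition test_function (phi : R -> R) : Prop :=
  [/\ forall x, derivable phi x 1, forall x, derivable (derive1 phi) x 1,
      continuous (derive1 (derive1 phi)) & phi 0 = 0 /\ phi 1 = 0].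

(* Weak formulation of the stochastic heat equation. The test functions vanish
   at 0 and 1 but their derivatives need not, which encodes the Dirichlet
   condition; the third clause also states that condition pointwise. *)
Definition heat_solution (W : L2 spacetime -> Om -> R) (z : H R)
    (v : {nonneg R} -> Om -> H R) : Prop :=
  [/\ forall t, measurable_fun setT (v t),
      {ae P, forall w, v (time 0) w = z /\ continuous (fun s => v (time s) w)},
      forall t : {nonneg R}, 0 < t%:num -> {ae P, forall w, exists f : R -> R,
        [/\ {within `[0, 1], continuous f}, f 0 = 0, f 1 = 0 & v t w = clsH f]} &
      forall phi (t : {nonneg R}), test_function phi -> {ae P, forall w,
        ip (v t w) (clsH phi) = ip z (clsH phi)
          + 2^-1 * \int[lebesgue_measure]_(s in `[0, t%:num])
                      ip (v (time s) w) (clsH (derive1 (derive1 phi)))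
          + W (cls spacetime (fun p => \1_`[0, t%:num] p.1 * phi p.2)) w}].

End gaussian.
Arguments spacetime : clear implicits.

Section cylinder.
Variable R : realType.

Definition basis (k : nat) : H R :=
  clsH (fun x => Num.sqrt 2 * sin (k%:R * pi * x)).

Definition basis_span : set (H R) :=
  [set l | exists n (a : nat -> R), l = \sum_(1 <= k < n.+1) a k *: basis k].

Definition iter_partial m (s : seq 'I_m) (psi : 'rV[R]_m -> R) : 'rV[R]_m -> R :=
  foldr (fun i f => 'D_(delta_mx 0 i) f) psi s.

(* Existence and continuity of all iterated partial derivatives amounts to
   smoothness. *)
Definition Cb_infty m (psi : 'rV[R]_m -> R) : Prop :=
  forall s : seq 'I_m,
    [/\ continuous (iter_partial s psi),
        exists M, forall y, `|iter_partial s psi y| <= M &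
        forall y i, derivable (iter_partial s psi) y (delta_mx 0 i)].

Definition FCb : set (H R -> R) :=
  [set F | exists m (l : 'I_m -> H R) (psi : 'rV[R]_m -> R),
    [/\ forall i, basis_span (l i), Cb_infty psi &
        forall z, F z = psi (\row_i ip (l i) z)]].

Definition L2_gradient (F : H R -> R) (z : H R) : H R :=
  xget 0 [set g | differentiable F z /\ forall h, 'd F z h = ip g h].

Section form.
Variable nu : probability (K R) R.

Definition restr (F : H R -> R) : L2 nu := cls nu (fun x => F (\val x)).

(* The pre-form at (F|_K, G|_K). *)
Definition preform (F G : H R -> R) : R :=
  2^-1 * \int[nu]_x ip (L2_gradient F (\val x)) (L2_gradient G (\val x)).

Definition approximates (F : nat -> H R -> R) (f : L2 nu) : Prop :=
  [/\ forall n, FCb (F n), restr (F n) @[n --> \oo] --> f &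
      forall e, 0 < e -> exists N, forall n m, (N <= n)%N -> (N <= m)%N ->
        preform (F n \- F m) (F n \- F m) < e].

(* The closure of the pre-form: closability means that the limit below
   does not depend on the approximating sequences. *)
Definition domE : set (L2 nu) := [set f | exists F, approximates F f].

Definition formE (f g : L2 nu) : R :=
  xget 0 [set c | exists F G, [/\ approximates F f, approximates G g &
                    preform (F n) (G n) @[n --> \oo] --> c]].

Definition formE1 (f : L2 nu) : R := formE f f + `|f| ^+ 2.

Definition contraction_semigroup (Q : {nonneg R} -> L2 nu -> L2 nu) : Prop :=
  [/\ forall t a f g, Q t (a *: f + g) = a *: Q t f + Q t g,
      forall t f, `|Q t f| <= `|f|,
      forall f, Q (time 0) f = f,
      forall s t f, Q (s%:num + t%:num)%:nng f = Q s (Q t f) &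
      forall f, Q (time s) f @[s --> 0^'+] --> f].

(* The generator L of Q is the one of the closed form: f is in D(L) with L f = g
   iff f is in D(E) and E(f, h) = - <g, h> for all h in D(E). *)
Definition semigroup_of_form (Q : {nonneg R} -> L2 nu -> L2 nu) : Prop :=
  contraction_semigroup Q /\
  forall f g, (s^-1 *: (Q (time s) f - f) @[s --> 0^'+] --> g) <->
    domE f /\ forall h, domE h -> formE f h = - ip g h.

(* The last clause: the f in D(E) vanishing a.e. outside some F_n are dense in
   D(E) for the norm E_1^(1/2). *)
Definition E_nest (F : nat -> set (K R)) : Prop :=
  [/\ forall n, closed (F n), forall n, F n `<=` F n.+1 &
      forall f e, domE f -> 0 < e -> exists n g,
        [/\ domE g, {ae nu, forall x, ~ F n x -> g x = 0} & formE1 (f - g) < e]].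

Definition quasi_continuous (f : K R -> R) : Prop :=
  exists2 F, E_nest F & forall n, {within F n, continuous f}.

End form.

Section process.
Context {d} {Om : measurableType d}.

Definition path_of (u : {nonneg R} -> Om -> K R) (w : Om) : path R :=
  fun t => u t w.

Definition filtration (F : {nonneg R} -> set (set Om)) : Prop :=
  [/\ forall t, sigma_algebra setT (F t),
      forall t, F t `<=` measurable,
      forall s t : {nonneg R}, s%:num <= t%:num -> F s `<=` F t &
      forall (t : {nonneg R}) A,
        (forall s : {nonneg R}, t%:num < s%:num -> F s A) -> F t A].

Definition stopping_time (F : {nonneg R} -> set (set Om)) (tau : Om -> \bar R) :=
  (forall w, (0 <= tau w)%E) /\
  forall t : {nonneg R}, F t [set w | (tau w <= t%:num%:E)%E].

Definition before (F : {nonneg R} -> set (set Om)) (tau : Om -> \bar R) :=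
  [set A : set Om | measurable A /\
     forall t : {nonneg R}, F t (A `&` [set w | (tau w <= t%:num%:E)%E])].

(* Conservative right process (strong Markov, for the stopping times of a
   right-continuous filtration) with almost surely continuous paths. *)
Record diffusion (F : {nonneg R} -> set (set Om)) (u : {nonneg R} -> Om -> K R)
    (P : K R -> probability Om R) : Prop := Diffusion {
  diffusion_filtration : filtration F ;
  diffusion_adapted : forall t B, measurable B -> F t (u t @^-1` B) ;
  diffusion_kernel : forall A : set (path R), measurable A ->
    measurable_fun setT (fun x => P x (path_of u @^-1` A)) ;
  diffusion_start : forall x, {ae P x, forall w, u (time 0) w = x} ;
  diffusion_right_continuous : forall w (t : {nonneg R}),
    u (time s) w @[s --> t%:num^'+] --> u t w ;
  diffusion_continuous : forall x,
    {ae P x, forall w, continuous (fun s => u (time s) w)} ;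
  diffusion_strong_markov : forall x tau A (t : {nonneg R}) B,
    stopping_time F tau -> before F tau A -> measurable B ->
    let A' := A `&` [set w | (tau w < +oo)%E] in
    P x (A' `&` [set w | B (u (time (fine (tau w) + t%:num)) w)]) =
    (\int[P x]_(w in A') P (u (time (fine (tau w))) w) (u t @^-1` B))%E }.

Definition properly_associated (nu : probability (K R) R)
    (Q : {nonneg R} -> L2 nu -> L2 nu)
    (u : {nonneg R} -> Om -> K R) (P : K R -> probability Om R) : Prop :=
  forall (phi : K R -> R) (t : {nonneg R}), measurable_fun setT phi ->
    (exists M, forall x, `|phi x| <= M) -> 0 < t%:num ->
    let p x := \int[P x]_w phi (u t w) in
    quasi_continuous nu p /\ p = Q t (cls nu phi) %[ae nu].

End process.
End cylinder.

(* Main.v *)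
(* At a fixed large time t, the midpoint value of the solution started from z is
   m(z) + Y, with m linear and Y a symmetric variable not depending on z. If z and
   z' lie outside the exceptional set and |z| = |z'|, then |m(z) + Y| and
   |m(z') + Y| have the same law, and comparing
   E cos(th |m(z) + Y|) = cos(th m(z)) E cos(th Y) for small th gives
   |m(z)| = |m(z')|.

   Were the exceptional set null, this would hold almost surely for z a bridge X
   and z' the bridge obtained from X by changing its sign after its first zero
   after 1/2. Hence m(head) m(tail) = 0, where the tail is the part of X after
   that zero. Reflecting X in the Cameron-Martin space along a functional whose
   dual path is supported in [0, 1/2] moves the head but not the tail, so
   m(tail) = 0 almost surely. Reflecting along a functional whose dual path is
   supported in [5/6, 1] moves the tail on the event X(1/2) X(5/6) <= 0, which is
   therefore null. But one of four explicit reflections of X always belongs to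
   that event. Both dual paths are positive, so that m does not vanish on them for
   large t, when the first eigenfunction dominates m. *)
Require Import Defs.
From HB Require Import structures.
From mathcomp Require Import all_boot all_order all_algebra.
From mathcomp Require Import all_classical all_reals all_analysis.
From mathcomp Require Import interval_inference measurable_realfun.
From mathcomp Require Import ring lra zify.
Set Implicit Arguments.
Unset Strict Implicit.
Unset Printing Implicit Defensive.
Import Order.TTheory GRing.Theory Num.Theory.
Import numFieldNormedType.Exports.
Local Open Scope classical_set_scope.
Local Open Scope ring_scope.

(** Let h and k be the values of m on the head and the tail. Equality of |h + k| and |h - k| means h
    k = 0. A reflection along a functional l subtracts 2 l(X) m(dual path) from one of the two
    values and fixes the other. It keeps the law of X, being an isometry of the Cameron-Martin
    space, and l(X) is almost surely nonzero. So h k = 0 before and after moving h forces k = 0, and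
    k = 0 before and after moving k is absurd. Both moves require that the zero where the sign
    changes stays in place. This is automatic for a reflection acting on [0, 1/2]. For one acting on
    [5/6, 1] the zero must come before 5/6, hence the event X(1/2) X(5/6) <= 0. Elements of H have
    no point values, so the midpoint value is a limit of pairings with kernels concentrating at 1/2.
    These are taken in the span of the eigenfunctions, so that each pairing reduces to finitely many
    scalar linear equations. Invariance under the sign change is a strong Markov statement. It is
    obtained by approaching the zero from above along dyadic grids: for each value of the grid time
    the change is a linear reflection at a fixed time, and a covariance computation suffices. *)

Section bounded_expectation.
Context {R : realType} {d} {Om : measurableType d} (P : probability Om R).

Definition bounded_mfun (f : Om -> R) :=
  measurable_fun setT f /\ exists M, forall x, `|f x| <= M.

Lemma bounded_mfun_integrable f : bounded_mfun f ->
  P.-integrable setT (EFin \o f).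
Proof.
move=> [mf [M fM]]; apply: measurable_bounded_integrable => //.
  by rewrite (le_lt_trans (probability_le1 _ _)) ?ltry.
by exists M; split; [exact: num_real|move=> N MN x _; exact: le_trans (fM x) (ltW MN)].
Qed.

Lemma bounded_mfunD f g : bounded_mfun f -> bounded_mfun g ->
  bounded_mfun (fun x => f x + g x).
Proof.
move=> [mf [M fM]] [mg [N gN]]; split; first exact: measurable_funD.
by exists (M + N) => x; rewrite (le_trans (ler_normD _ _)) ?lerD.
Qed.

Lemma bounded_mfunM f g : bounded_mfun f -> bounded_mfun g ->
  bounded_mfun (fun x => f x * g x).
Proof.
move=> [mf [M fM]] [mg [N gN]]; split; first exact: measurable_funM.
by exists (M * N) => x; rewrite normrM ler_pM.
Qed.

Lemma bounded_mfun_cst c : bounded_mfun (fun=> c).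
Proof. by split => //; exists `|c|. Qed.

Lemma bounded_mfunZ a f : bounded_mfun f -> bounded_mfun (fun x => a * f x).
Proof. by move=> bf; apply: bounded_mfunM => //; exact: bounded_mfun_cst. Qed.

Lemma bounded_mfun_sum I (s : seq I) (f : I -> Om -> R) :
  (forall i, bounded_mfun (f i)) -> bounded_mfun (fun x => \sum_(i <- s) f i x).
Proof.
move=> bf; elim: s => [|i s ih].
  by under eq_fun do rewrite big_nil; exact: bounded_mfun_cst.
by under eq_fun do rewrite big_cons; exact: bounded_mfunD.
Qed.

Lemma bounded_mfun_cos f : measurable_fun setT f ->
  bounded_mfun (fun x => cos (f x)).
Proof.
move=> mf; split; last by exists 1 => x; exact: cos_max.
by apply: measurableT_comp mf; apply: continuous_measurable_fun; exact: continuous_cos.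
Qed.

Lemma bounded_mfun_sin f : measurable_fun setT f ->
  bounded_mfun (fun x => sin (f x)).
Proof.
move=> mf; split; last by exists 1 => x; exact: sin_max.
by apply: measurableT_comp mf; apply: continuous_measurable_fun; exact: continuous_sin.
Qed.

Lemma bounded_mfun_indic A : measurable A -> bounded_mfun (\1_A : Om -> R).
Proof.
move=> mA; split; first exact: measurable_indic.
by exists 1 => x; rewrite indicE; case: (_ \in _); rewrite ?normr1 ?normr0.
Qed.

Lemma expD f g : bounded_mfun f -> bounded_mfun g ->
  \int[P]_x (f x + g x) = \int[P]_x f x + \int[P]_x g x.
Proof. by move=> bf bg; rewrite RintegralD//; exact: bounded_mfun_integrable. Qed.

Lemma expZ a f : bounded_mfun f -> \int[P]_x (a * f x) = a * \int[P]_x f x.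
Proof. by move=> bf; rewrite RintegralZl//; exact: bounded_mfun_integrable. Qed.

Lemma exp_sum I (s : seq I) (f : I -> Om -> R) :
  (forall i, bounded_mfun (f i)) ->
  \int[P]_x (\sum_(i <- s) f i x) = \sum_(i <- s) \int[P]_x f i x.
Proof.
move=> bf; elim: s => [|i s ih].
  under eq_Rintegral do rewrite big_nil.
  by rewrite big_nil Rintegral_cst// mul0r.
under eq_Rintegral do rewrite big_cons.
by rewrite expD ?ih ?big_cons//; exact: bounded_mfun_sum.
Qed.

Lemma exp_indic A : measurable A -> (\int[P]_x (\1_A x : R))%:E = P A.
Proof.
move=> mA; rewrite /Rintegral fineK; last first.
  exact: integrable_fin_num (bounded_mfun_integrable (bounded_mfun_indic mA)).
by rewrite integral_indic// setIT.
Qed.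

Lemma exp_ae_eq (f g : Om -> R) : measurable_fun setT f -> measurable_fun setT g ->
  {ae P, forall x, f x = g x} -> \int[P]_x f x = \int[P]_x g x.
Proof.
move=> mf mg fg; rewrite /Rintegral; congr fine; apply: ae_eq_integral => //.
- exact/measurable_EFinP.
- exact/measurable_EFinP.
- by apply: filterS fg => x /= -> _.
Qed.

Lemma prob_ae_eq (A B : set Om) : measurable A -> measurable B ->
  {ae P, forall w, A w <-> B w} -> P A = P B.
Proof.
move=> mA mB AB; rewrite -(exp_indic mA) -(exp_indic mB); congr EFin.
apply: exp_ae_eq; [exact: measurable_indic|exact: measurable_indic|].
apply: filterS AB => w AB; rewrite !indicE; congr (nat_of_bool _)%:R.
by apply/idP/idP; rewrite !inE => /AB.
Qed.

Lemma ae_prob0 (A : set Om) : measurable A -> P A = 0 -> {ae P, forall w, ~ A w}.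
Proof. by move=> mA A0; exists A; split => // w /= /contrapT. Qed.

Lemma ae_ex (Q : Om -> Prop) : {ae P, forall w, Q w} -> exists w, Q w.
Proof.
move=> [N [mN N0 hN]]; apply: contrapT => nQ.
suff NT : N = setT by move: N0; rewrite NT probability_setT => /eqP; rewrite onee_eq0.
by apply/seteqP; split => // w _; apply: hN => Qw; apply: nQ; exists w.
Qed.

Lemma bounded_cvg (f_ : nat -> Om -> R) (f : Om -> R) M :
  (forall n, measurable_fun setT (f_ n)) -> measurable_fun setT f ->
  (forall n x, `|f_ n x| <= M) ->
  {ae P, forall x, f_ n x @[n --> \oo] --> f x} ->
  \int[P]_x f_ n x @[n --> \oo] --> \int[P]_x f x.
Proof.
move=> mf_ mf bf cf.
have iM : P.-integrable setT (EFin \o cst M).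
  exact: bounded_mfun_integrable (bounded_mfun_cst M).
have cf' : {ae P, forall x, setT x -> ((f_ n x)%:E @[n --> \oo] --> (f x)%:E)%E}.
  by apply: filterS cf => x h _; apply/cvg_EFin => //; exact: nearW.
have [|||||fi _ h] := @dominated_convergence _ _ _ P setT measurableT
  (fun n => EFin \o f_ n) (EFin \o f) (EFin \o cst M) => //.
- by move=> n; exact/measurable_EFinP.
- exact/measurable_EFinP.
- by apply: aeW => x n _; rewrite lee_fin.
rewrite /Rintegral; apply: fine_cvg; rewrite fineK//; exact: integrable_fin_num fi.
Qed.

Lemma bounded_cvgT (f_ : nat -> Om -> R) (f : Om -> R) M :
  (forall n, measurable_fun setT (f_ n)) ->
  (forall n x, `|f_ n x| <= M) ->
  (forall x, f_ n x @[n --> \oo] --> f x) ->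
  \int[P]_x f_ n x @[n --> \oo] --> \int[P]_x f x.
Proof.
move=> mf_ bf cf; apply: (bounded_cvg (M := M)) => //; last exact: aeW.
by apply: (measurable_fun_cvg (h := f_)).
Qed.

End bounded_expectation.

Lemma same_law_exp {R : realType} d d' d'' (Om : measurableType d)
    (Om' : measurableType d') (T : measurableType d'') (P : probability Om R)
    (P' : probability Om' R) (X : Om -> T) (Y : Om' -> T) (phi : T -> R) :
  measurable_fun setT X -> measurable_fun setT Y ->
  (forall A, measurable A -> P (X @^-1` A) = P' (Y @^-1` A)) ->
  bounded_mfun phi ->
  \int[P]_w phi (X w) = \int[P']_w phi (Y w).
Proof.
move=> mX mY XY bphi; have [mphi [M phiM]] := bphi; rewrite /Rintegral; congr fine.
rewrite -[LHS](@integral_pushforward _ _ _ _ _ X mX P setT (EFin \o phi))//; first last.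
- apply: bounded_mfun_integrable; split; first exact: measurableT_comp.
  by exists M => x; exact: phiM.
- exact/measurable_EFinP.
rewrite -[RHS](@integral_pushforward _ _ _ _ _ Y mY P' setT (EFin \o phi))//; first last.
- apply: bounded_mfun_integrable; split; first exact: measurableT_comp.
  by exists M => x; exact: phiM.
- exact/measurable_EFinP.
by apply: eq_measure_integral => A mA _; exact: XY.
Qed.

(** * Laws of continuous paths *)

Section trig.
Variable R : realType.

Definition unit_time (t : R) := 0 <= t <= 1.

(** A list of pairs (weight, time) encodes a finitely supported signed measure, acting on paths. *)
Definition lin (l : seq (R * R)) (x : R -> R) := \sum_(p <- l) p.1 * x p.2.

Definition times_in (l : seq (R * R)) := forall p, p \in l -> unit_time p.2.

Lemma lin_cat l l' x : lin (l ++ l') x = lin l x + lin l' x.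
Proof. by rewrite /lin big_cat. Qed.

Definition scale_lin (a : R) (l : seq (R * R)) := [seq (a * p.1, p.2) | p <- l].

Lemma lin_scale a l x : lin (scale_lin a l) x = a * lin l x.
Proof.
by rewrite /lin big_map mulr_sumr; apply: eq_bigr => p _; rewrite mulrA.
Qed.

Lemma times_in_cat l l' : times_in l -> times_in l' -> times_in (l ++ l').
Proof. by move=> h h' p; rewrite mem_cat => /orP[/h|/h']. Qed.

Lemma times_in_scale a l : times_in l -> times_in (scale_lin a l).
Proof. by move=> h p /mapP[q /h hq ->]. Qed.

(** Trigonometric polynomials in finitely many values of the path. The free phase covers sines and
    makes the class closed under products. *)
Inductive trig : ((R -> R) -> R) -> Prop :=
| trig_cos l c : times_in l -> trig (fun x => cos (lin l x + c))
| trig_add f g : trig f -> trig g -> trig (fun x => f x + g x)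
| trig_scale a f : trig f -> trig (fun x => a * f x).

Lemma trig_cst a : trig (fun=> a).
Proof.
rewrite [X in trig X](_ : _ = fun x : R -> R => a * cos (lin [::] x + 0)).
  by apply: trig_scale; apply: trig_cos.
by apply/funext => x; rewrite /lin big_nil addr0 cos0 mulr1.
Qed.

Lemma cosMcos (a b : R) : cos a * cos b = 2^-1 * cos (a + b) + 2^-1 * cos (a - b).
Proof.
by rewrite cosD cosB; field.
Qed.

Lemma trig_mul f g : trig f -> trig g -> trig (fun x => f x * g x).
Proof.
move=> tf tg; elim: tf => [l c lt|{}f1 f2 _ ih1 _ ih2|a {}f1 _ ih]; last 2 first.
- by under eq_fun do rewrite mulrDl; exact: trig_add.
- by under eq_fun do rewrite -mulrA; exact: trig_scale.
elim: tg => [l' c' lt'|g1 g2 _ ih1 _ ih2|a g1 _ ih]; last 2 first.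
- by under eq_fun do rewrite mulrDr; exact: trig_add.
- by under eq_fun do rewrite mulrCA; exact: trig_scale.
rewrite [X in trig X](_ : _ = fun x : R -> R =>
    2^-1 * cos (lin (l ++ l') x + (c + c')) +
    2^-1 * cos (lin (l ++ scale_lin (- 1) l') x + (c - c'))).
  by apply: trig_add; apply: trig_scale; apply: trig_cos; apply: times_in_cat => //;
    exact: times_in_scale.
apply/funext => x; rewrite cosMcos !lin_cat lin_scale.
by congr (_ * cos _ + _ * cos _); ring.
Qed.

Lemma trig_exp f n : trig f -> trig (fun x => f x ^+ n).
Proof.
move=> tf; elim: n => [|n ih]; first exact: trig_cst.
by under eq_fun do rewrite exprS; exact: trig_mul.
Qed.

Lemma trig_prod I (s : seq I) (f : I -> (R -> R) -> R) :
  (forall i, trig (f i)) -> trig (fun x => \prod_(i <- s) f i x).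
Proof.
move=> tf; elim: s => [|i s ih].
  by under eq_fun do rewrite big_nil; exact: trig_cst.
by under eq_fun do rewrite big_cons; exact: trig_mul.
Qed.

(* The exponents are such that [1 - u ^ n] raised to them tends to 1 if u < 1/2,
   to 0 if u >= 1/2. *)
Definition step_poly (n : nat) (u : R) := (1 - u ^+ n) ^+ (n * 2 ^ n).

Lemma bernoulli_le (x : R) n : 0 <= x <= 1 -> 1 - n%:R * x <= (1 - x) ^+ n.
Proof.
move=> /andP[x0 x1]; elim: n => [|n ih]; first by rewrite expr0 mul0r subr0.
rewrite exprS (le_trans _ (ler_wpM2l _ ih)) ?subr_ge0//.
rewrite -subr_ge0 -natr1.
rewrite [leRHS](_ : _ = n%:R * (x * x)); last by ring.
by rewrite mulr_ge0// mulr_ge0.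
Qed.

Lemma step_poly_bound n u : 0 <= u <= 1 -> 0 <= step_poly n u <= 1.
Proof.
move=> /andP[u0 u1].
have h0 : 0 <= u ^+ n by rewrite exprn_ge0.
have h1 : u ^+ n <= 1 by rewrite exprn_ile1.
by rewrite /step_poly exprn_ge0 ?subr_ge0//= exprn_ile1 ?subr_ge0// lerBlDr lerDl.
Qed.

Lemma natMexpr_cvg0 (q : R) : 0 <= q < 1 -> n%:R * q ^+ n @[n --> \oo] --> 0.
Proof.
move=> /andP[q0 q1].
(* One factor p ^ n absorbs n, since n p ^ n (1 - p) <= 1; the other still tends to 0. *)
pose p := Num.sqrt q.
have p0 : 0 <= p by exact: sqrtr_ge0.
have p1 : p < 1 by rewrite -sqrtr1 ltr_sqrt.
have qE : q = p * p by rewrite -expr2 sqr_sqrtr.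
have bd n : n%:R * p ^+ n * (1 - p) <= 1.
  elim: n => [|n ih]; first by rewrite mul0r mul0r.
  have pn : 0 <= p ^+ n * (1 - p) by rewrite mulr_ge0 ?exprn_ge0// subr_ge0 ltW.
  have pn1 : p ^+ n <= 1 by rewrite exprn_ile1// ltW.
  rewrite exprS -natr1.
  rewrite (_ : _ * _ = p * (n%:R * p ^+ n * (1 - p)) + p * (p ^+ n * (1 - p))); last by ring.
  have h1 : p * (p ^+ n * (1 - p)) <= 1 - p.
    rewrite mulrA ler_piMl ?subr_ge0 ?(ltW p1)//.
    by rewrite -exprS exprn_ile1// ltW.
  have h2 : p * (n%:R * p ^+ n * (1 - p)) <= p by rewrite ler_piMr.
  lra.
apply: (@squeeze_cvgr _ _ _ _ (fun=> 0) (fun n => (1 - p)^-1 * p ^+ n)).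
- apply: nearW => n; rewrite mulr_ge0 ?exprn_ge0//= qE exprMn mulrA ler_wpM2r ?exprn_ge0//.
  by rewrite -[leRHS]mul1r ler_pdivlMr ?subr_gt0.
- exact: cvg_cst.
- rewrite -[X in _ --> X](mulr0 (1 - p)^-1); apply: cvgM; first exact: cvg_cst.
  by apply: cvg_expr; rewrite ger0_norm.
Qed.

(** For u < 1/2 Bernoulli's inequality gives the lower bound 1 - n (2 u) ^ n. For u >= 1/2 the upper
    bound is exp (- n (2 u) ^ n) <= 1 / (n + 1). *)
Lemma step_poly_cvg (u : R) : 0 <= u <= 1 ->
  step_poly n u @[n --> \oo] --> ((u < 2^-1)%R%:R : R).
Proof.
move=> u01; have /andP[u0 u1] := u01; have [u2|u2] := ltP u 2^-1.
  apply: (@squeeze_cvgr _ _ _ _ (fun n => 1 - n%:R * (2 * u) ^+ n) (fun=> 1)).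
  - apply: nearW => n; have /andP[_ ->] := step_poly_bound n u01; rewrite andbT.
    rewrite exprMn mulrA -natrX -natrM bernoulli_le//.
    by rewrite exprn_ge0//= exprn_ile1.
  - rewrite -[X in _ --> X](subr0 1); apply: cvgB; first exact: cvg_cst.
    by apply: natMexpr_cvg0; apply/andP; split; lra.
  - exact: cvg_cst.
apply: (@squeeze_cvgr _ _ _ _ (fun=> 0) (fun n => n.+1%:R^-1)).
- apply: nearW => n; have /andP[-> _] /= := step_poly_bound n u01.
  have h1 : 1 <= (2 * u) ^+ n by rewrite exprn_ege1//; lra.
  have h2 : 1 - u ^+ n <= expR (- u ^+ n) by rewrite expR_ge1Dx.
  apply: (@le_trans _ _ (expR (- u ^+ n) ^+ (n * 2 ^ n))).
    rewrite lerXn2r ?nnegrE ?expR_ge0//.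
    by rewrite subr_ge0 exprn_ile1.
  rewrite -expRM_natl mulrN expRN lef_pV2 ?posrE ?expR_gt0//.
  rewrite natrM natrX -mulrA -exprMn (le_trans _ (expR_ge1Dx _))//.
  by rewrite -natr1 addrC lerD2l ler_peMr.
- exact: cvg_cst.
- exact: cvg_harmonic.
Qed.

End trig.

Section path_space.
Variable R : realType.

Definition half_cylinder (s : seq (R * R)) : set (R -> R) :=
  [set x | forall p, p \in s -> p.1 < x p.2].

Definition half_cylinders : set (set (R -> R)) :=
  [set A | exists s, times_in s /\ A = half_cylinder s].

(** The sigma-algebra sees only times in [0, 1]; the values of a path elsewhere do not affect its
    law. *)
Definition pathR : Type := R -> R.
HB.instance Definition _ := Pointed.on pathR.
HB.instance Definition _ := Measurable.copy pathR
  (g_sigma_algebraType half_cylinders).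

Lemma half_cylindersI : setI_closed half_cylinders.
Proof.
move=> _ _ [s [ts ->]] [s' [ts' ->]]; exists (s ++ s'); split; first exact: times_in_cat.
apply/seteqP; split => x /=.
  by move=> [h h'] p; rewrite mem_cat => /orP[/h|/h'].
by move=> h; split => p ps; apply: h; rewrite mem_cat ps ?orbT.
Qed.

Lemma measurable_eval (t : R) : unit_time t ->
  measurable_fun setT (fun x : pathR => x t).
Proof.
move=> t01.
apply: (measurability _ (RGenOInfty.measurableE R)) => _ [_ [b ->] <-].
rewrite setTI; apply: sub_sigma_algebra.
exists [:: (b, t)]; split; first by move=> p; rewrite inE => /eqP ->.
apply/seteqP; split => x /=.
  by rewrite in_itv/= andbT => bx p; rewrite inE => /eqP ->.
by move=> /(_ (b, t)); rewrite inE eqxx in_itv/= andbT; apply.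
Qed.

Lemma measurable_pathR d (Om : measurableType d) (X : Om -> pathR) :
  (forall t, unit_time t -> measurable_fun setT (fun w => X w t)) ->
  measurable_fun setT X.
Proof.
move=> mX; apply: (@measurability _ _ Om pathR setT X half_cylinders erefl) =>
  _ [_ [s [ts ->]] <-].
rewrite setTI.
have -> : X @^-1` half_cylinder s =
    \bigcap_(p in [set` s]) [set w | p.1 < X w p.2].
  by apply/seteqP; split.
apply: fin_bigcap_measurable => // p ps.
have := mX p.2 (ts _ ps) measurableT `]p.1, +oo[%classic (measurable_itv _).
by rewrite setTI; congr measurable; apply/seteqP; split => w /=;
  rewrite in_itv/= andbT.
Qed.

Lemma measurable_lin l : times_in l -> measurable_fun setT (lin l : pathR -> R).
Proof.
move=> tl; rewrite [X in measurable_fun _ X](_ : _ = fun x : pathR =>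
  \sum_(p <- l) if p \in l then p.1 * x p.2 else 0).
  apply: measurable_sum => p; case: (boolP (p \in l)) => pl; last exact: (@measurable_cst _ _ pathR R).
  have := @measurable_funM _ pathR R setT (fun=> p.1) (fun x => x p.2).
  apply; first exact: (@measurable_cst _ _ pathR R).
  exact: (measurable_eval (tl _ pl)).
by apply/funext => x; rewrite /lin big_seq big_mkcond.
Qed.

Lemma trig_bounded (f : pathR -> R) : trig f -> bounded_mfun f.
Proof.
elim=> [l c lt|g h _ bg _ bh|a g _ bg].
- by apply: bounded_mfun_cos; apply: measurable_funD => //; exact: measurable_lin.
- exact: bounded_mfunD.
- exact: bounded_mfunZ.
Qed.

(* [1 - sin] is a cosine, and lies below 1 exactly on the right of [b], at
   least near [b]. *)
Definition smooth_step (n : nat) (th b y : R) :=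
  step_poly n (2^-1 * (1 - sin (th * (y - b)))).

Lemma smooth_step_arg (th b y : R) : 0 <= 2^-1 * (1 - sin (th * (y - b))) <= 1.
Proof.
have := sin_max (th * (y - b)); rewrite ler_norml => /andP[h1 h2].
by apply/andP; split; lra.
Qed.

Lemma smooth_step_bound n th b y : 0 <= smooth_step n th b y <= 1.
Proof. exact/step_poly_bound/smooth_step_arg. Qed.

Lemma smooth_step_trig n th b t : unit_time t ->
  trig (fun x => smooth_step n th b (x t)).
Proof.
move=> ht; rewrite /smooth_step /step_poly; apply: trig_exp.
rewrite [X in trig X](_ : _ = fun x : R -> R => 1 + (- 1) *
    (fun x : R -> R => 2^-1 * (1 + (- 1) * cos (lin [:: (th, t)] x
      + (- (th * b) - pi / 2)))) x ^+ n).
  apply: trig_add; first exact: trig_cst.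
  apply: trig_scale; apply: trig_exp; apply: trig_scale; apply: trig_add.
    exact: trig_cst.
  by apply: trig_scale; apply: trig_cos => p; rewrite inE => /eqP ->.
apply/funext => x; rewrite mulN1r; congr (1 - (_ * (1 + _)) ^+ n).
rewrite /lin big_seq1 /= mulN1r; congr (- _).
rewrite (_ : th * x t + _ = th * (x t - b) - pi / 2); last by ring.
by rewrite cosB cos_pihalf sin_pihalf mulr0 add0r mulr1.
Qed.

Lemma smooth_step_cvg th b y : smooth_step n th b y @[n --> \oo] -->
  ((0 < sin (th * (y - b)))%R%:R : R).
Proof.
have -> : (0 < sin (th * (y - b))) = (2^-1 * (1 - sin (th * (y - b))) < 2^-1).
  by apply/idP/idP => h; lra.
exact/step_poly_cvg/smooth_step_arg.
Qed.

(** For a small frequency the argument lies in (- pi, pi), where the sine has the sign of its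
    argument. *)
Lemma sin_sign_cvg (b y : R) :
  ((0 < sin (k.+1%:R^-1 * (y - b)))%R%:R : R) @[k --> \oo] --> ((b < y)%R%:R : R).
Proof.
apply: cvg_near_cst.
near=> k.
have k0 : (0 : R) < k.+1%:R^-1 by rewrite invr_gt0.
have kl : `|k.+1%:R^-1 * (y - b)| < pi.
  rewrite normrM gtr0_norm// mulrC ltr_pdivrMr//.
  have : `|y - b| / pi < k.+1%:R.
    near: k; exists (Num.truncn (`|y - b| / pi)) => // k /= hk.
    by rewrite (lt_le_trans (truncnS_gt _))// ler_nat ltnS.
  by rewrite ltr_pdivrMr ?pi_gt0// mulrC.
move: kl; rewrite ltr_norml => /andP[kl1 kl2].
congr ((nat_of_bool _)%:R); have [by_|by_] := ltP b y.
  by rewrite sin_gt0_pi// kl2 andbT mulr_gt0// subr_gt0.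
apply/negbTE; rewrite -leNgt -oppr_ge0 -sinN -mulrN opprB sin_ge0_pi//.
by rewrite mulr_ge0 ?subr_ge0 ?(ltW k0)//= -opprB mulrN lerNl ltW.
Unshelve. all: by end_near. Qed.

Lemma cvg_prod_seq I (s : seq I) (f : I -> nat -> R) (a : I -> R) :
  (forall i, f i n @[n --> \oo] --> a i) ->
  \prod_(i <- s) f i n @[n --> \oo] --> \prod_(i <- s) a i.
Proof.
move=> fa; elim: s => [|i s ih].
  by rewrite big_nil; under eq_fun do rewrite big_nil; exact: cvg_cst.
by rewrite big_cons; under eq_fun do rewrite big_cons; exact: cvgM.
Qed.

Lemma prod_bound I (s : seq I) (a : I -> R) : (forall i, 0 <= a i <= 1) ->
  0 <= \prod_(i <- s) a i <= 1.
Proof.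
move=> a01; elim: s => [|i s /andP[h0 h1]]; first by rewrite big_nil ler01 lexx.
rewrite big_cons; have /andP[a0 a1] := a01 i.
by rewrite mulr_ge0//= mulr_ile1.
Qed.

Lemma prod_indic (s : seq (R * R)) x :
  \prod_(p <- s) (p.1 < x p.2)%R%:R = \1_(half_cylinder s) x :> R.
Proof.
rewrite indicE; case: (asboolP (half_cylinder s x)) => h.
  rewrite mem_set// big_seq big1// => p /h -> //.
rewrite memNset//; elim: s h => [|p s ih] h; first by case: h.
rewrite big_cons; have [px|px] := boolP (p.1 < x p.2); last by rewrite mul0r.
rewrite ih ?mulr0// => hs; apply: h => q; rewrite inE => /predU1P[->//|]; exact: hs.
Qed.

End path_space.

Section law_unique.
Context {R : realType} {d} {Om : measurableType d} (P : probability Om R).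
Variables X Y : Om -> pathR R.
Hypotheses (mX : measurable_fun setT X) (mY : measurable_fun setT Y).
Hypothesis XY : forall l c, times_in l ->
  \int[P]_w cos (lin l (X w) + c) = \int[P]_w cos (lin l (Y w) + c).

Let same (f : pathR R -> R) :=
  measurable_fun setT f /\ \int[P]_w f (X w) = \int[P]_w f (Y w).

Let same_cvg (f_ : nat -> pathR R -> R) f : (forall n, same (f_ n)) ->
  (forall n x, 0 <= f_ n x <= 1) -> (forall x, f_ n x @[n --> \oo] --> f x) ->
  same f.
Proof.
move=> sf bf cf.
have bf' n x : `|f_ n x| <= 1 by have /andP[h0 h1] := bf n x; rewrite ger0_norm.
have mf_ n : measurable_fun setT (f_ n) by have [] := sf n.
split; first by apply: (measurable_fun_cvg (h := f_)).
have hX : \int[P]_w f_ n (X w) @[n --> \oo] --> \int[P]_w f (X w).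
  by apply: (bounded_cvgT (M := 1)) => [n|n w|w]//; apply: measurableT_comp.
have hY : \int[P]_w f_ n (Y w) @[n --> \oo] --> \int[P]_w f (Y w).
  by apply: (bounded_cvgT (M := 1)) => [n|n w|w]//; apply: measurableT_comp.
rewrite -(cvg_lim _ hX)// -(cvg_lim _ hY)//.
by congr (lim (_ @ \oo)); apply/funext => n; have [] := sf n.
Qed.

Let same_trig f : trig f -> same f.
Proof.
move=> tf; split; first by have [] := trig_bounded tf.
have bX g : trig g -> bounded_mfun (fun w => g (X w)).
  move=> /trig_bounded[mg [M gM]]; split; first exact: measurableT_comp.
  by exists M => w; exact: gM.
have bY g : trig g -> bounded_mfun (fun w => g (Y w)).
  move=> /trig_bounded[mg [M gM]]; split; first exact: measurableT_comp.
  by exists M => w; exact: gM.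
elim: tf => [l c lt|g h tg ihg th ihh|a g tg ih]; first exact: XY.
- by rewrite !expD ?ihg ?ihh//; [exact: bY|exact: bY|exact: bX|exact: bX].
- by rewrite !expZ ?ih//; [exact: bY|exact: bX].
Qed.

(** Two successive limits of products of smooth steps: letting n grow at a fixed frequency yields
    the sign of a sine, then letting the frequency 1 / (k + 1) tend to 0 yields the half-line. *)
Let same_half_cylinder s : times_in s -> same (\1_(half_cylinder s)).
Proof.
move=> ts.
pose F n k (x : pathR R) := \prod_(p <- s)
  if p \in s then smooth_step n k.+1%:R^-1 p.1 (x p.2) else 1.
pose G k (x : pathR R) := \prod_(p <- s)
  if p \in s then (0 < sin (k.+1%:R^-1 * (x p.2 - p.1)))%R%:R : R else 1.
have sG k : same (G k).
  apply: (@same_cvg (F ^~ k)) => [n|n x|x].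
  - apply: same_trig; apply: trig_prod => p; case: (boolP (p \in s)) => ps; last exact: trig_cst.
    exact/smooth_step_trig/ts.
  - by apply: prod_bound => p; case: ifP; rewrite ?ler01 ?lexx// smooth_step_bound.
  - apply: cvg_prod_seq => p; case: ifP => _; last exact: cvg_cst.
    exact: smooth_step_cvg.
apply: (@same_cvg G) => // [k x|x].
  by apply: prod_bound => p; case: ifP; rewrite ?ler01 ?lexx//; case: ltP;
    rewrite ?ler01 ?lexx.
rewrite -prod_indic big_seq big_mkcond.
apply: cvg_prod_seq => p; case: ifP => _; last exact: cvg_cst.
exact: sin_sign_cvg.
Qed.

(** Characteristic functions of the finite-dimensional marginals determine the law: they give the
    half cylinders, which form a pi-system generating the events. *)
Lemma law_unique A : measurable A -> P (X @^-1` A) = P (Y @^-1` A).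
Proof.
have := @measure_unique _ R (pathR R) (@half_cylinders R) (fun=> setT) erefl
  (@half_cylindersI R) _ _ (pushforward P X) (pushforward P Y) _ _ A.
apply.
- by move=> _; exists [::]; split=> //; apply/seteqP; split.
- by rewrite bigcup_const//; exists 0%N.
- move=> _ [s [ts ->]].
  have mA : measurable (half_cylinder s : set (pathR R)).
    by apply: sub_sigma_algebra; exists s.
  have mXA : measurable (X @^-1` half_cylinder s) by rewrite -[X in measurable X]setTI; exact: mX.
  have mYA : measurable (Y @^-1` half_cylinder s) by rewrite -[X in measurable X]setTI; exact: mY.
  change (P (X @^-1` half_cylinder s) = P (Y @^-1` half_cylinder s)).
  rewrite -(exp_indic P mXA) -(exp_indic P mYA).
  by congr EFin; exact: (same_half_cylinder ts).2.
- by move=> _; rewrite -[ltLHS]/(P setT) probability_setT ltry.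
Qed.

End law_unique.

(** * Uniform continuity on a segment *)

Section uniform_continuity.
Variable R : realType.

Definition ucont (a b : R) (f : R -> R) := forall e, 0 < e -> exists2 de, 0 < de &
  forall r s, a <= r <= b -> a <= s <= b -> `|r - s| < de -> `|f r - f s| < e.

Lemma ucontP (a b : R) (f : R -> R) :
  {within `[a, b], continuous f} <-> ucont a b f.
Proof.
split=> [/subspace_continuousP cf e e0|uf].
  have e2 : 0 < e / 2 by rewrite divr_gt0.
  (* Phrased for the near-covering form of compactness: [Q] holds for r' near r and all small [de]
     at once, hence for one [de] on the whole segment. *)
  pose Q (de r : R) := a <= r <= b -> forall s, a <= s <= b ->
    `|r - s| < de -> `|f r - f s| < e.
  have hQ r : `[a, b]%classic r -> \forall r' \near r & de \near (0 : R)^'+, Q de r'.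
    move=> ab; move: (cf _ ab) => /cvgrPdist_lt /(_ _ e2) [de /= de0 hde].
    have d2 : 0 < de / 2 by rewrite divr_gt0.
    exists (ball r (de / 2), [set x | x < de / 2]) => /=.
      split; first exact: nbhsx_ballx.
      exists (de / 2) => //= x; rewrite /ball_ /= sub0r normrN => + x0.
      by rewrite gtr0_norm.
    move=> [r' x] /= [rr' xde] r'ab s sab r's.
    have h1 : `|f r - f r'| < e / 2.
      apply: hde => //=.
      by apply: (lt_trans rr'); rewrite ltr_pdivrMr// ltr_pMr// ltr1n.
    have h2 : `|f r - f s| < e / 2.
      apply: hde => //=.
      rewrite (le_lt_trans (ler_distD r' _ _))// [ltRHS]splitr ltrD//.
      exact: lt_trans r's xde.
    by rewrite (le_lt_trans (ler_distD (f r) _ _))// [ltRHS]splitr ltrD// distrC.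
  have /compact_near_coveringP cov : compact `[a, b]%classic by exact: segment_compact.
  have [de /= de0 hde] := cov _ _ _ _ hQ; exists (de / 2); first by rewrite divr_gt0.
  move=> r s rab sab rs; apply: (hde (de / 2)) => //=.
  + rewrite /ball_ /= sub0r normrN gtr0_norm ?divr_gt0//.
    by rewrite ltr_pdivrMr// ltr_pMr// ltr1n.
  + by rewrite divr_gt0.
apply/subspace_continuousP => r /=; rewrite in_itv/= => rab.
apply/cvgrPdist_lt => e e0; have [de de0 h] := uf e e0.
exists de => //= s rs; rewrite in_itv/= => sab; exact: h.
Qed.

Lemma ucont_lin a b f g (c d : R) : ucont a b f -> ucont a b g ->
  ucont a b (fun r => c * f r + d * g r).
Proof.
move=> uf ug e e0.
pose C := `|c| + `|d| + 1.
have C0 : 0 < C by rewrite /C; have := normr_ge0 c; have := normr_ge0 d; lra.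
have eC : 0 < e / C by rewrite divr_gt0.
have [d1 d10 h1] := uf _ eC; have [d2 d20 h2] := ug _ eC.
exists (Num.min d1 d2); first by rewrite lt_min d10.
move=> r s rab sab; rewrite lt_min => /andP[rs1 rs2].
rewrite opprD addrACA -!mulrBr (le_lt_trans (ler_normD _ _))// !normrM.
apply: (@le_lt_trans _ _ (`|c| * (e / C) + `|d| * (e / C))).
  by rewrite lerD// ler_wpM2l// ltW// ?h1 ?h2.
rewrite -mulrDl mulrA ltr_pdivrMr// mulrC ltr_pM2l// /C; lra.
Qed.

Lemma ucont_cvg a b f (s : nat -> R) l : ucont a b f -> a <= l <= b ->
  (forall n, a <= s n <= b) -> s n @[n --> \oo] --> l ->
  f (s n) @[n --> \oo] --> f l.
Proof.
move=> uf lab sab /cvgrPdist_lt sl; apply/cvgrPdist_lt => e e0.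
have [de de0 h] := uf e e0; apply: filterS (sl de de0) => n; exact: h.
Qed.

Lemma ucont_bounded f : ucont 0 1 f ->
  exists M, forall r, 0 <= r <= 1 -> `|f r| <= M.
Proof.
move=> /ucontP cf; have := @continuous_compact R^o R^o f `[0, 1]%classic cf
  (@segment_compact R 0 1).
move=> /compact_bounded[M [_ hM]]; exists (`|M| + 1) => r r01.
by apply: hM; [rewrite (le_lt_trans (ler_norm _))// ltrDl|exists r => //=; rewrite in_itv].
Qed.

End uniform_continuity.

(** * The Brownian bridge *)

Section covariance.
Variable R : realType.

Definition bridge_cov (r s : R) := Num.min r s - r * s.

(** The covariance of [lin l] and [lin l'] under the bridge. *)
Definition cov (l l' : seq (R * R)) :=
  \sum_(p <- l) \sum_(q <- l') p.1 * q.1 * bridge_cov p.2 q.2.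

Lemma bridge_covC r s : bridge_cov r s = bridge_cov s r.
Proof. by rewrite /bridge_cov minC mulrC. Qed.

Lemma covC l l' : cov l l' = cov l' l.
Proof.
rewrite /cov exchange_big /=; apply: eq_bigr => p _; apply: eq_bigr => q _.
by rewrite bridge_covC [q.1 * _]mulrC.
Qed.

Lemma cov_cons p l l' : cov (p :: l) l' = p.1 * cov [:: (1, p.2)] l' + cov l l'.
Proof.
rewrite /cov big_cons big_seq1 mulr_sumr; congr (_ + _).
by apply: eq_bigr => q _; rewrite /= mul1r mulrA.
Qed.

Lemma cov_cat l1 l2 l : cov (l1 ++ l2) l = cov l1 l + cov l2 l.
Proof. by rewrite /cov big_cat. Qed.

Lemma cov_scale a l l' : cov (scale_lin a l) l' = a * cov l l'.
Proof.
rewrite /cov /scale_lin big_map mulr_sumr; apply: eq_bigr => p _ /=.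
by rewrite mulr_sumr; apply: eq_bigr => q _; rewrite !mulrA.
Qed.

Lemma cov0l l : cov [::] l = 0. Proof. by rewrite /cov big_nil. Qed.

Lemma cov11 r s : cov [:: (1, r)] [:: (1, s)] = bridge_cov r s.
Proof. by rewrite /cov !big_seq1 /= !mul1r. Qed.

(** By bilinearity, a linear substitution that keeps the covariances of point evaluations keeps
    those of all finite combinations. *)
Lemma cov_sub l l' lr lr' : times_in l -> times_in l' ->
  (forall r s, unit_time r -> unit_time s -> cov (lr r) (lr' s) = bridge_cov r s) ->
  cov (flatten [seq scale_lin p.1 (lr p.2) | p <- l])
      (flatten [seq scale_lin p.1 (lr' p.2) | p <- l']) = cov l l'.
Proof.
move=> tl tl' h.
have E m (k : R -> seq (R * R)) (m' : seq (R * R)) :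
    cov (flatten [seq scale_lin p.1 (k p.2) | p <- m]) m' =
    \sum_(p <- m) p.1 * cov (k p.2) m'.
  elim: m => [|p m ih]; first by rewrite big_nil cov0l.
  by rewrite big_cons /= cov_cat cov_scale ih.
rewrite E; rewrite [RHS]/cov !big_seq; apply: eq_bigr => p pl.
rewrite covC E mulr_sumr !big_seq; apply: eq_bigr => q ql.
by rewrite covC h ?mulrA//; [exact: tl|exact: tl'].
Qed.

Lemma lin_sub l (lr : R -> seq (R * R)) (x y : R -> R) : times_in l ->
  (forall r, unit_time r -> y r = lin (lr r) x) ->
  lin l y = lin (flatten [seq scale_lin p.1 (lr p.2) | p <- l]) x.
Proof.
move=> + h; elim: l => [|p l ih] tl; first by rewrite /lin !big_nil.
rewrite /= lin_cat lin_scale -ih => [|q ql]; last by apply: tl; rewrite inE ql orbT.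
by rewrite {1}/lin big_cons h//; apply: tl; rewrite inE eqxx.
Qed.

Lemma times_in_sub l (lr : R -> seq (R * R)) : times_in l ->
  (forall r, unit_time r -> times_in (lr r)) ->
  times_in (flatten [seq scale_lin p.1 (lr p.2) | p <- l]).
Proof.
move=> + h; elim: l => [|p l ih] tl //=; apply: times_in_cat.
  by apply: times_in_scale; apply: h; apply: tl; rewrite inE eqxx.
by apply: ih => q ql; apply: tl; rewrite inE ql orbT.
Qed.

End covariance.

Section bridge.
Context {R : realType} {d} {Om : measurableType d} (P : probability Om R).

Definition continuous_bridge (b : Om -> R -> R) :=
  [/\ forall w, ucont 0 1 (b w),
      forall w, b w 0 = 0 /\ b w 1 = 0,
      forall t, unit_time t -> measurable_fun setT (fun w => b w t) &
      forall l, times_in l -> centered_gaussian P (fun w => lin l (b w)) (cov l l)].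

(** The bridge is replaced by 0 on the null set where it is discontinuous or nonzero at an endpoint,
    so that constructions on paths apply at every sample point. *)
Lemma bridge_version (beta : R -> Om -> R) : brownian_bridge P beta ->
  exists2 b, continuous_bridge b &
    {ae P, forall w, forall r, unit_time r -> beta r w = b w r}.
Proof.
move=> [cb gb].
have glin l : times_in l ->
    centered_gaussian P (fun w => lin l (beta^~ w)) (cov l l).
  move=> tl; have := gb (size l) (fun i => (nth (0, 0) l i).2)
    (fun i => (nth (0, 0) l i).1) (fun i => tl _ (mem_nth _ (ltn_ord i))).
  rewrite /cov /lin (big_nth (0, 0)) big_mkord.
  under [X in _ -> centered_gaussian _ _ X]eq_bigr do
    rewrite (big_nth (0, 0)) big_mkord.
  congr (centered_gaussian P _ _); apply/funext => w.
  by rewrite [RHS](big_nth (0, 0)) big_mkord.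
have mbeta t : unit_time t -> measurable_fun setT (beta t).
  move=> t01; have [|+ _] := glin [:: (1, t)].
    by move=> p; rewrite inE => /eqP ->.
  by congr measurable_fun; apply/funext => w; rewrite /lin big_seq1 mul1r.
(* At times 0 and 1 the variance is 0, and the degenerate Gaussian law is the Dirac mass at 0. *)
have zero t : unit_time t -> bridge_cov t t = 0 -> {ae P, forall w, beta t w = 0}.
  move=> t01 v0; have [|mt] := glin [:: (1, t)].
    by move=> p; rewrite inE => /eqP ->.
  rewrite cov11 v0 /centered_gaussian_law eqxx => /(_ (~` [set 0])).
  rewrite /pushforward => h.
  have mN : measurable ([set~ 0] : set (measurableTypeR R)) by exact: measurableC.
  have hE : beta t = (fun w => lin [:: (1, t)] (beta^~ w)).
    by apply/funext => w; rewrite /lin big_seq1 mul1r.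
  have E0 : P (beta t @^-1` [set~ 0]) = 0%E.
    by rewrite hE h// diracE memNset//= => /(_ erefl).
  have mE : measurable (beta t @^-1` [set~ 0]).
    by rewrite -[X in measurable X]setTI; exact: mbeta.
  apply: filterS (ae_prob0 mE E0) => w /=; exact: contrapT.
have z0 : {ae P, forall w, beta 0 w = 0}.
  by apply: zero; rewrite /unit_time /bridge_cov ?lexx ?ler01// minxx; ring.
have z1 : {ae P, forall w, beta 1 w = 0}.
  by apply: zero; rewrite /unit_time /bridge_cov ?lexx ?ler01// minxx; ring.
have : {ae P, forall w, [/\ {within `[0, 1], continuous (beta^~ w)},
    beta 0 w = 0 & beta 1 w = 0]} by near do split.
move=> [N [mN N0 hN]].
have good w : ~ N w -> [/\ {within `[0, 1], continuous (beta^~ w)},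
    beta 0 w = 0 & beta 1 w = 0].
  by move=> Nw; apply: contrapT => /hN.
pose b w r := if w \in N then 0 else beta r w.
have bE : {ae P, forall w, forall r, unit_time r -> beta r w = b w r}.
  exists N; split=> // w /= h; apply: contrapT => Nw; apply: h => r _.
  by rewrite /b memNset.
exists b => //; split.
- move=> w; rewrite /b; case: (boolP (w \in N)) => [_|].
    by move=> e e0; exists 1 => // r s _ _ _; rewrite subrr normr0.
  by rewrite notin_setE => /good[+ _ _] => /ucontP.
- move=> w; rewrite /b; case: (boolP (w \in N)) => [//|].
  by rewrite notin_setE => /good[].
- move=> t t01; apply: (measurable_fun_ifT (f := fun w => w \in N)) => //.
    by apply: (@measurable_fun_bool _ _ _ _ true); rewrite setTI preimage_mem_true.
  exact: mbeta.
- move=> l tl; have [mb lb] := glin l tl.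
  have mb' : measurable_fun setT (fun w => lin l (b w)).
    have -> : (fun w => lin l (b w)) = (fun w => if w \in N then 0 else lin l (beta^~ w)).
      apply/funext => w; rewrite /b; case: (w \in N) => //.
      by rewrite /lin big1// => p _; rewrite mulr0.
    apply: (measurable_fun_ifT (f := fun w => w \in N)) => //.
    by apply: (@measurable_fun_bool _ _ _ _ true); rewrite setTI preimage_mem_true.
  split=> // A mA; rewrite -(lb A mA) /pushforward.
  apply: prob_ae_eq.
  - by rewrite -[X in measurable X]setTI; exact: mb'.
  - by rewrite -[X in measurable X]setTI; exact: mb.
  - apply: filterS bE => w bE /=; suff -> : lin l (b w) = lin l (beta^~ w) by [].
    by rewrite /lin !big_seq; apply: eq_bigr => p pl; rewrite bE//; exact: tl.
Unshelve. all: by end_near. Qed.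

End bridge.

Section bridge_law.
Context {R : realType} {d} {Om : measurableType d} (P : probability Om R).
Variable b : Om -> R -> R.
Hypothesis bb : continuous_bridge P b.

(** By [law_unique] this is equality in law with [b], in the form that covariances alone can
    verify. *)
Definition bridge_law (X : Om -> pathR R) :=
  measurable_fun setT X /\ forall l c, times_in l ->
    \int[P]_w cos (lin l (X w) + c) = \int[P]_w cos (lin l (b w) + c).

Definition is_bridge (X : Om -> pathR R) :=
  [/\ forall w, ucont 0 1 (X w), forall w, X w 0 = 0 /\ X w 1 = 0 &
      bridge_law X].

Lemma bridge_refl : is_bridge b.
Proof.
by case: bb => ? ? mb _; split => //; split => //; exact: measurable_pathR.
Qed.

Lemma bridge_prob X Y A : bridge_law X -> bridge_law Y -> measurable A ->
  P (X @^-1` A) = P (Y @^-1` A).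
Proof.
by move=> [mX hX] [mY hY]; apply: law_unique => // l c tl; rewrite hX// hY.
Qed.

Lemma bridge_exp X Y phi : bridge_law X -> bridge_law Y -> bounded_mfun phi ->
  \int[P]_w phi (X w) = \int[P]_w phi (Y w).
Proof.
move=> bX bY bphi; have [mX _] := bX; have [mY _] := bY.
by apply: same_law_exp => // A mA; exact: bridge_prob.
Qed.

Lemma cov_eq_exp l l' c : times_in l -> times_in l' -> cov l l = cov l' l' ->
  \int[P]_w cos (lin l (b w) + c) = \int[P]_w cos (lin l' (b w) + c).
Proof.
move=> tl tl' ll'; have [_ _ _ gb] := bb.
have [ml hl] := gb l tl; have [ml' hl'] := gb l' tl'.
apply: (@same_law_exp R _ _ _ Om Om (measurableTypeR R) P P _ _
  (fun y => cos (y + c)) ml ml').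
  by move=> A mA; have := hl A mA; rewrite ll' -(hl' A mA).
by apply: bounded_mfun_cos; exact: measurable_funD.
Qed.

(** The law of a centered Gaussian combination depends only on its variance, so a linear map of
    paths need only keep the covariance kernel. *)
Lemma bridge_transform (lr : R -> seq (R * R)) X Y : bridge_law Y ->
  (forall r, unit_time r -> times_in (lr r)) ->
  (forall r s, unit_time r -> unit_time s -> cov (lr r) (lr s) = bridge_cov r s) ->
  (forall w r, unit_time r -> X w r = lin (lr r) (Y w)) ->
  bridge_law X.
Proof.
move=> [mY hY] tlr hcov XE; split.
  apply: measurable_pathR => t t01.
  rewrite [X in measurable_fun _ X](_ : _ = (lin (lr t) : pathR R -> R) \o Y).
    by apply: measurableT_comp => //; exact: (measurable_lin (tlr _ t01)).
  by apply/funext => w /=; rewrite XE.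
move=> l c tl.
have tl' := times_in_sub tl tlr.
transitivity (\int[P]_w cos (lin (flatten [seq scale_lin p.1 (lr p.2) | p <- l]) (Y w) + c)).
  by apply: eq_Rintegral => w _; rewrite -(@lin_sub _ _ _ (Y w) (X w))// => r; exact: XE.
by rewrite hY//; apply: cov_eq_exp => //; exact: cov_sub.
Qed.

(** The Cameron-Martin representative of [lin l], normalized so that [lin l] equals 1 on it when
    [cov l l] is nonzero. *)
Definition dual_path (l : seq (R * R)) (r : R) := cov [:: (1, r)] l / cov l l.

(* The reflection of the Cameron-Martin space along the functional [lin l]. *)
Definition reflect_along (l : seq (R * R)) (x : R -> R) (r : R) :=
  x r - 2 * lin l x * dual_path l r.

Lemma bridge_cov0r (r : R) : unit_time r -> bridge_cov 0 r = 0.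
Proof. by move=> /andP[r0 _]; rewrite /bridge_cov mul0r subr0 min_l. Qed.

Lemma bridge_cov1r (r : R) : unit_time r -> bridge_cov 1 r = 0.
Proof. by move=> /andP[_ r1]; rewrite /bridge_cov mul1r min_r// subrr. Qed.

Lemma dual_path01 (l : seq (R * R)) : times_in l -> dual_path l 0 = 0 /\ dual_path l 1 = 0.
Proof.
move=> tl; rewrite /dual_path /cov !big_seq1 /=.
by split; rewrite big_seq big1 ?mul0r// => p /tl pl;
  rewrite ?bridge_cov0r ?bridge_cov1r ?mulr0.
Qed.

Lemma ucont_min (s : R) (f : R -> R) : ucont 0 1 f -> unit_time s ->
  ucont 0 1 (fun r => f (Num.min r s)).
Proof.
move=> uf /andP[s0 s1] e e0; have [de de0 h] := uf e e0; exists de => // r r'.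
move=> /andP[r0 r1] /andP[r'0 r'1] rr'; apply: h.
- by rewrite le_min r0 s0 ge_min r1.
- by rewrite le_min r'0 s0 ge_min r'1.
- by move: rr'; rewrite !ltr_norml !minEle; case: (leP r s); case: (leP r' s); lra.
Qed.

Lemma ucont_id : ucont 0 1 (@idfun R).
Proof. by move=> e e0; exists e. Qed.

Lemma ucont_bridge_cov (s : R) : unit_time s -> ucont 0 1 (fun r => bridge_cov r s).
Proof.
move=> s01; have := ucont_lin 1 (- s) (ucont_min ucont_id s01) ucont_id.
rewrite (_ : (fun r => _) = (fun r => bridge_cov r s))//.
by apply/funext => r; rewrite /bridge_cov mul1r mulNr [s * _]mulrC.
Qed.

Lemma ucont_dual_path (l : seq (R * R)) : times_in l -> ucont 0 1 (dual_path l).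
Proof.
move=> tl; rewrite /dual_path.
have : ucont 0 1 (fun r => cov [:: (1, r)] l).
  elim: l tl => [|p l ih] tl.
    move=> e e0; exists 1 => // r s _ _ _.
    by rewrite /cov !big_seq1 !big_nil subrr normr0.
  have tp : unit_time p.2 by apply: tl; rewrite inE eqxx.
  have /ih ul : times_in l by move=> q ql; apply: tl; rewrite inE ql orbT.
  have := ucont_lin p.1 1 (ucont_bridge_cov tp) ul; congr ucont.
  by apply/funext => r; rewrite /cov !big_seq1 big_cons /= !mul1r.
move=> /(fun h => ucont_lin (cov l l)^-1 0 h h); congr ucont.
by apply/funext => r; rewrite mul0r addr0 mulrC.
Qed.

(** With c_r the covariance of the value at r with [lin l] and V the variance of [lin l], the cross
    terms contribute - 4 c_r c_s / V to the covariance and the quadratic term contributes + 4 c_r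
    c_s / V. *)
Lemma bridge_reflect l X : is_bridge X -> times_in l -> cov l l != 0 ->
  is_bridge (fun w => reflect_along l (X w)).
Proof.
move=> [cX X01 bX] tl l0; split.
- move=> w; have := ucont_lin 1 (- 2 * lin l (X w)) (cX w) (ucont_dual_path tl).
  by congr ucont; apply/funext => r; rewrite /reflect_along mul1r; ring.
- move=> w; have [h0 h1] := dual_path01 tl; have [h2 h3] := X01 w.
  by rewrite /reflect_along h0 h1 h2 h3 !mulr0 subr0.
apply: (bridge_transform (Y := X)
  (lr := fun r => (1, r) :: scale_lin (- 2 * dual_path l r) l)) => //.
- move=> r r01 p; rewrite inE => /predU1P[->//|]; exact: times_in_scale.
- move=> r s _ _.
  have consr (u : seq (R * R)) t m : cov u ((1, t) :: m) = cov u [:: (1, t)] + cov u m.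
    by rewrite covC cov_cons mul1r covC [cov m u]covC.
  have scaler (u : seq (R * R)) a m : cov u (scale_lin a m) = a * cov u m.
    by rewrite covC cov_scale covC.
  have consl m : cov ((1, r) :: scale_lin (- 2 * dual_path l r) l) m =
      cov [:: (1, r)] m + cov (scale_lin (- 2 * dual_path l r) l) m.
    by rewrite cov_cons mul1r.
  rewrite (consr _ s (scale_lin _ _)) !consl !scaler !cov_scale cov11.
  rewrite [cov l [:: (1, s)]]covC /dual_path.
  by field.
- move=> w r _; rewrite /lin big_cons /= mul1r -/(lin _ _) lin_scale.
  by rewrite /reflect_along; ring.
Qed.

(* Reflects the part of the bridge after time [s], relative to its conditional
   mean given its past. *)
Definition reflect_after (s : R) (x : R -> R) (r : R) :=
  if r <= s then x r else 2 * ((1 - r) / (1 - s)) * x s - x r.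

Lemma bridge_reflect_after s X : unit_time s -> bridge_law X ->
  bridge_law (fun w => reflect_after s (X w)).
Proof.
move=> s01 bX; have /andP[s0 s1] := s01.
pose lr r := if r <= s then [:: (1, r)]
  else [:: (2 * ((1 - r) / (1 - s)), s); (- 1, r)].
apply: (bridge_transform (Y := X) (lr := lr)) => //.
- move=> r r01 p; rewrite /lr; case: ifP => _; rewrite !inE.
    by move=> /eqP ->.
  by move=> /orP[|] /eqP ->.
- move=> r r' /andP[r0 r1] /andP[r'0 r'1]; rewrite /lr /cov.
  case: (leP r s) => rs; case: (leP r' s) => r's;
    rewrite !big_cons !big_nil /= !addr0 /bridge_cov.
  + by rewrite !mul1r.
  (* A time after [s] forces s < 1; for s = 1 the reflecting branch is never taken. *)
  + have s1' : 1 - s != 0 by rewrite gt_eqF// subr_gt0 (lt_le_trans r's).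
    rewrite (min_l rs) (min_l (ltW (le_lt_trans rs r's))).
    by field.
  + have s1' : 1 - s != 0 by rewrite gt_eqF// subr_gt0 (lt_le_trans rs).
    rewrite (min_r r's) (min_r (ltW (le_lt_trans r's rs))).
    by field.
  + have s1' : 1 - s != 0 by rewrite gt_eqF// subr_gt0 (lt_le_trans rs).
    rewrite minxx (min_l (ltW r's)) (min_r (ltW rs)).
    by field.
- move=> w r _; rewrite /reflect_after /lr; case: ifP => _;
    by rewrite /lin !big_cons big_nil /=; ring.
Qed.

End bridge_law.

(** * The first zero after 1/2 *)

Section hitting.
Variable R : realType.

(* The factor 6 puts 5 / 6 on the grid. *)
Definition grid (n j : nat) : R := 2^-1 + j%:R / (6 * 2 ^ n)%:R.

Definition crossed (x : R -> R) (n j : nat) := x (grid n j) * x 2^-1 <= 0.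

(** If no grid point is crossed, [find] returns the length 3 * 2 ^ n, whose grid time is 1, where
    the bridge vanishes. *)
Definition hit_index (n : nat) (x : R -> R) := find (crossed x n) (iota 0 (3 * 2 ^ n)).

Definition hit_grid n x := grid n (hit_index n x).

Lemma gridE n j : grid n j = 2^-1 + j%:R / 6 * (2 ^ n)%:R^-1.
Proof. by rewrite /grid natrM invfM mulrA. Qed.

Lemma pow2_gt0 n : (0 : R) < (2 ^ n)%:R.
Proof. by rewrite ltr0n expn_gt0. Qed.

Lemma grid_last n : grid n (3 * 2 ^ n) = 1.
Proof. by rewrite gridE natrM; field; rewrite gt_eqF// pow2_gt0. Qed.

Lemma gridS n j : grid n.+1 (2 * j) = grid n j.
Proof. by rewrite !gridE expnS !natrM; field; rewrite gt_eqF// pow2_gt0. Qed.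

Lemma le_grid n : {mono grid n : i j / (i <= j)%N >-> i <= j}.
Proof.
by move=> i j; rewrite /grid lerD2l ler_pM2r ?ler_nat// invr_gt0 ltr0n muln_gt0 expn_gt0.
Qed.

Lemma hit_index_le n x : (hit_index n x <= 3 * 2 ^ n)%N.
Proof. by rewrite -[leqRHS](size_iota 0) find_size. Qed.

Lemma before_hit n x i : (i < hit_index n x)%N -> ~~ crossed x n i.
Proof.
move=> ih; have := before_find 0%N ih.
rewrite nth_iota ?add0n => [->//|]; exact: leq_trans ih (hit_index_le n x).
Qed.

Lemma at_hit n x : (hit_index n x < 3 * 2 ^ n)%N -> crossed x n (hit_index n x).
Proof.
move=> h; have := @nth_find _ 0%N (crossed x n) (iota 0 (3 * 2 ^ n)).
by rewrite nth_iota// add0n; apply; rewrite has_find size_iota.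
Qed.

(** The stopping-time property: only values up to [grid n j] enter, so a reflection after that time
    does not affect the event. *)
Lemma hit_indexP n x j : (j <= 3 * 2 ^ n)%N ->
  hit_index n x = j <-> (forall i, (i < j)%N -> ~~ crossed x n i) /\
    ((j < 3 * 2 ^ n)%N -> crossed x n j).
Proof.
move=> jN; split=> [<-|[h1 h2]]; first by split; [exact: before_hit|exact: at_hit].
have [hj|jh|//] := ltngtP (hit_index n x) j.
  by have := h1 _ hj; rewrite at_hit// (leq_trans hj).
by have := before_hit jh; rewrite h2// (leq_trans jh)// hit_index_le.
Qed.

Lemma hit_index_leP n x j : (j < 3 * 2 ^ n)%N -> crossed x n j ->
  (hit_index n x <= j)%N.
Proof. by move=> jN cj; rewrite leqNgt; apply/negP => /before_hit; rewrite cj. Qed.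

Lemma hit_grid_unit n x : 2^-1 <= hit_grid n x <= 1.
Proof.
apply/andP; split; first by rewrite lerDl divr_ge0.
by rewrite -[leRHS](grid_last n) le_grid hit_index_le.
Qed.

Lemma hit_grid_decr x : nonincreasing_seq (hit_grid ^~ x).
Proof.
apply/nonincreasing_seqP => n; rewrite /hit_grid -[leRHS]gridS le_grid.
have := hit_index_le n x; rewrite leq_eqVlt => /predU1P[->|h].
  by rewrite mulnCA -expnS hit_index_le.
apply: hit_index_leP; last by rewrite /crossed gridS; exact: at_hit.
by rewrite expnS mulnCA ltn_pmul2l.
Qed.

Definition hit (x : R -> R) := limn (hit_grid ^~ x).

Lemma hit_cvg x : hit_grid n x @[n --> \oo] --> hit x.
Proof.
apply: nonincreasing_is_cvgn; first exact: hit_grid_decr.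
by exists 2^-1 => _ [n _ <-]; have /andP[] := hit_grid_unit n x.
Qed.

Lemma hit_le x n : hit x <= hit_grid n x.
Proof.
apply: nonincreasing_cvgn_ge; first exact: hit_grid_decr.
by apply: cvgP; exact: hit_cvg.
Qed.

Lemma hit_unit x : 2^-1 <= hit x <= 1.
Proof.
apply/andP; split.
  apply: limr_ge; first by apply: cvgP; exact: hit_cvg.
  by apply: nearW => n; have /andP[] := hit_grid_unit n x.
by rewrite (le_trans (hit_le x 0))//; have /andP[] := hit_grid_unit 0 x.
Qed.

Lemma half_unit_time (s : R) : 2^-1 <= s <= 1 -> unit_time s.
Proof. by move=> /andP[h1 h2]; rewrite /unit_time h2 (le_trans _ h1). Qed.

(** If x(1/2) = 0 the search stops at once. Otherwise the product of x with x(1/2) is at most 0 at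
    the grid time (using x(1) = 0 if nothing is crossed) and positive one grid step earlier; both
    times tend to [hit x]. *)
Lemma hit_zero x : ucont 0 1 x -> x 1 = 0 -> x (hit x) = 0.
Proof.
move=> cx x1.
have hu n := half_unit_time (hit_grid_unit n x).
have hu' := half_unit_time (hit_unit x).
have [h0|h0] := eqVneq (x 2^-1) 0.
  have i0 n : hit_index n x = 0%N.
    have N0 : (0 < 3 * 2 ^ n)%N by rewrite muln_gt0 expn_gt0.
    by apply/eqP; rewrite -leqn0; apply: hit_index_leP; rewrite ?N0// /crossed h0 mulr0.
  suff -> : hit x = 2^-1 by [].
  apply/cvg_lim => //; rewrite /hit_grid; under eq_fun do rewrite i0.
  by rewrite /grid; under eq_fun do rewrite mul0r addr0; exact: cvg_cst.
apply/eqP; rewrite -(mulIr_eq0 (x (hit x)) (mulIf h0)); apply/eqP.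
have c1 : x (hit_grid n x) * x 2^-1 @[n --> \oo] --> x (hit x) * x 2^-1.
  by apply: cvgMl; apply: (ucont_cvg cx) => //; exact: hit_cvg.
apply/eqP; rewrite eq_le; apply/andP; split.
  rewrite -(cvg_lim _ c1)//; apply: limr_le; [exact: cvgP c1|apply: nearW => n].
  have := hit_index_le n x; rewrite leq_eqVlt => /predU1P[hN|].
    by rewrite /hit_grid hN grid_last x1 mul0r.
  by move=> /at_hit.
have i0 n : (0 < hit_index n x)%N.
  rewrite lt0n; apply/eqP => h; have N0 : (0 < 3 * 2 ^ n)%N by rewrite muln_gt0 expn_gt0.
  have := at_hit (n := n) (x := x); rewrite h /crossed /grid mul0r addr0 => /(_ N0).
  by rewrite leNgt -expr2 exprn_even_gt0//= h0.
pose s n := grid n (hit_index n x).-1.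
have sE n : s n = hit_grid n x - 6^-1 * (2 ^ n)%:R^-1.
  rewrite /s /hit_grid -[in RHS](prednK (i0 n)) !gridE -natr1; ring.
have su n : unit_time (s n).
  apply: half_unit_time; apply/andP; split; first by rewrite lerDl divr_ge0.
  by rewrite -[leRHS](grid_last n) le_grid (leq_trans (leq_pred _) (hit_index_le _ _)).
have sc : s n @[n --> \oo] --> hit x.
  have h6 : 6^-1 * (2 ^ n)%:R^-1 @[n --> \oo] --> (6^-1 * 0 : R).
    apply: cvgMr; under eq_fun do rewrite natrX -exprVn.
    by apply: cvg_expr; rewrite ger0_norm// invf_lt1// ltr1n.
  rewrite (funext sE : s = _) -[hit x]subr0 -[X in hit x - X](mulr0 6^-1).
  exact: cvgB (@hit_cvg x) h6.
have c2 : x (s n) * x 2^-1 @[n --> \oo] --> x (hit x) * x 2^-1.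
  by apply: cvgMl; apply: (ucont_cvg cx).
rewrite -(cvg_lim _ c2)//; apply: limr_ge; [exact: cvgP c2|apply: nearW => n].
by apply: ltW; rewrite ltNge; apply: before_hit; rewrite prednK.
Qed.

Lemma hit_le_crossing x : x 2^-1 * x (5 / 6) <= 0 -> hit x <= 5 / 6.
Proof.
move=> h; have g0 : grid 0 2 = 5 / 6 by rewrite /grid expn0 muln1; field.
rewrite (le_trans (hit_le x 0))// -g0 /hit_grid le_grid.
by apply: hit_index_leP; rewrite // /crossed g0 mulrC.
Qed.

Lemma eq_hit x y : (forall r, 2^-1 <= r <= 1 -> x r = y r) -> hit x = hit y.
Proof.
move=> xy; rewrite /hit; congr (lim (_ @ \oo)); apply/funext => n.
rewrite /hit_grid /hit_index; congr grid; apply: eq_in_find => j.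
rewrite mem_iota add0n => /andP[_ jN]; have gj : 2^-1 <= grid n j <= 1.
  apply/andP; split; first by rewrite lerDl divr_ge0.
  by rewrite -[leRHS](grid_last n) le_grid ltnW.
by rewrite /crossed (xy _ gj) xy// lexx invf_le1// ler1n.
Qed.

(** Since 5/6 is a grid point at every level and is crossed, each search ends there at the latest
    and never reads a later value. *)
Lemma eq_hit_crossing x y : (forall r, 2^-1 <= r <= 5 / 6 -> x r = y r) ->
  x 2^-1 * x (5 / 6) <= 0 -> hit x = hit y.
Proof.
move=> xy hx; rewrite /hit; congr (lim (_ @ \oo)); apply/funext => n.
have half56 : (2^-1 : R) <= 5 / 6 by lra.
have g0 : grid n (2 ^ n.+1) = 5 / 6.
  by rewrite gridE expnS natrM; field; rewrite gt_eqF// pow2_gt0.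
have lt1 : (2 ^ n.+1 < 3 * 2 ^ n)%N by rewrite expnS ltn_pmul2r// expn_gt0.
have cE j : (j <= 2 ^ n.+1)%N -> crossed x n j = crossed y n j.
  move=> jn; have gj : 2^-1 <= grid n j <= 5 / 6.
    by apply/andP; split; [rewrite lerDl divr_ge0|rewrite -g0 le_grid].
  by rewrite /crossed (xy _ gj) xy// lexx.
have cx : crossed x n (2 ^ n.+1) by rewrite /crossed g0 mulrC.
have ix := hit_index_leP lt1 cx.
rewrite /hit_grid; congr grid; apply/esym/hit_indexP; first exact: hit_index_le.
split=> [i ih|_]; first by rewrite -cE ?(leq_trans (ltnW ih))// before_hit.
by rewrite -cE// at_hit// (leq_ltn_trans ix).
Qed.

(** Written as a reflection about the stopped path, which is continuous whatever the value at
    [hit x]. When that value is 0 it is a change of sign. *)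
Definition flip_after_hit (x : R -> R) (r : R) := 2 * x (Num.min r (hit x)) - x r.

Lemma flip_after_hitE x r : ucont 0 1 x -> x 1 = 0 ->
  flip_after_hit x r = if r <= hit x then x r else - x r.
Proof.
move=> cx x1; rewrite /flip_after_hit; case: (leP r (hit x)) => _; first by ring.
by rewrite hit_zero// mulr0 sub0r.
Qed.

Lemma ucont_flip x : ucont 0 1 x -> ucont 0 1 (flip_after_hit x).
Proof.
move=> cx; have := ucont_lin 2 (- 1) (ucont_min cx (half_unit_time (hit_unit x))) cx.
by congr ucont; apply/funext => r; rewrite mulN1r.
Qed.

Definition flip_grid n (x : R -> R) := reflect_after (hit_grid n x) x.

(** Up to [hit x] nothing is reflected. After it, the mean subtracted by the grid reflection is at
    most 2 |x(s)| at the grid time s, and this tends to 0 because x vanishes at [hit x]. *)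
Lemma flip_grid_cvg x r : ucont 0 1 x -> x 1 = 0 -> unit_time r ->
  flip_grid n x r @[n --> \oo] --> flip_after_hit x r.
Proof.
move=> cx x1 /andP[r0 r1]; rewrite flip_after_hitE//; case: (leP r (hit x)) => rh.
  apply: cvg_near_cst; apply: nearW => n.
  by rewrite /flip_grid /reflect_after (le_trans rh (hit_le _ _)).
have hu n := hit_grid_unit n x.
have h0 : 2 * x (hit_grid n x) @[n --> \oo] --> (2 * 0 : R).
  apply: cvgMr; rewrite -(hit_zero cx x1).
  apply: (ucont_cvg cx) => [|n|]; last exact: hit_cvg.
    exact: (half_unit_time (hit_unit x)).
  exact: half_unit_time.
apply/cvgrPdist_lt => e e0.
move/cvgrPdist_lt : h0 => /(_ e e0) [N1 _ hN1].
have [N2 _ hN2] : \forall n \near \oo, hit_grid n x < r.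
  by have /cvgr_lt := @hit_cvg x; exact.
exists (maxn N1 N2) => // n /=; rewrite geq_max => /andP[n1 n2].
have hr := hN2 n n2; rewrite /flip_grid /reflect_after leNgt hr /=.
have := hN1 n n1; rewrite mulr0 sub0r normrN.
set rho := (_ / _); rewrite (_ : - x r - _ = - (2 * x (hit_grid n x) * rho)); last by ring.
apply: le_lt_trans; rewrite normrN normrM ler_piMr// normrM.
have s1 : 0 < 1 - hit_grid n x by rewrite subr_gt0 (lt_le_trans hr).
rewrite ger0_norm ?subr_ge0// ger0_norm ?invr_ge0 ?(ltW s1)//.
by rewrite ler_pdivrMr// mul1r lerD2l lerN2 ltW.
Qed.

End hitting.

(** * Invariance of the bridge under the change of sign *)

Section flip_law.
Context {R : realType} {d} {Om : measurableType d} (P : probability Om R).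
Variable b : Om -> R -> R.
Hypothesis bb : continuous_bridge P b.

Lemma grid_unit n j : (j <= 3 * 2 ^ n)%N -> unit_time (grid R n j).
Proof.
move=> jN; apply: half_unit_time; apply/andP; split; first by rewrite lerDl divr_ge0.
by rewrite -[leRHS](grid_last R n) le_grid.
Qed.

Let unit_half : unit_time (2^-1 : R).
Proof. by rewrite /unit_time invr_ge0 ler0n invf_le1// ler1n. Qed.

Lemma measurable_crossed n j : (j <= 3 * 2 ^ n)%N ->
  measurable [set y : pathR R | crossed y n j].
Proof.
move=> jN; rewrite -[X in measurable X]setTI.
have h : measurable_fun setT (fun y : pathR R => y (grid R n j) * y 2^-1).
  have := @measurable_funM _ (pathR R) R setT (fun y => y (grid R n j)) (fun y => y 2^-1).
  by apply; apply: measurable_eval => //; exact: grid_unit.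
have := h measurableT `]-oo, 0]%classic (measurable_itv _).
by congr measurable; apply/seteqP; split => y /=; rewrite in_itv.
Qed.

Lemma measurable_hit_index n j : (j <= 3 * 2 ^ n)%N ->
  measurable [set y : pathR R | hit_index n y = j].
Proof.
move=> jN.
have -> : [set y : pathR R | hit_index n y = j] =
    (\bigcap_(i in `I_j) ~` [set y : pathR R | crossed y n i]) `&`
    (if (j < 3 * 2 ^ n)%N then [set y : pathR R | crossed y n j] else setT).
  apply/seteqP; split => y /=.
    move/(hit_indexP _ jN) => [h1 h2]; split => [i ij|]; first exact/negP/h1.
    by case: ifP => // /h2.
  move=> [h1 h2]; apply/(hit_indexP _ jN); split => [i ij|jN'].
    exact/negP/h1.
  by move: h2; rewrite jN'.
apply: measurableI.
  apply: bigcap_measurableType => i ij; apply: measurableC; apply: measurable_crossed.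
  exact: ltnW (leq_trans ij jN).
by case: ifP => // h; exact: measurable_crossed.
Qed.

Lemma hit_index_reflect n j (x : R -> R) : (j <= 3 * 2 ^ n)%N ->
  hit_index n (reflect_after (grid R n j) x) = j <-> hit_index n x = j.
Proof.
move=> jN.
have cE i : (i <= j)%N ->
    crossed (reflect_after (grid R n j) x) n i = crossed x n i.
  by move=> ij; rewrite /crossed /reflect_after le_grid ij lerDl divr_ge0.
have e1 y : hit_index n y = j <-> (forall i, (i < j)%N -> ~~ crossed y n i) /\
    ((j < 3 * 2 ^ n)%N -> crossed y n j) by exact: hit_indexP.
rewrite !e1; split=> -[h1 h2]; split.
- by move=> i ij; have := h1 i ij; rewrite cE// ltnW.
- by move=> /h2; rewrite cE.
- by move=> i ij; rewrite cE ?(ltnW ij)// h1.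
- by move=> /h2; rewrite cE.
Qed.

Lemma sum_hit_index n (x : R -> R) (f : nat -> R) :
  \sum_(0 <= j < (3 * 2 ^ n).+1)
    \1_[set y : pathR R | hit_index n y = j] x * f j = f (hit_index n x).
Proof.
have us : uniq (index_iota 0 (3 * 2 ^ n).+1) by exact: iota_uniq.
have hs : hit_index n x \in index_iota 0 (3 * 2 ^ n).+1.
  by rewrite mem_index_iota ltnS hit_index_le.
move: us hs; move: (index_iota _ _) => s us hs.
rewrite (big_rem _ hs) /= indicE mem_set// mul1r big1_seq ?addr0// => j /andP[_].
rewrite (mem_rem_uniq _ us) inE => /andP[/eqP jh _].
by rewrite indicE memNset ?mul0r//=; exact/nesym.
Qed.

Lemma measurable_reflect_after s t : unit_time s -> unit_time t ->
  measurable_fun setT (fun x : pathR R => reflect_after s x t).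
Proof.
move=> s01 t01; rewrite /reflect_after; case: (t <= s); first exact: measurable_eval.
have := @measurable_funB _ (pathR R) R setT
  (fun x => 2 * ((1 - t) / (1 - s)) * x s) (fun x => x t).
apply; last exact: measurable_eval.
have := @measurable_funM _ (pathR R) R setT
  (fun x => 2 * ((1 - t) / (1 - s))) (fun x => x s).
by apply; [exact: (@measurable_cst _ _ (pathR R))|exact: measurable_eval].
Qed.

Lemma measurable_flip_grid n t : unit_time t ->
  measurable_fun setT (fun x : pathR R => flip_grid n x t).
Proof.
move=> t01; rewrite [X in measurable_fun _ X](_ : _ = fun x : pathR R =>
    \sum_(0 <= j < (3 * 2 ^ n).+1) if (j <= 3 * 2 ^ n)%N then
    \1_[set y : pathR R | hit_index n y = j] x * reflect_after (grid R n j) x t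
    else 0); last first.
  apply/funext => x; rewrite /flip_grid -(@sum_hit_index n x (fun j => reflect_after (grid R n j) x t)).
  by apply: eq_big_nat => j /=; rewrite ltnS => ->.
apply: measurable_sum => j; case: (boolP (j <= 3 * 2 ^ n)%N) => jN; last first.
  exact: (@measurable_cst _ _ (pathR R)).
have := @measurable_funM _ (pathR R) R setT
  (\1_[set y : pathR R | hit_index n y = j]) (fun x => reflect_after (grid R n j) x t).
apply; first by apply: measurable_indic; exact: measurable_hit_index.
by apply: measurable_reflect_after => //; exact: grid_unit.
Qed.

(** The strong Markov argument for a time with finitely many values. Where the index is j, the flip
    is the reflection at a fixed time, which keeps both the law and, by [hit_index_reflect], that
    event. *)
Lemma flip_grid_exp n X (phi : pathR R -> R) : bridge_law P b X -> bounded_mfun phi ->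
  \int[P]_w phi (flip_grid n (X w)) = \int[P]_w phi (X w).
Proof.
move=> bX bphi; have [mX _] := bX.
pose g j (y : pathR R) := if (j <= 3 * 2 ^ n)%N then
   \1_[set y : pathR R | hit_index n y = j] y * phi y else 0.
have bg j : bounded_mfun (g j).
  rewrite /g; case: (boolP (j <= 3 * 2 ^ n)%N) => jN; last exact: bounded_mfun_cst.
  apply: bounded_mfunM => //; apply: bounded_mfun_indic; exact: measurable_hit_index.
have sumg y : \sum_(0 <= j < (3 * 2 ^ n).+1) g j y = phi y.
  rewrite -[RHS](@sum_hit_index n y (fun=> phi y)); apply: eq_big_nat => j /=.
  by rewrite ltnS /g => ->.
have sumf y : \sum_(0 <= j < (3 * 2 ^ n).+1) g j (reflect_after (grid R n j) y) =
    phi (flip_grid n y).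
  rewrite -[RHS](@sum_hit_index n y (fun j => phi (reflect_after (grid R n j) y))).
  apply: eq_big_nat => j /=; rewrite ltnS /g => jN; rewrite jN !indicE.
  congr (_%:R * _); congr nat_of_bool; apply/idP/idP; rewrite !inE /=;
    by move=> /(hit_index_reflect _ jN).
have bcomp (Y : Om -> pathR R) (h : pathR R -> R) : bridge_law P b Y -> bounded_mfun h -> bounded_mfun (fun w => h (Y w)).
  move=> [mY _] [mh [M hM]]; split; first exact: measurableT_comp.
  by exists M => w; exact: hM.
have bR j : (j <= 3 * 2 ^ n)%N ->
    bridge_law P b (fun w => reflect_after (grid R n j) (X w)).
  by move=> jN; apply: bridge_reflect_after => //; exact: grid_unit.
have g0 j : ~~ (j <= 3 * 2 ^ n)%N -> g j = fun=> 0.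
  by move=> jN; apply/funext => y; rewrite /g (negbTE jN).
transitivity (\int[P]_w (\sum_(0 <= j < (3 * 2 ^ n).+1)
    g j (reflect_after (grid R n j) (X w)))).
  by apply: eq_Rintegral => w _; rewrite sumf.
transitivity (\int[P]_w (\sum_(0 <= j < (3 * 2 ^ n).+1) g j (X w))); last first.
  by apply: eq_Rintegral => w _; rewrite sumg.
rewrite !exp_sum; last 2 first.
- by move=> j; exact: bcomp.
- move=> j; have [jN|jN] := boolP (j <= 3 * 2 ^ n)%N.
    exact: (bcomp (fun w => reflect_after (grid R n j) (X w)) (g j) (bR j jN) (bg j)).
  by rewrite (g0 _ jN); exact: bounded_mfun_cst.
rewrite !big_nat; apply: eq_bigr => j /= jN.
apply: (bridge_exp (X := fun w => reflect_after (grid R n j) (X w)) _ bX (bg j)).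
exact: (bR j jN).
Qed.

Lemma cvg_lin (l : seq (R * R)) (x_ : nat -> R -> R) (x : R -> R) : times_in l ->
  (forall t, unit_time t -> x_ n t @[n --> \oo] --> x t) ->
  lin l (x_ n) @[n --> \oo] --> lin l x.
Proof.
move=> + cx; elim: l => [|p l ih] tl.
  by rewrite /lin big_nil; under eq_fun do rewrite big_nil; exact: cvg_cst.
rewrite /lin big_cons; under eq_fun do rewrite big_cons.
apply: cvgD; last by apply: ih => q ql; apply: tl; rewrite inE ql orbT.
by apply: cvgMr; apply: cx; apply: tl; rewrite inE eqxx.
Qed.

(** Expectations of cosines pass to the limit along the grid flips by dominated convergence. *)
Lemma bridge_flip X : is_bridge P b X ->
  is_bridge P b (fun w => flip_after_hit (X w)).
Proof.
move=> [cX X01 bX]; have [mX hX] := bX.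
have X1 w : X w 1 = 0 by have [] := X01 w.
have mflip t : unit_time t -> forall n, measurable_fun setT (fun w => flip_grid n (X w) t).
  move=> t01 n; exact: (measurableT_comp (measurable_flip_grid n t01) mX).
split=> [w|w|].
- exact: ucont_flip.
- have [x0 x1] := X01 w; have /andP[h1 h2] := hit_unit (X w).
  rewrite /flip_after_hit x0 x1 !subr0; split; last by rewrite min_r// hit_zero// mulr0.
  by rewrite min_l ?x0 ?mulr0// (le_trans _ h1)// invr_ge0.
split.
  apply: measurable_pathR => t t01.
  apply: (measurable_fun_cvg (h := fun n w => flip_grid n (X w) t)) => [n|w _].
    exact: mflip.
  exact: flip_grid_cvg.
move=> l c tl.
have mlin n : measurable_fun setT (fun w => cos (lin l (flip_grid n (X w)) + c)).
  have h : measurable_fun setT (fun w => flip_grid n (X w) : pathR R).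
    by apply: measurable_pathR => t t01; exact: mflip.
  have [mc _] := bounded_mfun_cos (measurable_funD (measurable_lin tl) (measurable_cst c)).
  exact: (measurableT_comp mc h).
have := @bounded_cvgT _ _ _ P (fun n w => cos (lin l (flip_grid n (X w)) + c))
  (fun w => cos (lin l (flip_after_hit (X w)) + c)) 1 mlin
  (fun n w => cos_max _).
have cflip w : cos (lin l (flip_grid n (X w)) + c) @[n --> \oo] -->
    cos (lin l (flip_after_hit (X w)) + c).
  apply: continuous_cvg; first exact: continuous_cos.
  apply: cvgD; last exact: cvg_cst.
  by apply: cvg_lin => // t t01; exact: flip_grid_cvg.
move=> /(_ cflip) h; rewrite -hX// -(cvg_lim _ h)//.
apply/cvg_lim => //; apply: cvg_near_cst; apply: nearW => n.
apply: (@flip_grid_exp n X (fun y : pathR R => cos (lin l y + c)) bX).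
by apply: bounded_mfun_cos; apply: measurable_funD => //; exact: measurable_lin.
Qed.

End flip_law.

(** * The space H *)

Section inner_product.
Context {d} {T : measurableType d} {R : realType}.
Variable mu : {measure set T -> \bar R}.
Implicit Types f g h : L2 mu.

Lemma ip_integrable f g :
  mu.-integrable setT (EFin \o (fun x => (f : T -> R) x * (g : T -> R) x)).
Proof. by apply/Lfun1_integrable; apply: Lfun2_mul_Lfun1; exact: L2_Lfun. Qed.

Lemma ip_ae_eq f g (u v : T -> R) : measurable_fun setT u -> measurable_fun setT v ->
  (f : T -> R) = u %[ae mu] -> (g : T -> R) = v %[ae mu] ->
  ip f g = \int[mu]_x (u x * v x).
Proof.
move=> mu_ mv fu gv; rewrite /ip /Rintegral; congr fine; apply: ae_eq_integral => //.
- by apply/measurable_EFinP; apply: measurable_funM; exact: L2_measurable.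
- by apply/measurable_EFinP; exact: measurable_funM.
- by apply: filterS2 fu gv => x /(_ I) + /(_ I) + _ => /= -> ->.
Qed.

Lemma ipC f g : ip f g = ip g f.
Proof. by rewrite /ip; apply: eq_Rintegral => x _; rewrite mulrC. Qed.

Lemma ipDl f g h : ip (f + g) h = ip f h + ip g h.
Proof.
rewrite (ip_ae_eq (u := fun x => f x + g x) (v := h)).
- rewrite /ip -RintegralD//; try exact: ip_integrable.
  by apply: eq_Rintegral => x _; rewrite mulrDl.
- by apply: measurable_funD; exact: L2_measurable.
- exact: L2_measurable.
- exact: L2_addE.
- exact: ae_eq_refl.
Qed.

Lemma ipZl a f g : ip (a *: f) g = a * ip f g.
Proof.
rewrite (ip_ae_eq (u := fun x => a * f x) (v := g)).
- rewrite /ip -RintegralZl//; last exact: ip_integrable.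
  by apply: eq_Rintegral => x _; rewrite mulrA.
- by apply: measurable_funM => //; exact: L2_measurable.
- exact: L2_measurable.
- exact: L2_scaleE.
- exact: ae_eq_refl.
Qed.

Lemma ipDr f g h : ip f (g + h) = ip f g + ip f h.
Proof. by rewrite ipC ipDl ipC [ip h f]ipC. Qed.

Lemma ipZr a f g : ip f (a *: g) = a * ip f g.
Proof. by rewrite ipC ipZl ipC. Qed.

Lemma ip0r f : ip f 0 = 0.
Proof. by rewrite -(scale0r (0 : L2 mu)) ipZr mul0r. Qed.

Lemma ip0l f : ip 0 f = 0. Proof. by rewrite ipC ip0r. Qed.

Lemma ipBl f g h : ip (f - g) h = ip f h - ip g h.
Proof. by rewrite -scaleN1r ipDl ipZl mulN1r. Qed.

Lemma ip_sumr I (s : seq I) f (g : I -> L2 mu) :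
  ip f (\sum_(i <- s) g i) = \sum_(i <- s) ip f (g i).
Proof.
elim: s => [|i s ih]; first by rewrite !big_nil ip0r.
by rewrite !big_cons ipDr ih.
Qed.

Lemma Cauchy_Schwarz f g : `|ip f g| <= `|f| * `|g|.
Proof.
have [->|g0] := eqVneq g 0; first by rewrite ip0r !normr0 mulr0.
have c0 : 0 < `|g| ^+ 2 by rewrite exprn_gt0// normr_gt0.
pose t := - (ip f g / `|g| ^+ 2).
have : 0 <= `|f + t *: g| ^+ 2 by rewrite exprn_ge0.
rewrite L2_normrE ipDl !ipDr !ipZl !ipZr -!L2_normrE [ip g f]ipC /t.
have -> : `|f| ^+ 2 + - (ip f g / `|g| ^+ 2) * ip f g +
    (- (ip f g / `|g| ^+ 2) * ip f g +
     - (ip f g / `|g| ^+ 2) * (- (ip f g / `|g| ^+ 2) * `|g| ^+ 2)) =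
    (`|f| ^+ 2 * `|g| ^+ 2 - ip f g ^+ 2) / `|g| ^+ 2.
  by field; rewrite normr_eq0.
rewrite pmulr_lge0 ?invr_gt0// subr_ge0 => h.
by rewrite -ler_sqr ?nnegrE ?mulr_ge0// real_normK ?num_real// exprMn.
Qed.

Lemma continuous_ip h : continuous (fun f : L2 mu => ip f h).
Proof.
move=> f; apply/(@cvgrPdist_lt _ _ _ _ (nbhs_filter f)) => e e0.
have h1 : 0 < `|h| + 1 by rewrite ltr_pwDr.
have eh : 0 < e / (`|h| + 1) by rewrite divr_gt0.
near=> g.
have fg : `|f - g| < e / (`|h| + 1).
  near: g; have := nbhsx_ballx f _ eh; rewrite -ball_normE; exact.
rewrite -ipBl (le_lt_trans (Cauchy_Schwarz _ _))//.
apply: (@le_lt_trans _ _ (`|f - g| * (`|h| + 1))); first by rewrite ler_wpM2l// lerDl.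
by rewrite -ltr_pdivlMr.
Unshelve. all: by end_near. Qed.

End inner_product.

Section H_classes.
Variable R : realType.
Local Notation D := (`]0, 1[%classic : set (measurableTypeR R)).
Local Notation lam := (@lebesgue_measure R).

Lemma lebesgue01T : lebesgue01 R setT = 1%E.
Proof.
by rewrite /lebesgue01 /= /mrestr setTI lebesgue_measure_itv/= lte_fin ltr01 oppr0 adde0.
Qed.

(** Only the open interval counts, as in [clsH]; boundedness makes every pairing an ordinary
    integral. *)
Definition bfun (f : R -> R) :=
  measurable_fun D f /\ exists M, forall x, 0 < x < 1 -> `|f x| <= M.

Lemma bfunD f g : bfun f -> bfun g -> bfun (fun x => f x + g x).
Proof.
move=> [mf [M fM]] [mg [N gN]]; split; first exact: measurable_funD.
by exists (M + N) => x x01; rewrite (le_trans (ler_normD _ _))// lerD ?fM ?gN.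
Qed.

Lemma bfunM f g : bfun f -> bfun g -> bfun (fun x => f x * g x).
Proof.
move=> [mf [M fM]] [mg [N gN]]; split; first exact: measurable_funM.
by exists (M * N) => x x01; rewrite normrM ler_pM ?fM ?gN.
Qed.

Lemma bfun_cst c : bfun (fun=> c).
Proof. by split => //; exists `|c|. Qed.

Lemma bfunZ a f : bfun f -> bfun (fun x => a * f x).
Proof. by move=> bf; apply: bfunM => //; exact: bfun_cst. Qed.

Lemma bfun_norm f : bfun f -> bfun (fun x => `|f x|).
Proof.
move=> [mf [M fM]]; split; first exact: measurableT_comp.
by exists M => x x01; rewrite normr_id fM.
Qed.

Lemma bfun_sum I (s : seq I) (f : I -> R -> R) : (forall i, bfun (f i)) ->
  bfun (fun x => \sum_(i <- s) f i x).
Proof.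
move=> bf; elim: s => [|i s ih].
  by under eq_fun do rewrite big_nil; exact: bfun_cst.
by under eq_fun do rewrite big_cons; exact: bfunD.
Qed.

Lemma measurable_restr01 f : measurable_fun D f ->
  measurable_fun setT (f \_ D : measurableTypeR R -> R).
Proof. by move=> mf; apply/(measurable_restrictT f (measurable_itv `]0, 1[)). Qed.

Lemma restr01_bound (f : R -> R) M : 0 <= M -> (forall x, 0 < x < 1 -> `|f x| <= M) ->
  forall x, `|(f \_ D) x| <= M.
Proof.
move=> M0 fM x; rewrite patchE; case: ifPn => [|_]; last by rewrite normr0.
by rewrite inE /= in_itv /= => /fM.
Qed.

Lemma bfun_Lfun f : bfun f -> f \_ D \in Lfun (lebesgue01 R) 2%:E.
Proof.
move=> [mf [M fM]]; have mf' := measurable_restr01 mf.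
apply: LfunI => //; rewrite /finite_norm unlock /=.
refine (poweR_lty _ _).
have M0 : 0 <= `|M| by [].
have fM' := restr01_bound M0 (fun x h => le_trans (fM x h) (ler_norm M)).
apply: (@le_lt_trans _ _ (\int[lebesgue01 R]_(x in setT) ((`|M| ^+ 2)%:E))%E).
  apply: ge0_le_integral => //.
  - apply/measurable_EFinP; apply: (measurableT_comp (measurable_powR 2)).
    exact: measurableT_comp.
  - move=> x _; rewrite lee_fin powR_mulrn//.
    by rewrite lerXn2r// nnegrE.
by rewrite integral_cst// lebesgue01T mule1 ltry.
Qed.

Lemma clsH_ae f : bfun f -> (clsH f : R -> R) = f \_ D %[ae lebesgue01 R].
Proof. by move=> bf; apply: clsE; exact: bfun_Lfun. Qed.

Lemma clsH_eq (f g : R -> R) : (forall x, 0 < x < 1 -> f x = g x) -> clsH f = clsH g.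
Proof.
move=> fg; rewrite /clsH; congr cls; apply/funext => x; rewrite !patchE.
by case: ifPn => //; rewrite inE /= in_itv /=; exact: fg.
Qed.

Lemma clsH_lin a b f g : bfun f -> bfun g ->
  clsH (fun x => a * f x + b * g x) = a *: clsH f + b *: clsH g.
Proof.
move=> bf bg; apply: L2_ext.
have b1 : bfun (fun x => a * f x + b * g x) by apply: bfunD; exact: bfunZ.
have h1 := ae_eq_both (L2_addE (a *: clsH f) (b *: clsH g)) (clsH_ae b1).
have h2 := ae_eq_both (L2_scaleE a (clsH f)) (L2_scaleE b (clsH g)).
have h3 := ae_eq_both (clsH_ae bf) (clsH_ae bg).
apply: filterS3 h1 h2 h3 => x [e1 e2] [e3 e4] [e5 e6] _.
have e7 := etrans e1 (congr2 +%R (etrans e3 (congr1 ( *%R a) e5))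
  (etrans e4 (congr1 ( *%R b) e6))).
refine (etrans e2 (etrans _ (esym e7))); rewrite !patchE.
by case: ifP => // _; rewrite !mulr0 addr0.
Qed.

Lemma clsHZ a f : bfun f -> clsH (fun x => a * f x) = a *: clsH f.
Proof.
move=> bf; have := clsH_lin a 0 bf bf; rewrite scale0r addr0 => <-.
by apply: clsH_eq => x _; rewrite mul0r addr0.
Qed.

Lemma clsHB f g : bfun f -> bfun g -> clsH f - clsH g = clsH (fun x => f x - g x).
Proof.
move=> bf bg; have := clsH_lin 1 (- 1) bf bg; rewrite scale1r scaleN1r => <-.
by apply: clsH_eq => x _; rewrite mul1r mulN1r.
Qed.

Lemma clsH_sum I (s : seq I) (a : I -> R) (f : I -> R -> R) : (forall i, bfun (f i)) ->
  clsH (fun x => \sum_(i <- s) a i * f i x) = \sum_(i <- s) a i *: clsH (f i).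
Proof.
move=> bf; elim: s => [|i s ih].
  rewrite big_nil -(scale0r (clsH (fun=> 0))) -clsHZ; last exact: bfun_cst.
  by apply: clsH_eq => x _; rewrite big_nil mul0r.
rewrite big_cons -ih -[X in _ = _ + X]scale1r -clsH_lin//; last first.
  by apply: bfun_sum => j; exact: bfunZ.
by apply: clsH_eq => x _; rewrite big_cons mul1r.
Qed.

Lemma absH_clsH f : bfun f -> absH (clsH f) = clsH (fun x => `|f x|).
Proof.
move=> bf; apply: L2_ext.
have h1 := clsE (Lfun_abs (L2_Lfun (clsH f))).
have h2 := ae_eq_both (clsH_ae bf) (clsH_ae (bfun_norm bf)).
apply: filterS2 h1 h2 => x /(_ I) e1 [e2 e3] _.
refine (etrans e1 (etrans (congr1 Num.norm e2) (etrans _ (esym e3)))).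
by rewrite !patchE; case: ifP => // _; rewrite normr0.
Qed.

Lemma Rintegral_lebesgue01 (h : R -> R) :
  \int[lebesgue01 R]_x (h \_ D) x = \int[lam]_(x in D) h x.
Proof.
rewrite -Rintegral_mkcond /Rintegral; congr fine.
by apply: eq_measure_integral => A mA AD; rewrite /= /mrestr setIidl.
Qed.

Lemma ip_clsH f g : bfun f -> bfun g ->
  ip (clsH f) (clsH g) = \int[lam]_(x in D) (f x * g x).
Proof.
move=> bf bg; rewrite -Rintegral_lebesgue01.
rewrite (ip_ae_eq (u := f \_ D) (v := g \_ D)).
- apply: eq_Rintegral => x _; rewrite !patchE; case: ifP => //.
  by rewrite mulr0.
- by apply: measurable_restr01; have [] := bf.
- by apply: measurable_restr01; have [] := bg.
- exact: clsH_ae.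
- exact: clsH_ae.
Qed.

Lemma bfun_integrable f : bfun f -> lam.-integrable D (EFin \o f).
Proof.
move=> [mf [M fM]]; apply: measurable_bounded_integrable => //.
  by rewrite /= lebesgue_measure_itv/= lte_fin ltr01 oppr0 adde0 ltry.
exists M; split; first exact: num_real.
by move=> N MN x /=; rewrite in_itv /= => /fM/le_trans; apply; exact: ltW.
Qed.

Lemma Rintegral01_cst (c : R) : \int[lam]_(x in D) c = c.
Proof.
rewrite Rintegral_cst//=.
by rewrite lebesgue_measure_itv/= lte_fin ltr01 oppr0 adde0 mulr1.
Qed.

Lemma Rintegral01_bound f M : bfun f -> (forall x, 0 < x < 1 -> `|f x| <= M) ->
  `|\int[lam]_(x in D) f x| <= M.
Proof.
move=> bf fM; rewrite (le_trans (le_normr_Rintegral _ (bfun_integrable bf)))//.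
rewrite -[leRHS]Rintegral01_cst; apply: le_Rintegral => //.
- exact: (bfun_integrable (bfun_norm bf)).
- exact: (bfun_integrable (bfun_cst M)).
Qed.

Lemma clsH_norm_le f M : bfun f -> 0 <= M -> (forall x, 0 < x < 1 -> `|f x| <= M) ->
  `|clsH f| <= M.
Proof.
move=> bf M0 fM; rewrite -ler_sqr ?nnegrE// L2_normrE ip_clsH//.
rewrite (le_trans (ler_norm _))// Rintegral01_bound//; first exact: bfunM.
by move=> x x01; rewrite normrM expr2 ler_pM ?fM.
Qed.

Lemma ucont_bfun f : ucont 0 1 f -> bfun f.
Proof.
move=> uf; split; last first.
  have [M hM] := ucont_bounded uf; exists M => x /andP[x0 x1].
  by apply: hM; rewrite !ltW.
have /ucontP cf := uf.
apply: (@measurable_funS _ _ (measurableTypeR R) (measurableTypeR R) (`[0, 1]%classic) D f) => //.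
  by move=> x /=; rewrite !in_itv /= => /andP[x0 x1]; rewrite !ltW.
exact: subspace_continuous_measurable_fun.
Qed.

Lemma Rintegral01_gt0 f a b : bfun f -> (forall x, 0 < x < 1 -> 0 <= f x) ->
  0 <= a -> a < b -> b <= 1 -> (forall x, a < x < b -> 0 < f x) ->
  0 < \int[lam]_(x in D) f x.
Proof.
move=> bf f0 a0 ab b1 fab.
have i0 : 0 <= \int[lam]_(x in D) f x.
  by apply: Rintegral_ge0 => x /=; rewrite in_itv /=; exact: f0.
rewrite lt_neqAle i0 andbT; apply/eqP => /esym I0.
have fi := bfun_integrable bf.
have E0 : (\int[lam]_(x in D) `|(f x)%:E| = 0)%E.
  transitivity (\int[lam]_(x in D) (f x)%:E)%E.
    by apply: eq_integral => x; rewrite inE /= in_itv /= => x01; rewrite ger0_norm// f0.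
  by rewrite -[LHS]fineK ?[fine _]I0//; exact: integrable_fin_num.
have mf : measurable_fun D (EFin \o f) by case/integrableP: fi.
have [/(_ E0)[N [mN N0 hN]] _] := ae_eq_integral_abs lam (measurable_itv `]0, 1[) mf.
have sub : `]a, b[%classic `<=` N.
  move=> x /=; rewrite in_itv /= => /[dup] xab /andP[ax xb]; apply: hN => /=.
  move=> /(_ _)/(congr1 fine) /= h; have := fab x xab; rewrite h ?ltxx//.
  by rewrite in_itv /= (le_lt_trans a0 ax) (lt_le_trans xb b1).
have : (lam `]a, b[%classic <= lam N)%E by apply: le_measure; rewrite ?inE.
by rewrite N0 lebesgue_measure_itv/= lte_fin ab -EFinB lee_fin subr_le0 leNgt ab.
Qed.

Lemma bfun_step a b : bfun (\1_(`[a, b[%classic : set R) : R -> R).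
Proof.
split; last by exists 1 => x _; rewrite indicE; case: (_ \in _); rewrite ?normr1 ?normr0.
by apply: measurable_indic; exact: measurable_itv.
Qed.

End H_classes.

(** * Events of H read on paths *)

Section step_approximation.
Variable R : realType.

Definition mesh (k : nat) : R := k.+1%:R.

Definition step_fun k (c : 'I_k.+1 -> int) (r : R) : R :=
  \sum_(i < k.+1) (c i)%:~R / mesh k *
    \1_(`[i%:R / mesh k, i.+1%:R / mesh k[%classic : set R) r.

(* Rounding the values makes the step approximations of a path take countably
   many values. *)
Definition round_path k (x : R -> R) (i : 'I_k.+1) : int :=
  Num.floor (mesh k * x (i%:R / mesh k)).

Definition step_class k (x : R -> R) : H R := clsH (step_fun (@round_path k x)).

Lemma mesh_gt0 k : 0 < mesh k. Proof. by rewrite ltr0n. Qed.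

Lemma mesh_unit k (i : 'I_k.+1) : unit_time (i%:R / mesh k).
Proof.
apply/andP; split; first by rewrite divr_ge0 ?(ltW (mesh_gt0 _)).
by rewrite ler_pdivrMr ?mesh_gt0// mul1r ler_nat ltnW.
Qed.

Lemma step_fun_bfun k (c : 'I_k.+1 -> int) : bfun (step_fun c).
Proof.
rewrite /step_fun; apply: bfun_sum => i.
exact: (bfunZ _ (bfun_step _ _)).
Qed.

Lemma step_funE k (c : 'I_k.+1 -> int) (r : R) : 0 < r < 1 ->
  exists2 i : 'I_k.+1, i%:R / mesh k <= r < i.+1%:R / mesh k &
    step_fun c r = (c i)%:~R / mesh k.
Proof.
move=> /andP[r0 r1]; have k0 := mesh_gt0 k.
have kr0 : 0 <= mesh k * r by rewrite mulr_ge0 ?ltW.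
have tle : (Num.truncn (mesh k * r))%:R <= mesh k * r by rewrite truncn_le.
have ik : (Num.truncn (mesh k * r) < k.+1)%N.
  rewrite -(ltr_nat R) (le_lt_trans tle)//.
  by rewrite -[ltRHS]mulr1 ltr_pM2l.
exists (Ordinal ik).
  by rewrite /= ler_pdivrMr// ltr_pdivlMr// [r * _]mulrC truncnS_gt tle.
have in_i (i : 'I_k.+1) : r \in (`[i%:R / mesh k, i.+1%:R / mesh k[%classic : set R) =
    (i == Ordinal ik).
  apply/idP/eqP => [|->]; rewrite inE /= in_itv /=; last first.
    by rewrite ler_pdivrMr// ltr_pdivlMr// [r * _]mulrC truncnS_gt tle.
  rewrite ler_pdivrMr// ltr_pdivlMr// [r * _]mulrC => /andP[h1 h2].
  by apply/val_inj => /=; apply/esym/eqP; rewrite truncn_eq// h1 h2.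
rewrite /step_fun (bigD1 (Ordinal ik))//= big1 ?addr0; last first.
  by move=> i /negbTE ni; rewrite indicE in_i ni mulr0.
by rewrite indicE (in_i (Ordinal ik)) eqxx mulr1.
Qed.

Lemma step_class_cvg x : ucont 0 1 x -> forall e, 0 < e ->
  exists N, forall k, (N <= k)%N -> `|step_class k x - clsH x| < e.
Proof.
move=> ux e e0.
have e4 : 0 < e / 4 by rewrite divr_gt0.
have [de de0 hde] := ux _ e4.
(* The mesh width must beat both the modulus of continuity and the rounding error, which is at most
   one mesh width. *)
pose m := Num.min de (e / 4).
have m0 : 0 < m by rewrite lt_min de0.
exists (Num.truncn m^-1) => k Nk.
have k0 := mesh_gt0 k.
have km : (mesh k)^-1 < m.
  rewrite invf_plt// (lt_le_trans (truncnS_gt _))//.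
  by rewrite ler_nat ltnS.
have bx := ucont_bfun ux; have bs := step_fun_bfun (@round_path k x).
rewrite clsHB//; apply: (@le_lt_trans _ _ (e / 2)); last first.
  by rewrite ltr_pdivrMr// ltr_pMr// ltr1n.
apply: clsH_norm_le; first by apply: bfunD => //; rewrite -[X in bfun X]/(fun r => - x r);
  have := bfunZ (-1) bx; congr bfun; apply/funext => r; rewrite mulN1r.
  by rewrite divr_ge0// ltW.
move=> r r01; have [i /andP[ir ri] ->] := step_funE (@round_path k x) r01.
have /andP[r0 r1] := r01.
have h1 : `|x (i%:R / mesh k) - x r| < e / 4.
  apply: hde; [exact: mesh_unit|by rewrite !ltW|].
  rewrite ler0_norm ?subr_le0// opprB.
  have : r - i%:R / mesh k < (mesh k)^-1.
    by rewrite ltrBlDr -[X in _ < X + _]mul1r -mulrDl nat1r.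
  by move=> /lt_trans; apply; apply: (lt_le_trans km); rewrite ge_min lexx.
have h2 : `|(@round_path k x i)%:~R / mesh k - x (i%:R / mesh k)| <= e / 4.
  rewrite /round_path; set y := x _.
  have f1 := floor_le (mesh k * y); have f2 := floorD1_gt (mesh k * y).
  rewrite ler0_norm; last by rewrite subr_le0 ler_pdivrMr// [y * _]mulrC.
  rewrite opprB lerBlDr -lerBlDl ler_pdivlMr//.
  have km' : (mesh k)^-1 <= e / 4 by rewrite (le_trans (ltW km))// ge_min lexx orbT.
  have : 1 <= e / 4 * mesh k by rewrite -ler_pdivrMr// mul1r.
  rewrite intrD in f2; rewrite mulrBl [y * _]mulrC; lra.
rewrite (_ : _ - x r = ((@round_path k x i)%:~R / mesh k - x (i%:R / mesh k)) +
  (x (i%:R / mesh k) - x r)); last by ring.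
rewrite (le_trans (ler_normD _ _))//; lra.
Qed.

Lemma measurable_floor_eval (a t : R) (m : int) : unit_time t ->
  measurable [set x : pathR R | Num.floor (a * x t) = m].
Proof.
move=> t01; rewrite -[X in measurable X]setTI.
have h : measurable_fun setT (fun x : pathR R => a * x t).
  have := @measurable_funM _ (pathR R) R setT (fun=> a) (fun x => x t).
  by apply; [exact: (@measurable_cst _ _ (pathR R))|exact: measurable_eval].
have := h measurableT `[m%:~R, (m + 1)%:~R[%classic (measurable_itv _).
congr measurable; apply/seteqP; split => x /= [_]; rewrite in_itv /= => h1; split => //.
  by apply/eqP; rewrite floor_eq.
by rewrite -h1 floor_le floorD1_gt.
Qed.

(** [S] is arbitrary: the step class factors through a countable set of integer codes, and each code
    is a finite intersection of conditions on floors of values. *)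
Lemma measurable_step_class k (S : set (H R)) :
  measurable [set x : pathR R | S (step_class k x)].
Proof.
pose dec (c : {ffun 'I_k.+1 -> int}) : H R := clsH (step_fun c).
pose code (x : pathR R) : {ffun 'I_k.+1 -> int} := [ffun i => round_path x i].
have decE x : step_class k x = dec (code x).
  by congr clsH; congr step_fun; apply/funext => i; rewrite ffunE.
have -> : [set x : pathR R | S (step_class k x)] =
    \bigcup_n (if unpickle n is Some c then
      [set x : pathR R | code x = c /\ S (dec c)] else set0).
  apply/seteqP; split => x /=.
    by rewrite decE => Sx; exists (pickle (code x)) => //; rewrite pickleK.
  by move=> [n _]; case: unpickle => [c|//] [<-]; rewrite decE.
apply: bigcupT_measurable => n; case: unpickle => [c|]; last exact: measurable0.
case: (pselect (S (dec c))) => Sc; last first.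
  rewrite [X in measurable X](_ : _ = set0)//.
  by apply/seteqP; split => x // [].
have -> : [set x : pathR R | code x = c /\ S (dec c)] =
    \bigcap_(i in [set: 'I_k.+1])
      [set x : pathR R | Num.floor (mesh k * x (i%:R / mesh k)) = c i].
  apply/seteqP; split => x /=.
    by move=> [<- _] i _ /=; rewrite ffunE.
  by move=> h; split => //; apply/ffunP => i; rewrite ffunE; exact: h.
apply: fin_bigcap_measurable; first exact: finite_finset.
by move=> i _; apply: measurable_floor_eval; exact: mesh_unit.
Qed.

(* Events of H are read on paths through the step classes, whose laws are
   discrete, instead of through a measurability proof for the class map. *)
Definition path_event (A : set (H R)) (D : set (pathR R)) :=
  measurable D /\ forall x z,
    (forall e, 0 < e -> exists N, forall k, (N <= k)%N -> `|step_class k x - z| < e) ->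
    D x <-> A z.

(** The sets admitting a path event form a sigma-algebra, so open sets suffice. *)
Lemma path_event_ex A : measurable A -> exists D, path_event A D.
Proof.
move: A; apply: smallest_sub.
  split.
  - exists set0; split; first exact: measurable0.
    by move=> x z _.
  - move=> A [D [mD hD]]; exists (~` D); split; first exact: measurableC.
    move=> x z /hD h; split => [n1|[_ n1] n2]; last by apply: n1; apply/h.
    by split => // n2; apply: n1; apply/h.
  - move=> A hA; have /choice[D hD] := hA.
    exists (\bigcup_n D n); split.
      by apply: bigcupT_measurable => n; have [] := hD n.
    move=> x z hz; split => [[n _ Dx]|[n _ Ax]]; exists n => //.
      by apply/((hD n).2 x z hz).
    by apply/((hD n).2 x z hz).
move=> U oU.
(* Points of U with a margin. The limit of the step classes is in U iff they eventually stay in U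
   with one fixed margin. *)
pose V (m : nat) : set (H R) := [set z | forall y, `|y - z| < (m.+1%:R)^-1 -> U y].
exists (\bigcup_m \bigcup_N \bigcap_(k in [set k | (N <= k)%N])
   [set x : pathR R | V m (step_class k x)]); split.
  apply: bigcupT_measurable => m; apply: bigcupT_measurable => N.
  by apply: bigcap_measurableType => k _; exact: measurable_step_class.
move=> x z hz; split.
  move=> [m _ [N _ hN]].
  have m0 : (0 : R) < m.+1%:R^-1 by rewrite invr_gt0.
  have [N' hN'] := hz _ m0.
  apply: (hN (maxn N N')); first by rewrite /= leq_maxl.
  by rewrite distrC; apply: hN'; rewrite leq_maxr.
move=> Uz.
have : nbhs (z : H R) U by apply: open_nbhs_nbhs; split.
rewrite -nbhs_ballE => -[e /= e0 he].
pose m := Num.truncn (e / 2)^-1.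
have m0 : (0 : R) < m.+1%:R^-1 by rewrite invr_gt0.
have me : m.+1%:R^-1 < e / 2.
  by rewrite invf_plt ?posrE ?divr_gt0// truncnS_gt.
exists m => //; have [N hN] := hz _ m0; exists N => // k /= Nk y yk.
apply: he; rewrite -ball_normE /=.
rewrite (le_lt_trans (ler_distD (step_class k x) _ _))//.
rewrite [ltRHS]splitr ltrD//; last by rewrite distrC; exact: lt_trans yk me.
by rewrite distrC; exact: lt_trans (hN k Nk) me.
Qed.

End step_approximation.

(** * Sine series *)

Section sines.
Variable R : realType.
Local Notation lam := (@lebesgue_measure R).
Local Notation D := (`]0, 1[%classic : set (measurableTypeR R)).

Definition sine (k : nat) (x : R) : R := Num.sqrt 2 * sin (k%:R * pi * x).

Lemma basisE k : Defs.basis R k = clsH (sine k). Proof. by []. Qed.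

Lemma is_derive_sinZ (c a x : R) :
  is_derive x 1 (fun y => c * sin (a * y)) (c * a * cos (a * x)).
Proof.
have h1 : is_derive x 1 (fun y : R => a * y) a.
  by apply: is_derive_eq; rewrite /GRing.scale /= mulr1.
have h2 := is_derive1_comp (is_derive_sin (a * x)) h1.
have h3 := is_deriveZ c h2.
by apply: (is_derive_eq h3); rewrite /GRing.scale /=; ring.
Qed.

Lemma is_derive_cosZ (c a x : R) :
  is_derive x 1 (fun y => c * cos (a * y)) (- c * a * sin (a * x)).
Proof.
have h1 : is_derive x 1 (fun y : R => a * y) a.
  by apply: is_derive_eq; rewrite /GRing.scale /= mulr1.
have h2 := is_derive1_comp (is_derive_cos (a * x)) h1.
have h3 := is_deriveZ c h2.
by apply: (is_derive_eq h3); rewrite /GRing.scale /=; ring.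
Qed.

Lemma sine_derive1 k : derive1 (sine k) =
  (fun x => Num.sqrt 2 * (k%:R * pi) * cos (k%:R * pi * x)).
Proof.
apply/funext => x; rewrite derive1E.
exact: (@derive_val _ _ _ _ _ _ _ (is_derive_sinZ _ _ x)).
Qed.

Lemma sine_derive2 k : derive1 (derive1 (sine k)) =
  (fun x => - (k%:R * pi) ^+ 2 * sine k x).
Proof.
rewrite sine_derive1; apply/funext => x; rewrite derive1E.
rewrite (@derive_val _ _ _ _ _ _ _ (is_derive_cosZ _ _ x)) /sine; ring.
Qed.

Lemma continuous_sinZ (c a : R) : continuous (fun y => c * sin (a * y)).
Proof.
by move=> x; apply/differentiable_continuous/derivable1_diffP;
  apply: ex_derive; exact: is_derive_sinZ.
Qed.

Lemma continuous_cosl (a : R) : continuous (fun y => cos (a * y)).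
Proof.
by move=> x; apply: continuous_comp; [exact: mulrl_continuous|exact: continuous_cos].
Qed.

Lemma sin_kpi k : sin (k%:R * pi) = 0 :> R.
Proof.
elim: k => [|k ih]; first by rewrite mul0r sin0.
by rewrite -natr1 mulrDl mul1r sinDpi ih oppr0.
Qed.

Lemma sine_test_function k : test_function (sine k).
Proof.
split.
- by move=> x; apply: ex_derive; exact: is_derive_sinZ.
- by move=> x; rewrite sine_derive1; apply: ex_derive; exact: is_derive_cosZ.
- rewrite sine_derive2.
  have -> : (fun x => - (k%:R * pi) ^+ 2 * sine k x) =
      (fun x => (- (k%:R * pi) ^+ 2 * Num.sqrt 2) * sin (k%:R * pi * x)).
    by apply/funext => x; rewrite /sine mulrA.
  exact: continuous_sinZ.
- by rewrite /sine mulr0 sin0 mulr0 mulr1 sin_kpi mulr0.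
Qed.

Lemma continuous_ucont (f : R -> R) : continuous f -> ucont 0 1 f.
Proof. by move=> cf; apply/ucontP; exact: continuous_subspaceT. Qed.

Lemma sine_bfun k : bfun (sine k).
Proof. by apply: ucont_bfun; apply: continuous_ucont; exact: continuous_sinZ. Qed.

Lemma sine_le k x : `|sine k x| <= Num.sqrt 2.
Proof.
by rewrite normrM ger0_norm ?sqrtr_ge0// ler_piMr ?sqrtr_ge0// sin_max.
Qed.

Lemma Rintegral_cosZ n : (0 < n)%N -> \int[lam]_(x in D) cos (n%:R * pi * x) = 0.
Proof.
move=> n0; have a0 : n%:R * pi != 0 :> R.
  by rewrite mulf_neq0 ?pnatr_eq0 -?lt0n// gt_eqF// pi_gt0.
have cc : continuous (fun x : R => cos (n%:R * pi * x)).
  exact: continuous_cosl.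
have bc : bfun (fun x : R => cos (n%:R * pi * x)).
  by apply: ucont_bfun; exact: continuous_ucont.
have bi := bfun_integrable bc.
have bi' : lam.-integrable `[0, 1[ (EFin \o (fun x : R => cos (n%:R * pi * x))).
  have cpt := @segment_compact R 0 1.
  have := continuous_compact_integrable cpt (continuous_subspaceT cc).
  apply: integrableS => // x /=; rewrite !in_itv /= => /andP[-> /ltW ->] //.
rewrite Rintegral_itv_obnd_cbnd// Rintegral_itv_bndo_bndc//.
rewrite /Rintegral (@continuous_FTC2 _ _ (fun x => (n%:R * pi)^-1 * sin (n%:R * pi * x)))//.
- by rewrite /= mulr1 mulr0 sin0 sin_kpi mulr0 subrr.
- exact: continuous_subspaceT.
- split.
  + by move=> x _; apply: ex_derive; exact: is_derive_sinZ.
  + by apply: cvg_at_right_filter; exact: continuous_sinZ.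
  + by apply: cvg_at_left_filter; exact: continuous_sinZ.
- move=> x _; rewrite derive1E.
  by rewrite (@derive_val _ _ _ _ _ _ _ (is_derive_sinZ _ _ x)) mulVf// mul1r.
Qed.

Lemma sine_orthonormal j k : (0 < j)%N -> (0 < k)%N ->
  ip (Defs.basis R j) (Defs.basis R k) = (j == k)%:R.
Proof.
wlog jk : j k / (k <= j)%N.
  move=> h j0 k0; have [kj|/ltnW jk] := leqP k j; first exact: h.
  by rewrite ipC h// eq_sym.
move=> j0 k0; rewrite !basisE ip_clsH; [|exact: sine_bfun|exact: sine_bfun].
have bcos n : bfun (fun x : R => cos (n%:R * pi * x)).
  apply: ucont_bfun; apply: continuous_ucont.
  exact: continuous_cosl.
transitivity (\int[lam]_(x in D) (cos ((j - k)%:R * pi * x) - cos ((j + k)%:R * pi * x))).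
  apply: eq_Rintegral => x _; rewrite /sine mulrACA -expr2 sqr_sqrtr//.
  rewrite natrB// natrD !mulrBl !mulrDl cosB cosD; ring.
rewrite RintegralB//; [|exact: bfun_integrable|exact: bfun_integrable].
rewrite [X in _ - X]Rintegral_cosZ ?addn_gt0 ?j0// subr0.
have [->|jk'] := eqVneq j k.
  rewrite subnn; under eq_Rintegral do rewrite mul0r mul0r cos0.
  exact: Rintegral01_cst.
by rewrite Rintegral_cosZ// subn_gt0 ltn_neqAle eq_sym jk'.
Qed.

Lemma sine_norm k : (0 < k)%N -> `|Defs.basis R k| = 1.
Proof.
move=> k0; apply/eqP; rewrite -(@eqrXn2 _ 2)// expr1n L2_normrE sine_orthonormal//.
by rewrite eqxx.
Qed.

Definition sine_span (M : nat) (f : R -> R) :=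
  exists a : nat -> R, forall x, f x = \sum_(1 <= k < M.+1) a k * sine k x.

Lemma sine_span_sine M k : (0 < k <= M)%N -> sine_span M (sine k).
Proof.
move=> /andP[k0 kM]; exists (fun j => (j == k)%:R) => x.
rewrite (bigD1_seq k) ?iota_uniq ?mem_index_iota ?k0 ?ltnS//= eqxx mul1r.
by rewrite big1 ?addr0// => j /negbTE ->; rewrite mul0r.
Qed.

Lemma sine_spanD M f g : sine_span M f -> sine_span M g ->
  sine_span M (fun x => f x + g x).
Proof.
move=> [a ha] [b hb]; exists (fun k => a k + b k) => x.
by rewrite ha hb -big_split /=; apply: eq_bigr => k _; rewrite mulrDl.
Qed.

Lemma sine_spanZ M c f : sine_span M f -> sine_span M (fun x => c * f x).
Proof.
move=> [a ha]; exists (fun k => c * a k) => x.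
by rewrite ha mulr_sumr; apply: eq_bigr => k _; rewrite mulrA.
Qed.

Lemma sine_span0 M : sine_span M (fun=> 0).
Proof. by exists (fun=> 0) => x; rewrite big1// => k _; rewrite mul0r. Qed.

Lemma sine_sqr_mul k x : (1 < k)%N -> sin (pi * x) ^+ 2 * sine k x =
  2^-1 * sine k x + (- 4^-1 * sine (k + 2) x + - 4^-1 * sine (k - 2) x).
Proof.
move=> k1; rewrite /sine.
have -> : (k + 2)%:R * pi * x = k%:R * pi * x + (pi * x + pi * x).
  by rewrite natrD; ring.
have -> : (k - 2)%:R * pi * x = k%:R * pi * x - (pi * x + pi * x).
  by rewrite natrB//; ring.
rewrite sinB !sinD cosD; have c2 := cos2Dsin2 (pi * x).
have -> : cos (pi * x) * cos (pi * x) = 1 - sin (pi * x) ^+ 2.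
  by rewrite -c2 -expr2 addrK.
by field.
Qed.

(** The frequency 1 - 2 folds back onto 1 with the opposite sign, which turns the coefficient 1/2
    into 3/4. *)
Lemma sine1_sqr_mul x : sin (pi * x) ^+ 2 * sine 1 x =
  3 / 4 * sine 1 x + - 4^-1 * sine 3 x.
Proof.
rewrite /sine mul1r; have -> : 3%:R * pi * x = pi * x + (pi * x + pi * x) by ring.
rewrite !sinD cosD; have c2 := cos2Dsin2 (pi * x).
have -> : cos (pi * x) * cos (pi * x) = 1 - sin (pi * x) ^+ 2.
  by rewrite -c2 -expr2 addrK.
rewrite [cos _ * (sin _ * cos _ + cos _ * sin _)](_ : _ =
  2 * sin (pi * x) * (cos (pi * x) ^+ 2)); last by ring.
have -> : cos (pi * x) ^+ 2 = 1 - sin (pi * x) ^+ 2 by rewrite -c2 addrK.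
by field.
Qed.

(** Multiplication by sin (pi x) ^ 2 spreads a frequency k over k - 2, k and k + 2, so raising the
    degree by two keeps a sine polynomial. *)
Lemma sin_odd_span N : sine_span (2 * N).+1 (fun x => sin (pi * x) ^+ (2 * N).+1).
Proof.
have s2 : Num.sqrt 2 != 0 :> R by rewrite gt_eqF// sqrtr_gt0.
elim: N => [|N [a ha]].
  exists (fun=> (Num.sqrt 2)^-1) => x.
  by rewrite muln0 expr1 big_nat1 /sine mul1r mulrA mulVf// mul1r.
have step k : (0 < k <= (2 * N).+1)%N ->
    sine_span (2 * N.+1).+1 (fun x => sin (pi * x) ^+ 2 * sine k x).
  move=> /andP[k0 kM]; have [k1|k1] := leqP k 1.
    have -> : k = 1%N by apply/eqP; rewrite eqn_leq k1.
    rewrite (funext sine1_sqr_mul); apply: sine_spanD; apply: sine_spanZ;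
      by apply: sine_span_sine; lia.
  rewrite (funext (fun x => sine_sqr_mul x k1)).
  apply: sine_spanD; first by apply: sine_spanZ; apply: sine_span_sine; lia.
  apply: sine_spanD; first by apply: sine_spanZ; apply: sine_span_sine; lia.
  (* For k = 2 the lowest frequency is 0, outside the index range of the span, but its sine
     vanishes. *)
  apply: sine_spanZ; have [k2|k2] := eqVneq k 2%N.
    rewrite k2 subnn (_ : sine 0 = fun=> 0); first exact: sine_span0.
    by apply/funext => x; rewrite /sine !mul0r sin0 mulr0.
  by apply: sine_span_sine; lia.
have -> : (fun x => sin (pi * x) ^+ (2 * N.+1).+1) =
    (fun x => \sum_(k <- index_iota 1 (2 * N).+2)
       if (0 < k <= (2 * N).+1)%N then a k * (sin (pi * x) ^+ 2 * sine k x) else 0).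
  apply/funext => x; rewrite (_ : (2 * N.+1).+1 = (2 + (2 * N).+1)%N); last by lia.
  rewrite exprD ha mulr_sumr; apply: eq_big_nat => k /andP[k1 k2].
  by rewrite k1 -ltnS k2 /= mulrCA.
elim: (index_iota _ _) => [|k s ih].
  by under eq_fun do rewrite big_nil; exact: sine_span0.
under eq_fun do rewrite big_cons; apply: sine_spanD => //.
case: (boolP (0 < k <= (2 * N).+1)%N) => hk; last exact: sine_span0.
by apply: sine_spanZ; exact: step.
Qed.

End sines.

(** * Kernels concentrating at the midpoint *)

Section sine_kernel.
Variable R : realType.
Local Notation lam := (@lebesgue_measure R).
Local Notation D := (`]0, 1[%classic : set (measurableTypeR R)).

(* Odd powers of the sine are sine polynomials, so these kernels, which
   concentrate at 1/2, lie in the span of the eigenfunctions. *)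
Definition sin_pow N (x : R) := sin (pi * x) ^+ (2 * N).+1.

Definition sin_mass N := \int[lam]_(x in D) sin_pow N x.

Definition peak N (x : R) := (sin_mass N)^-1 * sin_pow N x.

Lemma sin_pi_gt0 (x : R) : 0 < x < 1 -> 0 < sin (pi * x).
Proof.
move=> /andP[x0 x1]; apply: sin_gt0_pi; rewrite mulr_gt0 ?pi_gt0//=.
by rewrite -[ltRHS]mulr1 ltr_pM2l ?pi_gt0.
Qed.

Lemma sin_pow_gt0 N x : 0 < x < 1 -> 0 < sin_pow N x.
Proof. by move=> /sin_pi_gt0 h; rewrite exprn_gt0. Qed.

Lemma sin_pow_bfun N : bfun (sin_pow N).
Proof.
have bs : bfun (fun x : R => sin (pi * x)).
  apply: ucont_bfun; apply: continuous_ucont => x.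
  by apply: continuous_comp; [exact: mulrl_continuous|exact: continuous_sin].
rewrite /sin_pow; elim: (2 * N).+1 => [|n ih]; first exact: bfun_cst.
by under eq_fun do rewrite exprS; exact: bfunM.
Qed.

Lemma sin_mass_gt0 N : 0 < sin_mass N.
Proof.
apply: (Rintegral01_gt0 (a := 0) (b := 1)) => //; first exact: sin_pow_bfun.
- by move=> x /(sin_pow_gt0 N)/ltW.
- by move=> x /(sin_pow_gt0 N).
Qed.

Lemma peak_bfun N : bfun (peak N).
Proof. exact: bfunZ (sin_pow_bfun N). Qed.

Lemma peak_ge0 N x : 0 < x < 1 -> 0 <= peak N x.
Proof.
by move=> /(sin_pow_gt0 N) h; rewrite mulr_ge0 ?invr_ge0 ?(ltW (sin_mass_gt0 N)) ?ltW.
Qed.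

Lemma peak_mass N : \int[lam]_(x in D) peak N x = 1.
Proof.
rewrite RintegralZl//; last exact: bfun_integrable (sin_pow_bfun N).
by rewrite mulVf// gt_eqF// sin_mass_gt0.
Qed.

Lemma Rintegral01Z a f : bfun f ->
  \int[lam]_(x in D) (a * f x) = a * \int[lam]_(x in D) f x.
Proof. by move=> bf; rewrite RintegralZl//; exact: bfun_integrable. Qed.

Lemma Rintegral01_le f g : bfun f -> bfun g -> (forall x, 0 < x < 1 -> f x <= g x) ->
  \int[lam]_(x in D) f x <= \int[lam]_(x in D) g x.
Proof.
move=> bf bg fg; apply: le_Rintegral => //.
- exact: bfun_integrable bf.
- exact: bfun_integrable bg.
Qed.

Lemma Rintegral01_ge f a b c : bfun f -> (forall x, 0 < x < 1 -> 0 <= f x) ->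
  0 < a -> a <= b -> b < 1 -> (forall x, a <= x < b -> c <= f x) -> 
  c * (b - a) <= \int[lam]_(x in D) f x.
Proof.
move=> bf f0 a0 ab b1 fc.
have -> : b - a = \int[lam]_(x in D) (\1_(`[a, b[%classic : set R) x).
  rewrite /Rintegral integral_indic//.
  rewrite setIidl; last first.
    by move=> x /=; rewrite !in_itv /= => /andP[/(lt_le_trans a0) -> /lt_trans]; exact.
  have lE : lam `[a, b[%classic = (b - a)%:E.
    rewrite lebesgue_measure_itv /= lte_fin.
    by move: ab; rewrite le_eqVlt => /predU1P[->|->//]; rewrite ltxx subrr.
  exact: (congr1 fine (esym lE)).
rewrite -Rintegral01Z; last exact: bfun_step.
apply: Rintegral01_le => //; first by apply: bfunZ; exact: bfun_step.
move=> x x01; rewrite indicE; have [|_] := boolP (x \in _); last first.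
  by rewrite mulr0 f0.
by rewrite inE /= in_itv /= mulr1; exact: fc.
Qed.

Lemma sin_pi_cos (x : R) : sin (pi * x) = cos (pi * `|x - 2^-1|).
Proof.
have E y : cos (pi * `|y|) = cos (pi * y).
  have [y0|y0] := leP 0 y; first by rewrite ger0_norm.
  by rewrite ltr0_norm// mulrN cosN.
by rewrite E mulrBr cosB cos_pihalf sin_pihalf mulr0 add0r mulr1.
Qed.

Lemma cos_pi_le (a b : R) : 0 <= a -> a <= b -> b <= 1 -> cos (pi * b) <= cos (pi * a).
Proof.
move=> a0 ab b1; have p0 := @pi_gt0 R.
have hp (t : R) : 0 <= t -> t <= 1 -> pi * t \in `[0, pi].
  move=> t0 t1; rewrite in_itv /=; apply/andP; split.
    by rewrite mulr_ge0// ltW.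
  by rewrite -[leRHS]mulr1 ler_pM2l.
have [->//|ne] := eqVneq a b.
rewrite ltW// ltr_cos ?hp ?(le_trans a0)// ?(le_trans ab)//.
by rewrite ltr_pM2l// lt_neqAle ne.
Qed.

Lemma cos_pi_lt (a b : R) : 0 <= a -> a < b -> b <= 1 -> cos (pi * b) < cos (pi * a).
Proof.
move=> a0 ab b1; have p0 := @pi_gt0 R.
have hp (t : R) : 0 <= t -> t <= 1 -> pi * t \in `[0, pi].
  move=> t0 t1; rewrite in_itv /=; apply/andP; split.
    by rewrite mulr_ge0// ltW.
  by rewrite -[leRHS]mulr1 ler_pM2l.
by rewrite ltr_cos ?hp ?(le_trans a0 (ltW ab))// ?(le_trans (ltW ab))// ltr_pM2l.
Qed.

(** Laplace's method. Within [de] of 1/2 continuity controls the error. Farther away the sine is at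
    most [s], while on an interval of length [de / 2] around 1/2 it is at least [s'] > [s], so after
    division by the mass the kernel decays like (s / s') ^ (2 N + 1). *)
Lemma peak_cvg f : ucont 0 1 f ->
  \int[lam]_(x in D) (f x * peak N x) @[N --> \oo] --> f 2^-1.
Proof.
move=> uf; have bf := ucont_bfun uf.
have [F hF] := ucont_bounded uf.
have half01 : 0 <= (2^-1 : R) <= 1 by rewrite invr_ge0 ler0n invf_le1// ler1n.
have F0 : 0 <= F by apply: le_trans (hF _ half01).
apply/cvgrPdist_lt => e e0.
have e4 : 0 < e / 4 by rewrite divr_gt0.
have [d1 d10 hd1] := uf _ e4.
(* The cap 1/2 makes cos (pi de) nonnegative and keeps the intervals inside the unit interval. *)
pose de := Num.min d1 2^-1.
have de0 : 0 < de by rewrite lt_min d10 /=; lra.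
have de2 : de <= 2^-1 by rewrite ge_min lexx orbT.
have ded : de <= d1 by rewrite ge_min lexx.
pose s := cos (pi * de); pose s' := cos (pi * (de / 2)).
have s0 : 0 <= s.
  by rewrite /s -[leLHS](cos_pihalf R) cos_pi_le ?(ltW de0)//; lra.
have ss' : s < s' by apply: cos_pi_lt; lra.
have s'0 : 0 < s' by exact: le_lt_trans ss'.
pose q := s / s'.
have q01 : `|q| < 1 by rewrite ger0_norm ?divr_ge0// ?(ltW s'0)// ltr_pdivrMr// mul1r.
have mass N : de / 2 * s' ^+ (2 * N).+1 <= sin_mass N.
  rewrite mulrC [de / 2](_ : _ = (2^-1 + de / 4) - (2^-1 - de / 4)); last by field.
  apply: Rintegral01_ge; [exact: sin_pow_bfun| |lra|lra|lra|].
    by move=> x /(sin_pow_gt0 N)/ltW.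
  move=> x /andP[x1 x2]; rewrite /sin_pow lerXn2r ?nnegrE ?(ltW s'0)//.
    by apply/ltW/sin_pi_gt0/andP; split; lra.
  rewrite sin_pi_cos /s' cos_pi_le//; last by lra.
  by rewrite ler_norml; apply/andP; split; lra.
have cq : 2 * F / (de / 2) * q ^+ (2 * N).+1 @[N --> \oo] --> (2 * F / (de / 2) * 0 : R).
  apply: cvgMr; have := cvg_expr q01 => /cvgrPdist_lt h; apply/cvgrPdist_lt => t t0.
  have [n0 _ hn] := h t t0; exists n0 => // n /= n0n; apply: hn => /=.
  by rewrite (leq_trans n0n)// leqW// leq_pmull.
rewrite mulr0 in cq; move/cvgrPdist_lt : cq => /(_ _ e4) [n0 _ hn].
exists n0 => // N /= n0N.
have m0 := sin_mass_gt0 N.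
have -> : f 2^-1 - \int[lam]_(x in D) (f x * peak N x) =
    \int[lam]_(x in D) ((f 2^-1 - f x) * peak N x).
  under [in RHS]eq_Rintegral do rewrite mulrBl.
  rewrite RintegralB//; last 2 first.
  - by apply: bfun_integrable; apply: bfunZ; exact: peak_bfun.
  - by apply: bfun_integrable; apply: bfunM => //; exact: peak_bfun.
  by rewrite Rintegral01Z ?peak_mass ?mulr1//; exact: peak_bfun.
pose K := 2 * F * s ^+ (2 * N).+1 / sin_mass N.
have bfd : bfun (fun x => f 2^-1 - f x).
  have := bfunD (bfun_cst (f 2^-1)) (bfunZ (- 1) bf); congr bfun.
  by apply/funext => x; rewrite mulN1r.
have Kle : K < e / 4.
  have := hn N n0N; rewrite sub0r normrN; apply: le_lt_trans.
  rewrite (le_trans _ (ler_norm _))// /K /q expr_div_n.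
  rewrite -!mulrA ler_wpM2l// ler_wpM2l//.
  rewrite mulrCA ler_wpM2l ?exprn_ge0//.
  by rewrite -invfM lef_pV2 ?posrE// ?mass// mulr_gt0 ?divr_gt0// exprn_gt0.
rewrite (le_lt_trans (le_normr_Rintegral _ (bfun_integrable (bfunM bfd (peak_bfun N)))))//.
apply: (@le_lt_trans _ _ (\int[lam]_(x in D) (e / 4 * peak N x + K))).
  apply: Rintegral01_le.
  - exact: bfun_norm (bfunM bfd (peak_bfun N)).
  - by apply: bfunD; [apply: bfunZ; exact: peak_bfun|exact: bfun_cst].
  move=> x x01; have p0 := peak_ge0 N x01.
  rewrite normrM (ger0_norm p0).
  have K0 : 0 <= K.
    by rewrite /K divr_ge0 ?(ltW m0)// mulr_ge0 ?exprn_ge0// mulr_ge0.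
  have /andP[x0 x1] := x01.
  have x01' : 0 <= x <= 1 by rewrite !ltW.
  have [xd|xd] := ltP `|2^-1 - x| de.
    rewrite (@le_trans _ _ (e / 4 * peak N x)) ?lerDl// ler_wpM2r// ltW//.
    by apply: hd1 => //; exact: lt_le_trans xd ded.
  have h1 : `|f 2^-1 - f x| <= 2 * F.
    by rewrite (le_trans (ler_normB _ _))// mulr_natl mulr2n lerD// hF.
  rewrite (@le_trans _ _ K)//; last by rewrite lerDr mulr_ge0// ltW.
  rewrite /K -mulrA ler_pM// /peak mulrC ler_wpM2r ?invr_ge0 ?(ltW m0)//.
  rewrite /sin_pow lerXn2r ?nnegrE// ?(ltW (sin_pi_gt0 x01))//.
  rewrite sin_pi_cos distrC /s cos_pi_le// ?(ltW de0)// ler_norml.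
  by apply/andP; split; lra.
rewrite RintegralD//; last 2 first.
- by apply: bfun_integrable; apply: bfunZ; exact: peak_bfun.
- by apply: bfun_integrable; exact: bfun_cst.
rewrite Rintegral01Z ?peak_mass ?Rintegral01_cst; [lra|exact: peak_bfun].
Qed.

Lemma peak_coef_ex N : exists a : nat -> R,
  (forall x, peak N x = \sum_(1 <= k < (2 * N).+2) a k * sine k x) /\
  (forall k, (0 < k < (2 * N).+2)%N ->
     a k = \int[lam]_(x in D) (sine k x * peak N x)).
Proof.
have [a ha] := sine_spanZ (sin_mass N)^-1 (sin_odd_span R N).
exists a; split => [//|k /andP[k0 kN]].
have pE : clsH (peak N) = \sum_(1 <= j < (2 * N).+2) a j *: Defs.basis R j.
  by rewrite -clsH_sum; [apply: clsH_eq => x _; exact: ha|exact: sine_bfun].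
rewrite -ip_clsH; [|exact: sine_bfun|exact: peak_bfun].
rewrite -basisE pE ip_sumr (bigD1_seq k) ?iota_uniq ?mem_index_iota ?k0//=.
rewrite ipZr sine_orthonormal// eqxx mulr1 big_seq_cond big1 ?addr0// => j.
rewrite mem_index_iota => /andP[/andP[j0 _] jk].
by rewrite ipZr sine_orthonormal// eq_sym (negbTE jk) mulr0.
Qed.

Definition peak_coef N : nat -> R := sval (cid (peak_coef_ex N)).

Lemma peakE N : peak N =
  fun x => \sum_(1 <= k < (2 * N).+2) peak_coef N k * sine k x.
Proof. by apply/funext => x; have [h _] := svalP (cid (peak_coef_ex N)); exact: h. Qed.

Lemma peak_coefE N k : (0 < k < (2 * N).+2)%N ->
  peak_coef N k = \int[lam]_(x in D) (sine k x * peak N x).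
Proof. by move=> kN; have [_ h] := svalP (cid (peak_coef_ex N)); exact: h. Qed.

(** The kernel is nonnegative of mass 1. The uniformity in N and k later controls all higher modes
    at once. *)
Lemma peak_coef_le N k : (0 < k < (2 * N).+2)%N -> `|peak_coef N k| <= Num.sqrt 2.
Proof.
move=> kN; rewrite peak_coefE//.
have bp := peak_bfun N; have bs := sine_bfun R k.
rewrite (le_trans (le_normr_Rintegral _ (bfun_integrable (bfunM bs bp))))//.
have mE : Num.sqrt 2 * \int[lam]_(x in D) peak N x = Num.sqrt 2.
  by rewrite peak_mass mulr1.
rewrite -[leRHS]mE -Rintegral01Z//.
apply: Rintegral01_le; [exact: bfun_norm (bfunM bs bp)|exact: bfunZ|].
by move=> x /(peak_ge0 N) p0; rewrite normrM (ger0_norm p0) ler_wpM2r// sine_le.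
Qed.

Lemma peak_coef1_cvg : peak_coef N 1 @[N --> \oo] --> Num.sqrt 2.
Proof.
have := peak_cvg (continuous_ucont (@continuous_sinZ R (Num.sqrt 2) (1 * pi))).
rewrite mul1r sin_pihalf mulr1.
apply: cvg_trans; apply: near_eq_cvg; apply: nearW => N.
by rewrite peak_coefE//; apply: eq_Rintegral => x _; rewrite /sine mul1r.
Qed.

Lemma clsH_peak N : clsH (peak N) =
  \sum_(1 <= k < (2 * N).+2) peak_coef N k *: Defs.basis R k.
Proof. by rewrite peakE clsH_sum//; exact: sine_bfun. Qed.

End sine_kernel.

(** * The heat equation *)

Section linear_ode.
Variable R : realType.
Local Notation lam := (@lebesgue_measure R).

Lemma continuous_integrable (y : R -> R) (a b : R) : continuous y ->
  lam.-integrable `[a, b] (EFin \o y).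
Proof.
move=> cy; exact: (continuous_compact_integrable (@segment_compact R a b)
  (continuous_subspaceT cy)).
Qed.

Variables (y : R -> R) (k y0 : R).
Hypotheses (cy : continuous y) (k0 : k != 0).

Let I (s : R) := \int[lam]_(r in `[0, s]) y r.

(* If y' = - k y + f' with f 0 = 0 and y 0 = y0, this is f. *)
Definition forcing (s : R) := y s - y0 + k * I s.

(** The antiderivative of exp (k s) times the forcing that vanishes at 0, in closed form although y
    is only continuous. *)
Let J (s : R) := expR (k * s) * I s - y0 / k * (expR (k * s) - 1).

Lemma I_continuous (t : R) : 0 <= t -> {within `[0, t], continuous I}.
Proof.
move=> t0; exact: (parameterized_integral_continuous t0 (continuous_integrable _ _ cy)).
Qed.

Lemma forcing_ucont (t : R) : 0 <= t -> ucont 0 t forcing.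
Proof.
move=> t0; have /ucontP uy : {within `[0, t], continuous y} by exact: continuous_subspaceT.
have /ucontP uI := I_continuous t0.
have uc : ucont 0 t (fun=> y0) by move=> e e0; exists 1 => // *; rewrite subrr normr0.
have := ucont_lin 1 1 (ucont_lin 1 (- 1) uy uc) (ucont_lin k 0 uI uI).
congr ucont; apply/funext => s; rewrite /forcing; ring.
Qed.

Lemma is_derive_expRZ (x : R) : is_derive x 1 (fun s => expR (k * s)) (k * expR (k * x)).
Proof.
have h1 : is_derive x 1 (fun s : R => k * s) k.
  by apply: is_derive_eq; rewrite /GRing.scale /= mulr1.
have h2 := is_derive1_comp (is_derive_expR (k * x)) h1.
by apply: (is_derive_eq h2); rewrite mulrC.
Qed.

Lemma is_derive_J (t x : R) : 0 < x < t ->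
  is_derive x 1 J (expR (k * x) * forcing x).
Proof.
move=> /andP[x0 xt].
have [dI eI] := continuous_FTC1_closed xt (continuous_integrable 0 t cy) x0 (@cy x).
have hI : is_derive x 1 I (y x) := DeriveDef dI (etrans (esym (derive1E _ _)) eI).
have hE := is_derive_expRZ x.
have h := is_deriveB (is_deriveM hE hI)
  (is_deriveZ (y0 / k) (is_deriveB hE (is_derive_cst (1 : R) x 1))).
apply: (is_derive_eq h); rewrite /forcing /GRing.scale /=.
by field.
Qed.

Lemma J_continuous (t : R) : 0 <= t -> {within `[0, t], continuous J}.
Proof.
move=> t0; have cI := I_continuous t0.
have cE : continuous (fun s => expR (k * s)).
  by move=> x; apply: continuous_comp; [exact: mulrl_continuous|exact: continuous_expR].
move=> x; apply: cvgB.
  by apply: cvgM; [exact: (continuous_subspaceT cE)|exact: cI].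
apply: cvgM; first exact: cvg_cst.
by apply: cvgB; [exact: (continuous_subspaceT cE)|exact: cvg_cst].
Qed.

Definition time_mesh (t : R) (n i : nat) : R := t * (i%:R / n.+1%:R).

(** J t telescopes over the mesh, and the mean value theorem turns each increment into a value of
    the uniformly continuous integrand inside the mesh interval. *)
Lemma riemann_forcing (t : R) : 0 < t ->
  \sum_(i < n.+1) t / n.+1%:R * (expR (k * time_mesh t n i) * forcing (time_mesh t n i))
    @[n --> \oo] --> J t.
Proof.
move=> t0; have t0' := ltW t0.
have uF : ucont 0 t (fun s => expR (k * s) * forcing s).
  apply/ucontP.
  have cE : continuous (fun s => expR (k * s)).
    by move=> x; apply: continuous_comp; [exact: mulrl_continuous|exact: continuous_expR].
  have /ucontP cB := forcing_ucont t0'.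
  by move=> x; apply: cvgM; [exact: (continuous_subspaceT cE)|exact: cB].
apply/cvgrPdist_lt => e e0.
have et : 0 < e / (2 * t) by rewrite divr_gt0// mulr_gt0.
have [de de0 hde] := uF _ et.
exists (Num.truncn (t / de)) => // n /= hn.
have n0 : (0 : R) < n.+1%:R by [].
have tn : t / n.+1%:R < de.
  rewrite ltr_pdivrMr// mulrC -ltr_pdivrMr// (lt_le_trans (truncnS_gt _))//.
  by rewrite ler_nat ltnS.
have mesh_in i : (i <= n.+1)%N -> 0 <= time_mesh t n i <= t.
  move=> ile; rewrite /time_mesh mulr_ge0 ?divr_ge0//=.
  by rewrite ler_piMr// ler_pdivrMr// mul1r ler_nat.
have mesh_step i : time_mesh t n i.+1 - time_mesh t n i = t / n.+1%:R.
  by rewrite /time_mesh -natr1; field.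
have tele : J t = \sum_(i < n.+1) (J (time_mesh t n i.+1) - J (time_mesh t n i)).
  rewrite -(big_mkord xpredT (fun i => J (time_mesh t n i.+1) - J (time_mesh t n i))).
  rewrite telescope_sumr// /time_mesh divff ?gt_eqF// mulr1 mul0r mulr0.
  by rewrite /J /I set_itv1 Rintegral_set1 mulr0 expR0 subrr !mulr0 !subr0.
rewrite tele -sumrB (le_lt_trans (ler_norm_sum _ _ _))//.
apply: (@le_lt_trans _ _ (\sum_(i < n.+1) t / n.+1%:R * (e / (2 * t)))); last first.
  rewrite sumr_const card_ord -[X in X < _]mulr_natl.
  have -> : n.+1%:R * (t / n.+1%:R * (e / (2 * t))) = e / 2.
    by field; rewrite ?gt_eqF// ?nat1r ?natr1.
  by rewrite ltr_pdivrMr// ltr_pMr// ltr1n.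
apply: ler_sum => i _.
have s_lt : time_mesh t n i < time_mesh t n i.+1.
  by rewrite -subr_gt0 mesh_step divr_gt0.
have /andP[m0 _] := mesh_in i (ltnW (ltn_ord i)).
have /andP[_ m1] := mesh_in i.+1 (ltn_ord i).
have dJ x : x \in `]time_mesh t n i, time_mesh t n i.+1[ ->
    is_derive x 1 J (expR (k * x) * forcing x).
  rewrite in_itv /= => /andP[x1 x2]; apply: (@is_derive_J t).
  by rewrite (le_lt_trans m0 x1) (lt_le_trans x2 m1).
have cJ : {within `[time_mesh t n i, time_mesh t n i.+1], continuous J}.
  apply: continuous_subspaceW (J_continuous t0') => x /=.
  by rewrite !in_itv /= => /andP[x1 x2]; rewrite (le_trans m0 x1) (le_trans x2 m1).
have [c] := MVT s_lt dJ cJ; rewrite in_itv /= mesh_step => /andP[c1 c2] ->.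
rewrite [_ * (t / _)]mulrC -mulrBr normrM ger0_norm ?divr_ge0//.
rewrite ler_wpM2l ?divr_ge0// ltW// hde.
- by [].
- by rewrite (le_trans m0 (ltW c1)) (le_trans (ltW c2) m1).
- exact: mesh_in (ltnW (ltn_ord i)).
- rewrite ger0_norm ?subr_ge0 ?(ltW c1)// (lt_trans _ tn)//.
  by rewrite -(mesh_step i) ltrD2r.
Qed.

(* Riemann sums replace the Duhamel integral, so that a value of the solution is
   a limit of finite linear combinations of values of the noise. *)
Definition duhamel_weight (t : R) (n i : nat) : R :=
  - (k * expR (- (k * t)) * (t / n.+1%:R) * expR (k * time_mesh t n i)).

Lemma duhamel (t : R) : 0 < t ->
  forcing t + \sum_(i < n.+1) duhamel_weight t n i * forcing (time_mesh t n i)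
    @[n --> \oo] --> y t - expR (- (k * t)) * y0.
Proof.
move=> t0.
(* Variation of constants after an integration by parts, so that the forcing enters through its
   values and not through a derivative. *)
have -> : y t - expR (- (k * t)) * y0 = forcing t + - (k * expR (- (k * t))) * J t.
  rewrite /forcing /J.
  have e1 : expR (- (k * t)) * expR (k * t) = 1 by rewrite -expRD addNr expR0.
  have e2 : forall a b : R, - (k * expR (- (k * t))) * (expR (k * t) * a - b) =
      - k * a * (expR (- (k * t)) * expR (k * t)) + k * expR (- (k * t)) * b.
    by move=> a b; ring.
  rewrite e2 e1 mulr1.
  have e3 : k * expR (- (k * t)) * (y0 / k * (expR (k * t) - 1)) =
     y0 * (expR (- (k * t)) * expR (k * t)) - y0 * expR (- (k * t)).
    by field.
  by rewrite e3 e1; ring.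
apply: cvgD; first exact: cvg_cst.
rewrite [X in X @ _ --> _](_ : _ = fun n => - (k * expR (- (k * t))) *
    \sum_(i < n.+1) t / n.+1%:R *
      (expR (k * time_mesh t n i) * forcing (time_mesh t n i))).
  by apply: cvgMr; exact: riemann_forcing.
apply/funext => n; rewrite mulr_sumr; apply: eq_bigr => i _.
rewrite /duhamel_weight; ring.
Qed.

End linear_ode.

(** Setting the variables to 0 on the exceptional null set makes them converge everywhere, which
    gives a measurable limit. *)
Lemma ae_cvg_version {R : realType} d (Om : measurableType d)
    (P : probability Om R) (X : nat -> Om -> R) :
  (forall n, measurable_fun setT (X n)) ->
  {ae P, forall w, cvgn (X ^~ w)} ->
  exists2 Y : Om -> R, measurable_fun setT Y & {ae P, forall w, X n w @[n --> \oo] --> Y w}.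
Proof.
move=> mX [N [mN N0 hN]].
pose X' n w := \1_(~` N) w * X n w.
have cX' w : X' n w @[n --> \oo] --> limn (X' ^~ w).
  have [Nw|Nw] := pselect (N w).
    rewrite (_ : (fun n => X' n w) = fun=> 0); first exact: is_cvg_cst.
    by apply/funext => n; rewrite /X' indicE memNset ?mul0r.
  have cw : cvgn (X ^~ w) by apply: contrapT => /hN.
  rewrite (_ : (fun n => X' n w) = X ^~ w)//.
  by apply/funext => n; rewrite /X' indicE mem_set ?mul1r.
exists (fun w => limn (X' ^~ w)).
  apply: (measurable_fun_cvg (h := X')) => // n.
  by apply: measurable_funM => //; apply: measurable_indic; exact: measurableC.
exists N; split => // w /= h; apply: contrapT => Nw; apply: h.
have -> : (fun n => X n w) = X' ^~ w.
  by apply/funext => n; rewrite /X' indicE mem_set ?mul1r.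
exact: cX'.
Qed.

Section white_noise_facts.
Context {R : realType} {d} {Om : measurableType d} (P : probability Om R).
Variable W : L2 (spacetime R) -> Om -> R.
Hypothesis WN : white_noise P W.

Lemma noise_measurable h : measurable_fun setT (W h).
Proof. by have [hW _] := WN; have [mW _] := hW h. Qed.

Lemma noise0 : {ae P, forall w, W 0 w = 0}.
Proof.
have [_ lW] := WN; apply: filterS (lW 1 0 0) => w.
by rewrite scaler0 addr0 mul1r => /(congr1 (fun x => x - W 0 w)); rewrite subrr addrK.
Qed.

Lemma noise_sum I (s : seq I) (c : I -> R) (h : I -> L2 (spacetime R)) :
  {ae P, forall w, W (\sum_(i <- s) c i *: h i) w = \sum_(i <- s) c i * W (h i) w}.
Proof.
have [_ lW] := WN; elim: s => [|i s ih].
  by rewrite big_nil; apply: filterS noise0 => w ->; rewrite big_nil.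
rewrite big_cons; apply: filterS2 ih (lW (c i) (h i) (\sum_(j <- s) c j *: h j)).
by move=> w e1 ->; rewrite big_cons e1.
Qed.

(* [- W h] is [W (- h)], which has the law of [W h]. *)
Lemma noise_sin_exp h (th : R) : \int[P]_w sin (th * W h w) = 0.
Proof.
have [gW lW] := WN.
have mW := noise_measurable.
have bs g : bounded_mfun (fun w => sin (th * W g w)).
  by apply: bounded_mfun_sin; exact: measurable_funM.
have oppW : {ae P, forall w, W (- h) w = - W h w}.
  have := lW (- 1) h 0; rewrite scaleN1r addr0.
  by apply: filterS2 noise0 => w -> ->; rewrite addr0 mulN1r.
have e1 : \int[P]_w sin (th * W (- h) w) = \int[P]_w sin (th * W h w).
  have [m1 l1] := gW h; have [m2 l2] := gW (- h).
  apply: (@same_law_exp R _ _ _ Om Om (measurableTypeR R) P P _ _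
    (fun y => sin (th * y)) m2 m1).
    by move=> A mA; have := l2 A mA; rewrite normrN -(l1 A mA).
  by apply: bounded_mfun_sin; exact: measurable_funM.
have e2 : \int[P]_w sin (th * W (- h) w) = - 1 * \int[P]_w sin (th * W h w).
  rewrite -expZ//; apply: exp_ae_eq.
  - by have [] := bs (- h).
  - by apply: measurable_funM => //; have [] := bs h.
  - by apply: filterS oppW => w ->; rewrite mulrN sinN mulN1r.
by move: e2; rewrite e1; lra.
Qed.

End white_noise_facts.

Section heat.
Context {R : realType} {d} {Om : measurableType d} (P : probability Om R).
Variable W : L2 (spacetime R) -> Om -> R.
Hypothesis WN : white_noise P W.
Variable v : H R -> {nonneg R} -> Om -> H R.
Hypothesis hv : forall z, heat_solution P W z (v z).
Local Notation lam := (@lebesgue_measure R).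

(** The decay rate of mode k: [sine k] is an eigenfunction of half the Dirichlet Laplacian for the
    eigenvalue [- rate k]. *)
Definition rate (k : nat) : R := (k%:R * pi) ^+ 2 / 2.

Definition noise_test (s : R) (k : nat) : L2 (spacetime R) :=
  cls (spacetime R) (fun p => \1_`[0, (time s)%:num] p.1 * sine k p.2).

(** [None] indexes the boundary term of [duhamel] and [Some i] its Riemann sum. Gathering everything
    in one element of L^2 makes its noise a single symmetric Gaussian variable. *)
Definition heat_noise (t : R) (N n : nat) : L2 (spacetime R) :=
  \sum_(1 <= k < (2 * N).+2) peak_coef R N k *:
    (\sum_(i <- None :: [seq Some i | i <- index_enum 'I_n.+1])
      (if i is Some i then duhamel_weight (rate k) t n i else 1) *:
      noise_test (if i is Some i then time_mesh t n i else t) k).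

(** The deterministic heat flow from z at time t, paired with [peak N]. *)
Definition heat_mean (t : R) (N : nat) (z : H R) : R :=
  \sum_(1 <= k < (2 * N).+2)
    peak_coef R N k * (expR (- (rate k * t)) * ip z (Defs.basis R k)).

Definition heat_peak (t : R) (N : nat) (z : H R) (w : Om) : R :=
  ip (v z (time t) w) (clsH (peak N)).

Lemma rate_neq0 k : (0 < k)%N -> rate k != 0.
Proof.
move=> k0; rewrite /rate mulf_neq0 ?invr_neq0 ?pnatr_eq0// expf_neq0//.
by rewrite mulf_neq0 ?pnatr_eq0 -?lt0n// gt_eqF// pi_gt0.
Qed.

(** Testing the equation with an eigenfunction closes it: each mode solves a scalar linear equation
    whose forcing is the noise. *)
Lemma heat_forcing z k s : 0 <= s -> {ae P, forall w, W (noise_test s k) w =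
  forcing (fun r => ip (v z (time r) w) (Defs.basis R k)) (rate k)
    (ip z (Defs.basis R k)) s}.
Proof.
move=> s0; have [_ cv _ eqv] := hv z.
apply: filterS2 cv (eqv (sine k) (time s) (sine_test_function R k)) => w [_ cw].
have cy : continuous (fun r => ip (v z (time r) w) (Defs.basis R k)).
  move=> r; apply: (@continuous_comp _ _ _ (fun r => v z (time r) w)
    (fun f : H R => ip f (Defs.basis R k))); first exact: cw.
  exact: continuous_ip.
rewrite sine_derive2 (clsHZ _ (sine_bfun R k)).
rewrite -basisE /forcing /=.
under eq_Rintegral do rewrite ipZr.
rewrite RintegralZl//; last first.
  exact: (continuous_integrable _ _ cy).
rewrite ger0_norm// -/(noise_test s k) => ->.
rewrite /rate /noise_test /= ger0_norm//.
by field.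
Qed.

(** The approximating noise variables do not involve z, so the fluctuation around the mean is common
    to all initial conditions. *)
Lemma heat_noise_cvg t z : 0 < t -> {ae P, forall w N,
  W (heat_noise t N n) w @[n --> \oo] --> heat_peak t N z w - heat_mean t N z}.
Proof.
move=> t0; have [_ cv _ _] := hv z.
have mesh0 n i : 0 <= time_mesh t n i.
  by rewrite /time_mesh mulr_ge0 ?(ltW t0)// divr_ge0.
have A1 : {ae P, forall w N n, W (heat_noise t N n) w =
    \sum_(1 <= k < (2 * N).+2) peak_coef R N k * W
     (\sum_(i <- None :: [seq Some i | i <- index_enum 'I_n.+1])
      (if i is Some i then duhamel_weight (rate k) t n i else 1) *:
      noise_test (if i is Some i then time_mesh t n i else t) k) w}.
  by apply: ae_foralln => N; apply: ae_foralln => n; exact: noise_sum.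
have A2 : {ae P, forall w k n, W
     (\sum_(i <- None :: [seq Some i | i <- index_enum 'I_n.+1])
      (if i is Some i then duhamel_weight (rate k) t n i else 1) *:
      noise_test (if i is Some i then time_mesh t n i else t) k) w =
     \sum_(i <- None :: [seq Some i | i <- index_enum 'I_n.+1])
      (if i is Some i then duhamel_weight (rate k) t n i else 1) *
       W (noise_test (if i is Some i then time_mesh t n i else t) k) w}.
  by apply: ae_foralln => k; apply: ae_foralln => n; exact: noise_sum.
have A3 : {ae P, forall w k n i, W (noise_test (time_mesh t n i) k) w =
  forcing (fun r => ip (v z (time r) w) (Defs.basis R k)) (rate k)
    (ip z (Defs.basis R k)) (time_mesh t n i)}.
  apply: ae_foralln => k; apply: ae_foralln => n; apply: ae_foralln => i.
  exact: heat_forcing.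
have A4 : {ae P, forall w k, W (noise_test t k) w =
  forcing (fun r => ip (v z (time r) w) (Defs.basis R k)) (rate k)
    (ip z (Defs.basis R k)) t}.
  by apply: ae_foralln => k; apply: heat_forcing; exact: ltW.
apply: filterS (filterI A1 (filterI A2 (filterI A3 (filterI A4 cv)))).
move=> w [h1 [h2 [h3 [h4 [_ cw]]]]] N.
have cy k : continuous (fun r => ip (v z (time r) w) (Defs.basis R k)).
  move=> r; apply: (@continuous_comp _ _ _ (fun r => v z (time r) w)
    (fun f : H R => ip f (Defs.basis R k))); first exact: cw.
  exact: continuous_ip.
have -> : heat_peak t N z w - heat_mean t N z = \sum_(1 <= k < (2 * N).+2)
    peak_coef R N k * (if (0 < k)%N then ip (v z (time t) w) (Defs.basis R k) -
      expR (- (rate k * t)) * ip z (Defs.basis R k) else 0).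
  rewrite /heat_peak /heat_mean clsH_peak ip_sumr -sumrB; apply: eq_big_nat => k.
  by move=> /andP[k0 _]; rewrite k0 ipZr mulrBr.
rewrite (_ : (fun n => _) = fun n => \sum_(1 <= k < (2 * N).+2) peak_coef R N k *
   (if (0 < k)%N then
     forcing (fun r => ip (v z (time r) w) (Defs.basis R k)) (rate k)
      (ip z (Defs.basis R k)) t + \sum_(i < n.+1) duhamel_weight (rate k) t n i *
      forcing (fun r => ip (v z (time r) w) (Defs.basis R k)) (rate k)
      (ip z (Defs.basis R k)) (time_mesh t n i) else 0)); last first.
  apply/funext => n; rewrite h1; apply: eq_big_nat => k /andP[k0 _].
  rewrite k0 h2 big_cons mul1r h4 big_map; congr (_ * (_ + _)).
  by apply: eq_bigr => i _; rewrite h3.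
elim: (index_iota _ _) => [|k s ih].
  by rewrite big_nil; under eq_fun do rewrite big_nil; exact: cvg_cst.
rewrite big_cons; under eq_fun do rewrite big_cons; apply: cvgD => //.
apply: cvgMr; case: (boolP (0 < k)%N) => k0; last exact: cvg_cst.
by apply: duhamel => //; exact: rate_neq0.
Qed.

End heat.

(** * Borel measurability on H and K *)

Section borel.
Variable R : realType.

Lemma measurable_continuous_H (f : H R -> R) : continuous f ->
  measurable_fun setT f.
Proof.
move=> /continuousP cf; apply: (measurability _ (RGenOInfty.measurableE R)).
move=> _ [_ [a ->] <-]; rewrite setTI; apply: sub_sigma_algebra; apply: cf.
exact: interval_open.
Qed.

Lemma measurable_ip (h : H R) : measurable_fun setT (fun z : H R => ip z h).
Proof. by apply: measurable_continuous_H; exact: continuous_ip. Qed.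

Lemma measurable_ip_val (h : H R) : measurable_fun setT (fun x : K R => ip (\val x) h).
Proof.
have /continuousP cf := @continuous_ip _ _ _ (lebesgue01 R) h.
apply: (measurability _ (RGenOInfty.measurableE R)).
move=> _ [_ [a ->] <-]; rewrite setTI; apply: sub_sigma_algebra.
exists ((fun f => ip f h) @^-1` `]a, +oo[%classic); first exact/cf/interval_open.
by [].
Qed.

Lemma absH_lipschitz (f g : H R) : `|absH f - absH g| <= `|f - g|.
Proof.
have ab h := clsE (Lfun_abs (L2_Lfun (h : H R))).
have sb (u w : H R) := ae_eq_both (L2_addE u (- w)) (L2_scaleE (-1) w).
have uw : {ae lebesgue01 R, forall x, `|(absH f - absH g : H R) x| <= `|(f - g : H R) x|}.
  have h1 := sb (absH f) (absH g); have h2 := sb f g.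
  have h3 := ae_eq_both (ab f) (ab g).
  apply: filterS3 h1 h2 h3 => x [e1 e2] [e3 e4] [e5 e6].
  have e7 := etrans e1 (congr2 +%R e5 (etrans e2
    (etrans (congr1 ( *%R (- 1)) e6) (mulN1r _)))).
  have e8 := etrans e3 (congr2 +%R erefl (etrans e4 (mulN1r _))).
  exact: (eq_ind_r (fun c => `|c| <= _) (eq_ind_r (fun c => _ <= `|c|)
    (ler_dist_dist _ _) e8) e7).
rewrite -ler_sqr ?nnegrE// !L2_normrE /ip.
have i1 := ip_integrable (absH f - absH g) (absH f - absH g).
have i2 := ip_integrable (f - g) (f - g).
rewrite -lee_fin /Rintegral !fineK; [|exact: integrable_fin_num i2|exact: integrable_fin_num i1].
apply: ae_ge0_le_integral => //.
- by move=> x _; rewrite lee_fin -expr2 sqr_ge0.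
- by case/integrableP : i1.
- by move=> x _; rewrite lee_fin -expr2 sqr_ge0.
- by case/integrableP : i2.
apply: filterS uw => x h _; rewrite lee_fin -!expr2 -[leLHS]real_normK ?num_real//.
by rewrite -[leRHS]real_normK ?num_real// lerXn2r ?nnegrE.
Qed.

Lemma continuous_absH : continuous (@absH R).
Proof.
move=> f; apply/(@cvgrPdist_lt _ _ _ _ (nbhs_filter f)) => e e0.
near=> g; apply: le_lt_trans (absH_lipschitz _ _) _.
near: g; have := nbhsx_ballx f _ e0; rewrite -ball_normE; exact.
Unshelve. all: by end_near. Qed.

Lemma measurable_absK : measurable_fun setT (@absK R).
Proof.
have /continuousP ca := continuous_absH.
apply: (@measurability _ _ (H R) (K R) setT (@absK R) open erefl) => _ [_ [U oU <-] <-].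
by rewrite setTI; apply: sub_sigma_algebra; exact: ca.
Qed.

End borel.

(** * The midpoint value of the solution *)

Section heat_limit.
Context {R : realType} {d} {Om : measurableType d} (P : probability Om R).
Variable W : L2 (spacetime R) -> Om -> R.
Hypothesis WN : white_noise P W.
Variable v : H R -> {nonneg R} -> Om -> H R.
Hypothesis hv : forall z, heat_solution P W z (v z).
Variable t : R.
Hypothesis t0 : 0 < t.
Local Notation lam := (@lebesgue_measure R).

Lemma heat_peak_measurable N z : measurable_fun setT (heat_peak v t N z).
Proof.
have [mv _ _ _] := hv z.
exact: (measurableT_comp (measurable_ip _) (mv (time t))).
Qed.

Lemma heat_mean0 N : heat_mean t N 0 = 0.
Proof. by rewrite /heat_mean big1// => k _; rewrite ip0l !mulr0. Qed.

Lemma heat_meanD N (x y : H R) : heat_mean t N (x + y) = heat_mean t N x + heat_mean t N y.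
Proof.
by rewrite /heat_mean -big_split; apply: eq_bigr => k _ /=; rewrite ipDl; ring.
Qed.

Lemma heat_meanZ N a (x : H R) : heat_mean t N (a *: x) = a * heat_mean t N x.
Proof.
by rewrite /heat_mean mulr_sumr; apply: eq_bigr => k _ /=; rewrite ipZl; ring.
Qed.

Lemma heat_peak_shift z : {ae P, forall w N,
  heat_peak v t N z w = heat_mean t N z + heat_peak v t N 0 w}.
Proof.
apply: filterS2 (heat_noise_cvg WN hv z t0) (heat_noise_cvg WN hv 0 t0) => w h1 h2 N.
have := @cvg_unique _ (@norm_hausdorff _ R) _ _ _ _ (h1 N) (h2 N).
by rewrite heat_mean0 subr0 => /(_ _) <-; rewrite addrC subrK.
Qed.

(** At a positive time the solution has a continuous representative f, and c is f(1/2). The same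
    kernels applied to |f| recover |c|, which is all that the reflected process shows. *)
Lemma heat_midpoint z : {ae P, forall w, exists c : R,
  heat_peak v t N z w @[N --> \oo] --> c /\
  ip (absH (v z (time t) w)) (clsH (peak N)) @[N --> \oo] --> `|c|}.
Proof.
have [_ _ fv _] := hv z.
have tt : 0 < (time t)%:num :> R by rewrite /= ger0_norm ?ltW.
apply: filterS (fv (time t) tt) => w [f [/ucontP uf _ _ vf]].
have bf := ucont_bfun uf.
have ua : ucont 0 1 (fun x => `|f x|).
  by move=> e e0; have [de de0 h] := uf e e0; exists de => // r s ru su rs;
    rewrite (le_lt_trans (ler_dist_dist _ _))// h.
exists (f 2^-1); split.
  rewrite /heat_peak vf; under eq_fun do rewrite (ip_clsH bf (peak_bfun R _)).
  exact: peak_cvg.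
rewrite vf absH_clsH//; under eq_fun do rewrite (ip_clsH (bfun_norm bf) (peak_bfun R _)).
exact: (peak_cvg ua).
Qed.

(** The functional m of the overview. *)
Definition heat_value (z : H R) : R := limn (fun N => heat_mean t N z).

(** Convergence of this deterministic sequence is read off one sample point at which the solutions
    from z and from 0 both have midpoint values. *)
Lemma heat_mean_cvg z : heat_mean t N z @[N --> \oo] --> heat_value z.
Proof.
suff : cvgn (fun N => heat_mean t N z) by [].
have [w [[c [hc _]] [[c' [hc' _]] hs]]] := ae_ex (filterI (heat_midpoint z)
  (filterI (heat_midpoint 0) (heat_peak_shift z))).
apply: (cvgP (c - c')).
rewrite (_ : (fun N => _) = fun N => heat_peak v t N z w - heat_peak v t N 0 w).
  exact: cvgB.
by apply/funext => N; rewrite hs addrK.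
Qed.

Lemma heat_valueD x y : heat_value (x + y) = heat_value x + heat_value y.
Proof.
apply: cvg_lim => //; under eq_fun do rewrite heat_meanD.
by apply: cvgD; exact: heat_mean_cvg.
Qed.

Lemma heat_valueZ a x : heat_value (a *: x) = a * heat_value x.
Proof.
apply: cvg_lim => //; under eq_fun do rewrite heat_meanZ.
by apply: cvgMr; exact: heat_mean_cvg.
Qed.

Lemma measurable_heat_value : measurable_fun setT heat_value.
Proof.
apply: (measurable_fun_cvg (h := fun N => heat_mean t N)) => [N|z _]; last exact: heat_mean_cvg.
apply: measurable_sum => k; apply: measurable_funM => //.
by apply: measurable_funM => //; exact: measurable_ip.
Qed.

Lemma sin_exp_cvg0 (X : nat -> Om -> R) (Y : Om -> R) (th : R) :
  (forall n, measurable_fun setT (X n)) -> measurable_fun setT Y ->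
  {ae P, forall w, X n w @[n --> \oo] --> Y w} ->
  (forall n, \int[P]_w sin (th * X n w) = 0) -> \int[P]_w sin (th * Y w) = 0.
Proof.
move=> mX mY XY X0.
have ms (Z : Om -> R) : measurable_fun setT Z -> measurable_fun setT (fun w => sin (th * Z w)).
  by move=> mZ; apply: (bounded_mfun_sin _).1; exact: measurable_funM.
have lim : \int[P]_w sin (th * X n w) @[n --> \oo] --> \int[P]_w sin (th * Y w).
  apply: (bounded_cvg (M := 1)) => [n||n w|]; [exact: ms|exact: ms|..].
    by rewrite ler_norml sin_geN1 sin_le1.
  apply: filterS XY => w hw; apply: continuous_cvg; first exact: continuous_sin.
  exact: cvgMr.
apply: (@cvg_unique _ (@norm_hausdorff _ R) _ _ _ _ lim).
by rewrite (_ : (fun n => _) = fun=> 0) ?X0; [exact: cvg_cst|exact/funext].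
Qed.

(** C th is E cos (th Y), where Y is the midpoint value from the initial condition 0. The limit of C
    at 0 allows it to be cancelled at small th. *)
Lemma heat_abs_cos : exists2 C : R -> R, C (j.+1%:R^-1) @[j --> \oo] --> (1 : R) &
  forall z th, \int[P]_w cos (th * ip (absH (v z (time t) w)) (clsH (peak N)))
    @[N --> \oo] --> cos (th * heat_value z) * C th.
Proof.
have mp N := @heat_peak_measurable N.
have [Y mY hY] := @ae_cvg_version _ _ _ P (fun N => heat_peak v t N 0) (fun N => mp N 0)
  (filterS (fun w '(ex_intro c (conj h _)) => cvgP c h) (heat_midpoint 0)).
have mth (X : Om -> R) th : measurable_fun setT X -> measurable_fun setT (fun w => th * X w).
  by move=> mX; exact: measurable_funM.
have sin0 th : \int[P]_w sin (th * Y w) = 0.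
  (* The vanishing of the sine expectations passes through two limits, from the noise of the Riemann
     sums to the pairing with [peak N], then to Y. *)
  apply: (sin_exp_cvg0 (mp ^~ 0) mY hY) => N.
  apply: (@sin_exp_cvg0 (fun n => W (heat_noise t N n))) => //.
  - by move=> n; exact: noise_measurable WN _.
  - apply: filterS (heat_noise_cvg WN hv 0 t0) => w /(_ N).
    by rewrite heat_mean0 subr0.
  - by move=> n; exact: (noise_sin_exp WN).
exists (fun th => \int[P]_w cos (th * Y w)).
  have := @bounded_cvgT _ _ _ P (fun j w => cos (j.+1%:R^-1 * Y w)) (fun w => 1) 1.
  rewrite (_ : \int[P]_w 1 = 1); last first.
    by rewrite Rintegral_cst//= probability_setT mulr1.
  apply=> [j|j w|w].
  - by case: (bounded_mfun_cos (mth _ j.+1%:R^-1 mY)).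
  - by rewrite ler_norml cos_geN1 cos_le1.
  - have h : (j.+1%:R^-1 : R) * Y w @[j --> \oo] --> 0 * Y w.
      have h0 : (j.+1%:R^-1 : R) @[j --> \oo] --> (0 : R) by exact: cvg_harmonic.
      exact: cvgMl.
    rewrite -[X in _ --> X]cos0 -[X in cos X](mul0r (Y w)).
    by apply: continuous_cvg; first exact: continuous_cos.
move=> z th; have [mv _ _ _] := hv z.
have mA N : measurable_fun setT (fun w => ip (absH (v z (time t) w)) (clsH (peak N))).
  exact: (measurableT_comp (measurable_ip_val _) (measurableT_comp (@measurable_absK R) (mv (time t)))).
have -> : cos (th * heat_value z) * \int[P]_w cos (th * Y w) =
    \int[P]_w cos (th * (heat_value z + Y w)).
  under [RHS]eq_Rintegral do rewrite mulrDr cosD -mulNr.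
  rewrite expD ?expZ ?sin0 ?mulr0 ?addr0//.
  - exact: bounded_mfun_sin (mth _ th mY).
  - exact: bounded_mfun_cos (mth _ th mY).
  - by apply: bounded_mfunZ; exact: bounded_mfun_cos (mth _ th mY).
  - by apply: bounded_mfunZ; exact: bounded_mfun_sin (mth _ th mY).
apply: (bounded_cvg (M := 1)).
- by move=> N; case: (bounded_mfun_cos (mth _ th (mA N))).
- by case: (bounded_mfun_cos (mth _ th (measurable_funD (measurable_cst (heat_value z)) mY))).
- by move=> n w; rewrite ler_norml cos_geN1 cos_le1.
apply: filterS (filterI (heat_midpoint z) (filterI hY (heat_peak_shift z))).
move=> w [[c [hc ha]] [hYw hs]].
have <- : c = heat_value z + Y w.
  apply: (@cvg_unique _ (@norm_hausdorff _ R) _ _ _ _ hc).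
  rewrite (_ : (fun N => _) = fun N => heat_mean t N z + heat_peak v t N 0 w).
    by apply: cvgD => //; exact: heat_mean_cvg.
  exact/funext.
have -> : cos (th * c) = cos (th * `|c|).
  by case: (ger0P c) => c0 //; rewrite mulrN cosN.
apply: continuous_cvg; first exact: continuous_cos.
exact: cvgMr.
Qed.

End heat_limit.

(** * Dominance of the first eigenfunction *)

Section spectral_gap.
Context {R : realType}.

Lemma geometric_le2 (r : R) n : 0 <= r -> r <= 2^-1 -> \sum_(0 <= k < n) r ^+ k <= 2.
Proof.
move=> r0 r1; elim: n => [|n ih]; first by rewrite big_geq.
rewrite big_nat_recl// expr0; under eq_bigr do rewrite exprS.
rewrite -mulr_sumr.
have : r * \sum_(0 <= k < n) r ^+ k <= 2^-1 * 2.
  by apply: ler_pM => //; apply: sumr_ge0 => k _; rewrite exprn_ge0.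
rewrite mulVf ?pnatr_eq0//; lra.
Qed.

(** With r = exp (- rate 1 t), mode k decays like r ^ (k ^ 2), and k ^ 2 >= k + 2 for k >= 2. What
    remains is r ^ 2 times a geometric series of sum at most 2, uniformly in N. *)
Lemma heat_mean_first_mode (t : R) N z : expR (- rate 1 * t) <= 2^-1 ->
  `|heat_mean t N z - peak_coef R N 1 * expR (- rate 1 * t) * ip z (Defs.basis R 1)|
    <= 2 * Num.sqrt 2 * `|z| * expR (- rate 1 * t) ^+ 2.
Proof.
set r := expR _ => r2; have r0 : 0 <= r := expR_ge0 _.
have rk k : expR (- (rate k * t)) = r ^+ (k ^ 2).
  rewrite /r -expRM_natl; congr expR; rewrite /rate natrX; by field.
rewrite /heat_mean big_ltn// rk expr1 mulrA addrC addKr.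
apply: (@le_trans _ _ (\sum_(2 <= k < (2 * N).+2) Num.sqrt 2 * `|z| * r ^+ 2 * r ^+ k)).
  apply: (le_trans (ler_norm_sum _ _ _)).
  rewrite big_nat_cond [leRHS]big_nat_cond; apply: ler_sum => k /andP[/andP[k2 kN] _].
  rewrite rk !normrM (ger0_norm (exprn_ge0 _ r0)) -!mulrA.
  apply: ler_pM => //; first by rewrite mulr_ge0 ?exprn_ge0.
    by apply: peak_coef_le; rewrite kN (leq_trans _ k2).
  rewrite mulrC; apply: ler_pM => //; first exact: exprn_ge0.
    by rewrite (le_trans (Cauchy_Schwarz _ _))// sine_norm ?mulr1// (leq_trans _ k2).
  rewrite -!exprS; apply: ler_wiXn2l => //; first by rewrite (le_trans r2)// invf_le1// ler1n.
  by nia.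
rewrite -mulr_sumr [leRHS](_ : _ = Num.sqrt 2 * `|z| * r ^+ 2 * 2); last by ring.
apply: ler_wpM2l; first by rewrite !mulr_ge0// exprn_ge0.
apply: le_trans (geometric_le2 (2 * N).+2 r0 r2).
rewrite [leRHS](big_cat_nat (n := 2))//= lerDr.
by apply: sumr_ge0 => k _; rewrite exprn_ge0.
Qed.

Lemma heat_mean_limit_gt0 (t c : R) z : heat_mean t N z @[N --> \oo] --> c ->
  expR (- rate 1 * t) <= 2^-1 ->
  expR (- rate 1 * t) * (2 * `|z|) < ip z (Defs.basis R 1) -> 0 < c.
Proof.
set r := expR _ => hc r2 rz; have r0 : 0 < r := expR_gt0 _.
have h1 : `|heat_mean t N z - peak_coef R N 1 * r * ip z (Defs.basis R 1)| @[N --> \oo] -->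
    `|c - Num.sqrt 2 * r * ip z (Defs.basis R 1)|.
  apply: cvg_norm; apply: cvgB => //; rewrite -!mulrA.
  under eq_fun do rewrite -mulrA; apply: cvgMl; exact: peak_coef1_cvg.
have h2 : `|c - Num.sqrt 2 * r * ip z (Defs.basis R 1)| <= 2 * Num.sqrt 2 * `|z| * r ^+ 2.
  rewrite -(cvg_lim (@norm_hausdorff _ _) h1); apply: limr_le; first exact: cvgP h1.
  by apply: nearW => N; exact: heat_mean_first_mode.
have s2 : 0 < Num.sqrt 2 :> R by rewrite sqrtr_gt0.
have : 0 < Num.sqrt 2 * r * (ip z (Defs.basis R 1) - r * (2 * `|z|)).
  by rewrite !mulr_gt0// subr_gt0.
have := ler_norm (- (c - Num.sqrt 2 * r * ip z (Defs.basis R 1))); rewrite normrN.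
move: h2; rewrite expr2 => h2 h3; nra.
Qed.

Lemma heat_decay (e : R) : 0 < e -> exists2 t, 0 < t & expR (- rate 1 * t) < e.
Proof.
move=> e0; have a0 : 0 < rate 1 :> R by rewrite /rate divr_gt0// exprn_gt0// mul1r pi_gt0.
(* The exponent becomes - 1 / e, and exp (1 / e) > 1 / e. *)
exists ((rate 1 * e)^-1); first by rewrite invr_gt0 mulr_gt0.
rewrite mulNr invfM mulrA divff ?gt_eqF// mul1r expRN invf_plt//.
  by rewrite (lt_le_trans _ (expR_ge1Dx _))// ltrDr.
by rewrite posrE expR_gt0.
Qed.

End spectral_gap.

(** * Detection of the initial condition *)

Lemma measurable_cvg_set {R : realType} d (T : measurableType d) (f : nat -> T -> R)
    (g : T -> R) : (forall n, measurable_fun setT (f n)) -> measurable_fun setT g ->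
  measurable [set x | f n x @[n --> \oo] --> g x].
Proof.
move=> mf mg.
rewrite (_ : mkset _ = \bigcap_k \bigcup_M \bigcap_(n in [set n | (M <= n)%N])
    ((fun x => `|g x - f n x|) @^-1` `]-oo, k.+1%:R^-1[%classic)).
  apply: bigcap_measurableType => k _; apply: bigcupT_measurable => M.
  apply: bigcap_measurableType => n _; rewrite -[X in measurable X]setTI.
  have : measurable_fun setT (fun x => `|g x - f n x|).
    by apply: measurableT_comp => //; exact: measurable_funB.
  by apply => //; exact: measurable_itv.
apply/seteqP; split => x /=.
  move=> /cvgrPdist_lt h k _.
  have k0 : (0 : R) < k.+1%:R^-1 by rewrite invr_gt0.
  by have [M _ hM] := h _ k0; exists M.
move=> h; apply/cvgrPdist_lt => e e0.
have [M _ hM] := h (Num.truncn e^-1) I.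
exists M => // n Mn; have := hM n Mn; rewrite /= in_itv /= => /lt_trans; apply.
by rewrite invf_plt ?posrE// truncnS_gt.
Qed.

(** A single index beyond |a| + |b| suffices: both arguments then lie in [0, pi] up to sign, where
    the cosine is injective. *)
Lemma cos_seq_inj {R : realType} (a b : R) :
  (exists M, forall j, (M <= j)%N -> cos (j.+1%:R^-1 * a) = cos (j.+1%:R^-1 * b)) ->
  `|a| = `|b|.
Proof.
move=> [M hM]; pose j := maxn M (Num.truncn (`|a| + `|b|)).
have j0 : (0 : R) < j.+1%:R by [].
have jab : `|a| + `|b| <= j.+1%:R.
  rewrite (le_trans (ltW (truncnS_gt _)))// ler_nat ltnS /j.
  by rewrite leq_maxr.
have cosn (x : R) : cos (j.+1%:R^-1 * x) = cos (j.+1%:R^-1 * `|x|).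
  by case: (ger0P x) => // _; rewrite mulrN cosN.
have := hM j (leq_maxl _ _); rewrite cosn [in RHS]cosn => h.
have in_pi (x : R) : `|x| <= j.+1%:R -> j.+1%:R^-1 * `|x| \in `[0, pi].
  move=> xj; rewrite in_itv /= mulr_ge0//= (@le_trans _ _ 1)//; last first.
    by have := @pi_ge2 R; lra.
  by rewrite mulrC ler_pdivrMr// mul1r.
have a' := normr_ge0 a; have b' := normr_ge0 b.
have aj : `|a| <= j.+1%:R by lra.
have bj : `|b| <= j.+1%:R by lra.
have := cos_inj (in_pi a aj) (in_pi b bj) h.
by apply: mulfI; rewrite invr_neq0// gt_eqF.
Qed.

Section detection.
Context {R : realType} {d} {Om : measurableType d}.
Variables (F : {nonneg R} -> set (set Om)) (u : {nonneg R} -> Om -> K R)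
  (P : K R -> probability Om R).
Hypothesis diffu : diffusion F u P.

Lemma diffusion_measurable t : measurable_fun setT (u t).
Proof.
have [_ sF _ _] := diffusion_filtration diffu.
move=> _ B mB; rewrite setTI; apply: (sF t); exact: diffusion_adapted diffu t B mB.
Qed.

Lemma measurable_path_eval (t : {nonneg R}) (B : set (K R)) : measurable B ->
  measurable [set w : Defs.path R | B (w t)].
Proof. by move=> mB; apply: sub_sigma_algebra; exists t, B. Qed.

Lemma diffusion_exp_measurable t (phi : K R -> R) : bounded_mfun phi ->
  measurable_fun setT (fun x => \int[P x]_w phi (u t w)).
Proof.
move=> bphi; have [mphi [M hM]] := bphi.
have mu_ := diffusion_measurable t.
have bu : bounded_mfun (fun w => phi (u t w)).
  by split; [exact: measurableT_comp|exists M => w; exact: hM].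
(* Integration against a kernel is measurable for nonnegative functions; the shift by |M| is
   subtracted at the end. *)
pose k (y : K R) : \bar R := (phi y + `|M|)%:E.
have k0 y : (0 <= k y)%E.
  have /ler_normlP[h _] := hM y.
  by rewrite lee_fin; have := ler_norm M; lra.
have mk : measurable_fun setT k by apply/measurable_EFinP; exact: measurable_funD.
pose l x : {measure set (K R) -> \bar R} := distribution (P x) (mfun_Sub (mem_set mu_)).
have ml B : measurable B -> measurable_fun setT (l ^~ B).
  by move=> mB; exact: (diffusion_kernel diffu (measurable_path_eval t mB)).
have mi := measurable_fun_integral_kernel ml k0 mk.
rewrite (_ : (fun x => _) = fun x => fine (\int[l x]_y k y)%E - `|M|).
  by apply: measurable_funB => //; apply: measurableT_comp mi.
apply/funext => x.
have -> : (\int[l x]_y k y = \int[P x]_w k (u t w))%E.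
  rewrite [LHS](@ge0_integral_pushforward _ _ _ _ _ (u t) mu_ (P x) setT k)//.
have -> : fine (\int[P x]_w k (u t w))%E = \int[P x]_w (phi (u t w) + `|M|) by [].
rewrite expD//; last exact: bounded_mfun_cst.
by rewrite Rintegral_cst//= probability_setT mulr1 addrK.
Qed.


Context {d'} {Om' : measurableType d'} (P' : probability Om' R).
Variable W : L2 (spacetime R) -> Om' -> R.
Hypothesis WN : white_noise P' W.
Variable v : H R -> {nonneg R} -> Om' -> H R.
Hypothesis hv : forall z, heat_solution P' W z (v z).

(** The set where the laws differ need not be Borel. [B j] is the measurable part of it detected at
    the frequency 1 / (j + 1), where the cosine expectations of the diffusion fail to converge to
    those of the heat equation. Countably many frequencies determine |m|. *)
Lemma heat_detection (t : R) : 0 < t -> exists B : nat -> set (H R),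
  [/\ forall j, measurable (B j),
      forall j, B j `<=` [set z | ~ same_law (pushforward (P (absK z)) (path_of u))
        (pushforward P' (path_of (fun s w => absK (v z s w))))] &
      forall y z, (forall j, ~ B j y) -> (forall j, ~ B j z) -> absH y = absH z ->
        `|heat_value t y| = `|heat_value t z|].
Proof.
move=> t0; have [C C1 hC] := heat_abs_cos WN hv t0.
pose phi (th : R) (N : nat) (x : K R) := cos (th * ip (\val x) (clsH (peak N))).
have bphi th N : bounded_mfun (phi th N).
  apply: bounded_mfun_cos; apply: measurable_funM => //; exact: measurable_ip_val.
pose q th N (z : H R) := \int[P (absK z)]_w phi th N (u (time t) w).
have mq th N : measurable_fun setT (q th N).
  apply: (measurableT_comp (diffusion_exp_measurable (time t) (bphi th N))).
  exact: measurable_absK.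
pose g th z := cos (th * heat_value t z) * C th.
have mg th : measurable_fun setT (g th).
  apply: measurable_funM => //; apply: (bounded_mfun_cos _).1.
  by apply: measurable_funM => //; exact: (measurable_heat_value WN hv t0).
exists (fun j => ~` [set z | q j.+1%:R^-1 N z @[N --> \oo] --> g j.+1%:R^-1 z]); split.
- by move=> j; apply: measurableC; apply: measurable_cvg_set.
- move=> j z /= nc sl; apply: nc.
  rewrite (_ : (fun N => _) = fun N => \int[P']_w
    cos (j.+1%:R^-1 * ip (absH (v z (time t) w)) (clsH (peak N)))); first exact: hC.
  apply/funext => N; have [mv _ _ _] := hv z.
  apply: (same_law_exp (X := u (time t)) (Y := fun w => absK (v z (time t) w))
    (phi := phi j.+1%:R^-1 N)) => //; first exact: diffusion_measurable.
    exact: measurableT_comp (@measurable_absK R) (mv _).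
  by move=> A mA; exact: (sl _ (measurable_path_eval (time t) mA)).
move=> y z hy hz yz.
have {}hy j := contrapT (hy j); have {}hz j := contrapT (hz j).
have eK : absK y = absK z by apply: val_inj.
have eg j : g j.+1%:R^-1 y = g j.+1%:R^-1 z.
  apply: (@cvg_unique _ (@norm_hausdorff _ R) _ _ _ _ (hy j)).
  have -> : (fun N => q j.+1%:R^-1 N y) = fun N => q j.+1%:R^-1 N z.
    by apply/funext => N; rewrite /q eK.
  exact: hz.
apply: cos_seq_inj; have /cvgrPdist_lt/(_ 1 ltr01)[M _ hM] := C1.
(* For large j the common factor is within distance less than 1 of its limit 1, hence can be
   cancelled. *)
exists M => j Mj; have Cj : C j.+1%:R^-1 != 0.
  by apply/eqP => C0; have := hM j Mj; rewrite /= C0 subr0 normr1 ltxx.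
exact: (mulIf Cj (eg j)).
Qed.

End detection.

(** * Reflections of the bridge *)

Section bridge_almost_surely.
Context {R : realType} {d} {Om : measurableType d} (P : probability Om R).
Variable b : Om -> R -> R.
Hypothesis bb : continuous_bridge P b.

Lemma bridge_lin_neq0 X l : is_bridge P b X -> times_in l -> 0 < cov l l ->
  {ae P, forall w, lin l (X w) != 0}.
Proof.
move=> [_ _ bX] tl l0; have [mX _] := bX; have [_ _ _ gb] := bb.
have ml := measurable_lin tl.
have m0 : measurable [set y : pathR R | lin l y = 0].
  rewrite -[X in measurable X]setTI; exact: ml _ [set 0] (measurable_set1 _).
have : P (X @^-1` [set y : pathR R | lin l y = 0]) = 0.
  have [_ _ bl] := bridge_refl bb; rewrite (bridge_prob bX bl m0).
  have [_ h] := gb l tl; apply: (etrans (h [set 0] (measurable_set1 _))).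
  rewrite /centered_gaussian_law gt_eqF//.
  by move/null_content_dominatesP: (normal_prob_dominates 0 (Num.sqrt (cov l l))); apply; [exact: measurable_set1|exact: lebesgue_measure_set1].
have : measurable (X @^-1` [set y : pathR R | lin l y = 0]).
  by rewrite -[X in measurable X]setTI; exact: mX.
move=> m P0; have := ae_prob0 m P0; apply: filterS => w /= h.
by apply/eqP.
Qed.

(** The path event of A carries its nullity from [beta] to every process with the law of the bridge,
    with no need to view the class of X as a random element of H. *)
Lemma bridge_avoids_null (beta : R -> Om -> R) (mu : probability (H R) R) X A :
  {ae P, forall w, forall r, unit_time r -> beta r w = b w r} ->
  has_law P (path_class beta) mu -> is_bridge P b X -> measurable A -> mu A = 0 ->
  {ae P, forall w, ~ A (clsH (X w))}.
Proof.
move=> bE [mbeta lbeta] [cX _ bX] mA A0; have [mX _] := bX.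
have [cb _ [mb _]] := bridge_refl bb.
have [D [mD hD]] := path_event_ex mA.
have DA x : ucont 0 1 x -> D x <-> A (clsH x) by move=> /step_class_cvg/hD.
have pre (Y : Om -> pathR R) : measurable_fun setT Y -> measurable (Y @^-1` D).
  by move=> mY; rewrite -[X in measurable X]setTI; exact: mY.
have PX : P (X @^-1` D) = 0.
  have [_ _ bl] := bridge_refl bb; rewrite (bridge_prob bX bl mD) -A0 -lbeta//.
  apply: prob_ae_eq; first exact: pre.
    by rewrite -[X in measurable X]setTI; exact: mbeta.
  apply: filterS bE => w bw; rewrite /preimage /= DA// /path_class.
  rewrite (@clsH_eq _ (fun r => beta r w) (b w))// => r /andP[r0 r1].
  by apply: bw; rewrite /unit_time !ltW.
by apply: filterS (ae_prob0 (pre _ mX) PX) => w nD /(DA _ (cX w)).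
Qed.

End bridge_almost_surely.

(** * Functionals with localized dual paths *)

Section tents.
Context {R : realType}.

(** The value at the middle of [0, 1/2], respectively of [5/6, 1], minus its linear interpolation
    from the endpoints, the bridge being 0 at times 0 and 1. It is uncorrelated with the path
    outside the interval, so the dual path is a tent on it. *)
Definition early_tent : seq (R * R) := [:: (1, 4^-1); (- 2^-1, 2^-1)].
Definition late_tent : seq (R * R) := [:: (1, 11 / 12); (- 2^-1, 5 / 6)].

Lemma early_tent_times : times_in early_tent.
Proof. by move=> p; rewrite !inE => /orP[|] /eqP -> /=; apply/andP; split; lra. Qed.

Lemma late_tent_times : times_in late_tent.
Proof. by move=> p; rewrite !inE => /orP[|] /eqP -> /=; apply/andP; split; lra. Qed.

Lemma cov1_early (r : R) : cov [:: (1, r)] early_tent =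
  Num.min r 4^-1 - 2^-1 * Num.min r 2^-1.
Proof.
rewrite /cov big_seq1 /early_tent !big_cons big_nil /= /bridge_cov; by field.
Qed.

Lemma cov1_late (r : R) : cov [:: (1, r)] late_tent =
  Num.min r (11 / 12) - 2^-1 * Num.min r (5 / 6) - 2^-1 * r.
Proof.
rewrite /cov big_seq1 /late_tent !big_cons big_nil /= /bridge_cov; by field.
Qed.

Lemma cov_pair (a r c s : R) l : cov [:: (a, r); (c, s)] l =
  a * cov [:: (1, r)] l + c * cov [:: (1, s)] l.
Proof. by rewrite cov_cons cov_cons cov0l addr0. Qed.

Lemma early_tent_var : cov early_tent early_tent = 8^-1.
Proof.
rewrite cov_pair !cov1_early !minEle; do ?[case: ifPn; rewrite -?ltNge => ?]; lra.
Qed.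

Lemma late_tent_var : cov late_tent late_tent = 24^-1.
Proof.
rewrite cov_pair !cov1_late !minEle; do ?[case: ifPn; rewrite -?ltNge => ?]; lra.
Qed.

Lemma dual_path_early (r : R) : 0 <= r -> 
  [/\ 2^-1 <= r -> dual_path early_tent r = 0, 0 <= dual_path early_tent r &
      0 < r < 2^-1 -> 0 < dual_path early_tent r].
Proof.
move=> r0; rewrite /dual_path early_tent_var cov1_early invrK.
split; rewrite !minEle; do ?[case: ifPn; rewrite -?ltNge => ?]; lra.
Qed.

Lemma dual_path_late (r : R) : r <= 1 ->
  [/\ r <= 5 / 6 -> dual_path late_tent r = 0, 0 <= dual_path late_tent r &
      5 / 6 < r < 1 -> 0 < dual_path late_tent r].
Proof.
move=> r1; rewrite /dual_path late_tent_var cov1_late invrK.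
split; rewrite !minEle; do ?[case: ifPn; rewrite -?ltNge => ?]; lra.
Qed.

Lemma dual_path_first_mode l (a c : R) : times_in l -> 0 <= a -> a < c -> c <= 1 ->
  (forall r, 0 < r < 1 -> 0 <= dual_path l r) ->
  (forall r, a < r < c -> 0 < dual_path l r) ->
  0 < ip (clsH (dual_path l)) (Defs.basis R 1).
Proof.
move=> tl a0 ac c1 p0 pac; rewrite basisE ip_clsH; last exact: sine_bfun.
  have s0 (r : R) : 0 < r < 1 -> 0 < sine 1 r.
    by move=> r01; rewrite /sine mul1r mulr_gt0 ?sqrtr_gt0// sin_pi_gt0.
  apply: (Rintegral01_gt0 (a := a) (b := c)) => //.
  - by apply: bfunM; [exact: ucont_bfun (ucont_dual_path tl)|exact: sine_bfun].
  - by move=> r r01; rewrite mulr_ge0 ?p0// ltW// s0.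
  - move=> r /[dup] rac /andP[ar rc]; rewrite mulr_gt0 ?pac// s0//.
    by rewrite (le_lt_trans a0 ar) (lt_le_trans rc c1).
exact: ucont_bfun (ucont_dual_path tl).
Qed.

Lemma early_first_mode : 0 < ip (clsH (dual_path early_tent)) (Defs.basis R 1).
Proof.
apply: (dual_path_first_mode early_tent_times (a := 0) (c := 2^-1)); [lra..| |].
  by move=> r /andP[r0 _]; have [] := dual_path_early (ltW r0).
by move=> r /[dup] h /andP[r0 _]; have [_ _] := dual_path_early (ltW r0); apply.
Qed.

Lemma late_first_mode : 0 < ip (clsH (dual_path late_tent)) (Defs.basis R 1).
Proof.
apply: (dual_path_first_mode late_tent_times (a := 5 / 6) (c := 1)); [lra..| |].
  by move=> r /andP[_ r1]; have [] := dual_path_late (ltW r1).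
by move=> r /[dup] h /andP[_ r1]; have [_ _] := dual_path_late (ltW r1); apply.
Qed.

End tents.

(** * Sign changes between 1/2 and 5/6 *)

Section crossing.
Context {R : realType} {d} {Om : measurableType d} (P : probability Om R).
Variable b : Om -> R -> R.
Hypothesis bb : continuous_bridge P b.

Definition crosses (x : R -> R) := x 2^-1 * x (5 / 6) <= 0.

(* In the orthonormal coordinates U = 2 x(1/2) and V = 3 (x(5/6) - x(1/2) / 3),
   reflecting along [tilt_late] maps V to - V, and reflecting along [swap_pair]
   exchanges U and V. *)
Definition tilt_late : seq (R * R) := [:: (1, 5 / 6); (- 3^-1, 2^-1)].
Definition swap_pair : seq (R * R) := [:: (1, 2^-1); (-1, 5 / 6)].

Lemma cov1_pair (a s c t r : R) : cov [:: (1, r)] [:: (a, s); (c, t)] =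
  a * bridge_cov r s + c * bridge_cov r t.
Proof. by rewrite covC cov_pair ![cov _ [:: (1, r)]]covC !cov11. Qed.

Lemma bridge_cov_half : [/\ bridge_cov 2^-1 2^-1 = 4^-1 :> R,
  bridge_cov 2^-1 (5 / 6) = 12^-1 :> R, bridge_cov (5 / 6) 2^-1 = 12^-1 :> R &
  bridge_cov (5 / 6) (5 / 6) = 5 / 36 :> R].
Proof.
by rewrite /bridge_cov !minEle; split; do ?[case: ifPn; rewrite -?ltNge => ?]; lra.
Qed.

Lemma reflect_tilt_late (x : R -> R) :
  reflect_along tilt_late x 2^-1 = x 2^-1 /\
  reflect_along tilt_late x (5 / 6) = 2 / 3 * x 2^-1 - x (5 / 6).
Proof.
have [h1 h2 h3 h4] := bridge_cov_half.
rewrite /reflect_along /dual_path /tilt_late cov_pair !cov1_pair h1 h2 h3 h4.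
by rewrite /lin !big_cons big_nil /=; split; field.
Qed.

Lemma reflect_swap_pair (x : R -> R) :
  reflect_along swap_pair x 2^-1 = (3 * x (5 / 6) - x 2^-1) / 2 /\
  reflect_along swap_pair x (5 / 6) = (x 2^-1 + x (5 / 6)) / 2.
Proof.
have [h1 h2 h3 h4] := bridge_cov_half.
rewrite /reflect_along /dual_path /swap_pair cov_pair !cov1_pair h1 h2 h3 h4.
by rewrite /lin !big_cons big_nil /=; split; field.
Qed.

(** In the coordinates U and V, not crossing means U (U + 2 V) > 0. For x and its tilt together this
    says |U| > 2 |V|, and for the two swapped paths |V| > 2 |U|. *)
Lemma reflections_cross (x : R -> R) :
  [\/ crosses x, crosses (reflect_along tilt_late x),
      crosses (reflect_along swap_pair x) |
      crosses (reflect_along swap_pair (reflect_along tilt_late x))].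
Proof.
rewrite /crosses.
have [-> ->] := reflect_swap_pair (reflect_along tilt_late x).
have [-> ->] := reflect_swap_pair x.
have [-> ->] := reflect_tilt_late x.
set u := x 2^-1; set w := x (5 / 6).
have [h1|h1] := leP (u * w) 0; first by constructor 1.
have [h2|h2] := leP (u * (2 / 3 * u - w)) 0; first by constructor 2.
have [h3|h3] := leP ((3 * w - u) / 2 * ((u + w) / 2)) 0; first by constructor 3.
have [h4|h4] := leP ((3 * (2 / 3 * u - w) - u) / 2 * ((u + (2 / 3 * u - w)) / 2)) 0.
  by constructor 4.
exfalso; have [u0|u0|u0] := ltgtP u 0; last by rewrite u0 mul0r ltxx in h1.
  have w0 : w < 0 by rewrite -(nmulr_rgt0 _ u0).
  rewrite nmulr_rgt0// in h2.
  have : 3 * w - u < 0 by nra.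
  have : u + w < 0 by lra.
  nra.
have w0 : 0 < w by rewrite -(pmulr_rgt0 _ u0).
rewrite pmulr_rgt0// in h2.
have : 0 < 3 * w - u by nra.
have : 0 < u + w by lra.
nra.
Qed.

(** The four reflected paths are bridges, and at each sample point one of them crosses. *)
Lemma bridge_crosses : ~ (forall X, is_bridge P b X -> {ae P, forall w, ~ crosses (X w)}).
Proof.
move=> h; have [h1 h2 h3 h4] := bridge_cov_half.
have t12 : unit_time (2^-1 : R) by apply/andP; split; lra.
have t56 : unit_time (5 / 6 : R) by apply/andP; split; lra.
have tt : times_in tilt_late by move=> p; rewrite !inE => /orP[|] /eqP ->.
have ts : times_in swap_pair by move=> p; rewrite !inE => /orP[|] /eqP ->.
have ct : cov tilt_late tilt_late != 0.
  by rewrite /tilt_late cov_pair !cov1_pair h1 h2 h3 h4; apply/eqP; lra.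
have cs : cov swap_pair swap_pair != 0.
  by rewrite /swap_pair cov_pair !cov1_pair h1 h2 h3 h4; apply/eqP; lra.
have b0 := bridge_refl bb.
have b1 := bridge_reflect bb b0 tt ct.
have b2 := bridge_reflect bb b0 ts cs.
have b3 := bridge_reflect bb b1 ts cs.
have [w [n0 [n1 [n2 n3]]]] := ae_ex (filterI (h _ b0) (filterI (h _ b1)
  (filterI (h _ b2) (h _ b3)))).
by case: (reflections_cross (b w)).
Qed.

End crossing.

(** * Contradiction from the invariance of |m| under the flip *)

Section no_symmetry.
Context {R : realType} {d} {Om : measurableType d} (P : probability Om R).
Variable b : Om -> R -> R.
Hypothesis bb : continuous_bridge P b.
Variable m : H R -> R.
Hypothesis mD : forall x y, m (x + y) = m x + m y.
Hypothesis mZ : forall a x, m (a *: x) = a * m x.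
Hypothesis flip_inv : forall X, is_bridge P b X ->
  {ae P, forall w, `|m (clsH (X w))| = `|m (clsH (flip_after_hit (X w)))|}.

Lemma reflect_cls l x : times_in l -> ucont 0 1 x ->
  m (clsH (reflect_along l x)) = m (clsH x) - 2 * lin l x * m (clsH (dual_path l)).
Proof.
move=> tl ux; have bx := ucont_bfun ux; have bd := ucont_bfun (ucont_dual_path tl).
rewrite -[m (clsH x)]mul1r -mulNr -!mZ -mD -clsH_lin//; congr (m _).
by apply: clsH_eq => r _; rewrite /reflect_along mul1r; ring.
Qed.

(** The dual path vanishes from 1/2 on, so the zero is not moved and the correction lies in the
    head, which the flip keeps: same sign as in [reflect_cls]. *)
Lemma flip_reflect_early x : ucont 0 1 x -> x 1 = 0 ->
  m (clsH (flip_after_hit (reflect_along early_tent x))) =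
  m (clsH (flip_after_hit x)) - 2 * lin early_tent x * m (clsH (dual_path early_tent)).
Proof.
move=> ux x1; have bx := ucont_bfun (ucont_flip ux).
have ur : ucont 0 1 (reflect_along early_tent x).
  have := ucont_lin 1 (- (2 * lin early_tent x)) ux (ucont_dual_path early_tent_times).
  by congr ucont; apply/funext => r; rewrite /reflect_along mul1r mulNr.
have bd := ucont_bfun (ucont_dual_path (@early_tent_times R)).
have late (r : R) : 2^-1 <= r -> dual_path early_tent r = 0.
  move=> r2; have r0 : 0 <= r by lra.
  by have [h _ _] := dual_path_early r0; exact: h.
have r1 : reflect_along early_tent x 1 = 0.
  by rewrite /reflect_along late ?x1 ?mulr0 ?subr0//; lra.
have hE : hit (reflect_along early_tent x) = hit x.
  by apply: eq_hit => r /andP[r2 _]; rewrite /reflect_along late// mulr0 subr0.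
have /andP[h2 _] := hit_unit x.
rewrite -[m (clsH (flip_after_hit x))]mul1r -mulNr -!mZ -mD -clsH_lin//; congr (m _).
apply: clsH_eq => r _; rewrite !flip_after_hitE// hE /reflect_along.
case: (leP r (hit x)) => rh; first by ring.
by rewrite late ?(le_trans h2 (ltW rh))//; ring.
Qed.

(** The crossing puts the zero before 5/6, so it is not moved and the correction lies in the tail,
    which the flip negates: opposite sign to [reflect_cls]. *)
Lemma flip_reflect_late x : ucont 0 1 x -> x 1 = 0 -> crosses x ->
  m (clsH (flip_after_hit (reflect_along late_tent x))) =
  m (clsH (flip_after_hit x)) + 2 * lin late_tent x * m (clsH (dual_path late_tent)).
Proof.
move=> ux x1 cx; have bx := ucont_bfun (ucont_flip ux).
have ur : ucont 0 1 (reflect_along late_tent x).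
  have := ucont_lin 1 (- (2 * lin late_tent x)) ux (ucont_dual_path late_tent_times).
  by congr ucont; apply/funext => r; rewrite /reflect_along mul1r mulNr.
have bd := ucont_bfun (ucont_dual_path (@late_tent_times R)).
have early (r : R) : r <= 5 / 6 -> dual_path late_tent r = 0.
  move=> r2; have r1 : r <= 1 by lra.
  by have [h _ _] := dual_path_late r1; exact: h.
have r1 : reflect_along late_tent x 1 = 0.
  by rewrite /reflect_along (dual_path01 (@late_tent_times R)).2 x1 mulr0 subr0.
have hE : hit x = hit (reflect_along late_tent x).
  apply: eq_hit_crossing cx => r /andP[_ r2].
  by rewrite /reflect_along early// mulr0 subr0.
have h2 := hit_le_crossing cx.
rewrite -[m (clsH (flip_after_hit x))]mul1r -!mZ -mD -clsH_lin//; congr (m _).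
apply: clsH_eq => r _; rewrite !flip_after_hitE// -hE /reflect_along.
case: (leP r (hit x)) => rh; last by ring.
by rewrite early ?(le_trans rh h2)//; ring.
Qed.

Lemma eq_normM (y z : R) : `|y| = `|z| -> (y - z) * (y + z) = 0.
Proof.
move=> yz; rewrite -subr_sqr -[y ^+ 2]real_normK ?num_real// yz.
by rewrite real_normK ?num_real// subrr.
Qed.

Hypothesis m_early : m (clsH (dual_path early_tent)) != 0.
Hypothesis m_late : m (clsH (dual_path late_tent)) != 0.

(** For y and z the values of m at the path and at its flip, (y - z) (y + z) = 0. The early
    reflection fixes y - z and lowers y + z by 4 l(X) m(dual path), so the two identities leave y -
    z = 0. *)
Lemma flip_value X : is_bridge P b X ->
  {ae P, forall w, m (clsH (X w)) = m (clsH (flip_after_hit (X w)))}.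
Proof.
move=> bX; have [cX X01 _] := bX.
have v0 : 0 < cov early_tent early_tent :> R by rewrite early_tent_var; lra.
have bY := bridge_reflect bb bX (@early_tent_times R) (lt0r_neq0 v0).
apply: filterS3 (flip_inv bX) (flip_inv bY) (bridge_lin_neq0 bb bX (@early_tent_times R) v0).
move=> w /eq_normM e1 /eq_normM + n0; have [_ x1] := X01 w.
rewrite (flip_reflect_early (cX w) x1) (reflect_cls (@early_tent_times R) (cX w)) => e2.
have : (m (clsH (X w)) - m (clsH (flip_after_hit (X w)))) *
    (4 * lin early_tent (X w) * m (clsH (dual_path early_tent))) = 0.
  by rewrite -[RHS](subrr (0 : R)) -{1}e1 -e2; ring.
move/eqP; rewrite mulf_eq0 => /orP[|]; first by rewrite subr_eq0 => /eqP.
by rewrite mulf_eq0 (negbTE m_early) mulf_eq0 (negbTE n0) pnatr_eq0.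
Qed.

(** On a crossing, the late reflection moves y and z in opposite directions, so y = z before and
    after gives 4 l(X) m(dual path) = 0. Hence no bridge ever crosses. *)
Lemma flip_symmetry_absurd : False.
Proof.
apply: (bridge_crosses bb) => X bX; have [cX X01 _] := bX.
have v0 : 0 < cov late_tent late_tent :> R by rewrite late_tent_var; lra.
have bY := bridge_reflect bb bX (@late_tent_times R) (lt0r_neq0 v0).
apply: filterS3 (flip_value bX) (flip_value bY) (bridge_lin_neq0 bb bX (@late_tent_times R) v0).
move=> w e1 + n0 cr; have [_ x1] := X01 w.
rewrite (flip_reflect_late (cX w) x1 cr) (reflect_cls (@late_tent_times R) (cX w)) e1 => e2.
have /eqP : 4 * lin late_tent (X w) * m (clsH (dual_path late_tent)) = 0 by lra.
by rewrite !mulf_eq0 (negbTE m_late) (negbTE n0) pnatr_eq0.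
Qed.

End no_symmetry.

Lemma absH_flip {R : realType} (x : R -> R) : ucont 0 1 x -> x 1 = 0 ->
  absH (clsH x) = absH (clsH (flip_after_hit x)).
Proof.
move=> ux x1; rewrite !absH_clsH; [|exact: ucont_bfun (ucont_flip ux)|exact: ucont_bfun].
apply: clsH_eq => r _; rewrite flip_after_hitE//; case: ifP => // _.
by rewrite normrN.
Qed.

Theorem theorem5p9 (R : realType)
  (* the Brownian bridge, its law mu and the law nu of its absolute value *)
  (d0 : measure_display) (Om0 : measurableType d0) (P0 : probability Om0 R)
  (beta : R -> Om0 -> R) (beta_bridge : brownian_bridge P0 beta)
  (mu : probability (H R) R) (mu_law : has_law P0 (path_class beta) mu)
  (nu : probability (K R) R)
  (nu_law : has_law P0 (fun w => absK (path_class beta w)) nu)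
  (* the semigroup of the Dirichlet form, and the diffusion *)
  (Q : {nonneg R} -> L2 nu -> L2 nu) (Q_form : semigroup_of_form Q)
  (d : measure_display) (Om : measurableType d)
  (F : {nonneg R} -> set (set Om)) (u : {nonneg R} -> Om -> K R)
  (P : K R -> probability Om R)
  (u_diffusion : diffusion F u P) (u_assoc : properly_associated Q u P)
  (* the white noise and the solutions of the stochastic heat equation *)
  (d' : measure_display) (Om' : measurableType d') (P' : probability Om' R)
  (W : L2 (spacetime R) -> Om' -> R) (W_noise : white_noise P' W)
  (v : H R -> {nonneg R} -> Om' -> H R)
  (v_solution : forall z, heat_solution P' W z (v z)) :
  (* mu(A) > 0, without presupposing that A is Borel *)
  exists B : set (H R),
    [/\ measurable B,
        B `<=` [set z | ~ same_law (pushforward (P (absK z)) (path_of u))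
                  (pushforward P' (path_of (fun t w => absK (v z t w))))] &
        (0 < mu B)%E].
Proof.
have [b bb bE] := bridge_version beta_bridge.
have e1 := @early_first_mode R; have e2 := @late_first_mode R.
pose tau1 : H R := clsH (dual_path early_tent); pose tau2 : H R := clsH (dual_path late_tent).
(* A single time t must serve both tents: [del] bounds exp (- rate 1 t) so that the geometric series
   is controlled and the first mode dominates on either dual path. *)
have [del [del0 del2 del_1 del_2]] : exists del : R, [/\ 0 < del, del <= 2^-1,
    del * (2 * `|tau1|) < ip tau1 (Defs.basis R 1) &
    del * (2 * `|tau2|) < ip tau2 (Defs.basis R 1)].
  have small (z : H R) : 0 < ip z (Defs.basis R 1) -> exists2 e : R, 0 < e &
      forall e', e' <= e -> e' * (2 * `|z|) < ip z (Defs.basis R 1).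
    move=> z0; have z1 : 0 < 2 * `|z| + 1 by rewrite ltr_wpDl// mulr_ge0.
    exists (ip z (Defs.basis R 1) / (2 * `|z| + 1)); first exact: divr_gt0.
    move=> e' he; apply: (@le_lt_trans _ _ (ip z (Defs.basis R 1) / (2 * `|z| + 1) * (2 * `|z|))).
      by rewrite ler_wpM2r// mulr_ge0.
    by rewrite mulrAC ltr_pdivrMr// ltr_pM2l// ltrDl.
  have [a1 a10 h1] := small _ e1; have [a2 a20 h2] := small _ e2.
  exists (Num.min 2^-1 (Num.min a1 a2)); split.
  - by rewrite !lt_min a10 a20 invr_gt0 ltr0n.
  - by rewrite ge_min lexx.
  - by apply: h1; rewrite !ge_min lexx orbT.
  - by apply: h2; rewrite !ge_min lexx !orbT.
have [t t0 tdel] := heat_decay del0.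
have pos (z : H R) : del * (2 * `|z|) < ip z (Defs.basis R 1) -> heat_value t z != 0.
  move=> hz; apply: lt0r_neq0.
  have hc : heat_mean t N z @[N --> \oo] --> heat_value t z.
    exact: (heat_mean_cvg W_noise v_solution t0).
  apply: (heat_mean_limit_gt0 hc); first exact: le_trans (ltW tdel) del2.
  by apply: le_lt_trans hz; rewrite ler_wpM2r ?mulr_ge0// ltW.
have [B [mB Bbad Beq]] := heat_detection u_diffusion W_noise v_solution t0.
(* Either some [B j] is the required set, or all are null; then a bridge and its flip almost surely
   avoid all of them, and |m| would be invariant under the flip. *)
have [[j muj]|mu0] := pselect (exists j, (0 < mu (B j))%E).
  by exists (B j); split.
have Bnull j : mu (B j) = 0%E.
  by apply/eqP; rewrite eq_le measure_ge0 andbT leNgt; apply/negP => h; apply: mu0; exists j.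
exfalso; apply: (flip_symmetry_absurd bb (heat_valueD W_noise v_solution t0)
  (heat_valueZ W_noise v_solution t0) _ (pos _ del_1) (pos _ del_2)).
move=> X bX; have [cX X01 _] := bX.
have av Y j (bY : is_bridge P0 b Y) := bridge_avoids_null bb bE mu_law bY (mB j) (Bnull j).
have a1 : {ae P0, forall w j, ~ B j (clsH (X w))} by apply: ae_foralln => j; exact: av.
have a2 : {ae P0, forall w j, ~ B j (clsH (flip_after_hit (X w)))}.
  by apply: ae_foralln => j; apply: (av (fun w => flip_after_hit (X w))); exact: bridge_flip.
apply: filterS2 a1 a2 => w n1 n2; have [_ x1] := X01 w.
by apply: Beq => //; exact: absH_flip.
Qed.
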